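(* Let $N\ge 2$, let $B\subset\mathbb{R}^N$ be a ball centered at the origin, let $1\le p\le N$, $0\le \alpha<N(p-1)$ and $q\in(p,q_0)$, where $q_0=q_0(N,p,\alpha)$ is defined in the context. Then there exists a number $\gamma^*\ge\alpha$ such that for every $\gamma>\gamma^*$ the following holds: no minimizer of the problem $$\inf\left\{\frac{\int_{B}|\nabla v|^p|x|^{\alpha}\,dx}{\left(\int_{B}|v|^q|x|^{\gamma}\,dx\right)^{p/q}}:\ v\in W_0^{1,p}(B,|x|^\alpha,|x|^\alpha)\setminus\{0\}\right\}$$ is radially symmetric.
   Context: For a bounded domain $\Omega\subset\mathbb{R}^N$ and $\alpha\in\mathbb{R}$, $L^p(\Omega,|x|^\alpha)$ is the space of measurable $u$ with $\|u\|_{p,\Omega,\alpha}:=(\int_\Omega|u|^p|x|^\alpha dx)^{1/p}<\infty$. The space $W^{1,p}(\Omega,|x|^\alpha,|x|^\alpha)$ is the set of $u\in L^p(\Omega,|x|^\alpha)$ having distributional first derivatives for which $\|u\|_{1,p,\Omega,\alpha,\alpha}:=[\|u\|_{p,\Omega,\alpha}^p+\||\nabla u|\|_{p,\Omega,\alpha}^p]^{1/p}$ is finite, and $W_0^{1,p}(\Omega,|x|^\alpha,|x|^\alpha)$ is the closure of $C_0^\infty(\Omega)$ in this norm (for $-N<\alpha<N(p-1)$). The exponent $q_0$ is: $q_0=+\infty$ if $p\ge N$ and $\alpha\le p-N$; $q_0=\frac{(2N-p+\alpha)p}{N-p+\alpha}$ if $p\ge N$ and $\alpha>p-N$; $q_0=\frac{Np}{N-p}$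 if $N>p$ and $\alpha\le 0$; $q_0=\frac{(N+\alpha)p}{N-p+\alpha}$ if $N>p$ and $\alpha>0$. A minimizer is an admissible function at which the infimum is attained. *)

(* Defs.v *)
From HB Require Import structures.
From mathcomp Require Import all_boot all_order all_algebra.
From mathcomp Require Import all_classical all_reals all_analysis.

Set Implicit Arguments.
Unset Strict Implicit.
Unset Printing Implicit Defensive.

Import Order.TTheory GRing.Theory Num.Theory.
Import numFieldNormedType.Exports.

Local Open Scope classical_set_scope.
Local Open Scope ring_scope.

(* The sigma-algebra on R^n generated by the coordinates, that is, the Borel
   one; it is the row-vector counterpart of the library's instance on
   [n.-tuple T]. *)
Definition row_display : measure_display -> measure_display.
Proof. exact. Qed.

Section measurable_row.
Context {R : realType} (n : nat).

Let coors : 'I_n -> 'rV[R]_n -> R := fun i x => x ord0 i.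

Let row_set0 : g_sigma_preimage coors set0.
Proof. exact: sigma_algebra0. Qed.

Let row_setC A : g_sigma_preimage coors A -> g_sigma_preimage coors (~` A).
Proof. exact: sigma_algebraC. Qed.

Let row_bigcup (F : _^nat) : (forall i, g_sigma_preimage coors (F i)) ->
  g_sigma_preimage coors (\bigcup_i (F i)).
Proof. exact: sigma_algebra_bigcup. Qed.

HB.instance Definition _ := @isMeasurable.Build
  (row_display default_measure_display)
  'rV[R]_n (g_sigma_preimage coors) row_set0 row_setC row_bigcup.

End measurable_row.

Lemma sigma_finite_prod d1 d2 (T1 : measurableType d1) (T2 : measurableType d2)
    (R : realType) (m1 : {sigma_finite_measure set T1 -> \bar R})
    (m2 : {sigma_finite_measure set T2 -> \bar R}) :
  sigma_finite setT (m1 \x m2)%E.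
Proof.
have /sigma_finiteP[F [TF ndF Foo]] := sigma_finiteT m1.
have /sigma_finiteP[G [TG ndG Goo]] := sigma_finiteT m2.
exists (fun k => F k `*` G k) => [|k].
  rewrite -setXTT TF TG predeqE => -[x y]; split.
    move=> [/= [i _ Fx] [k _ Gy]]; exists (maxn i k) => //; split.
    - by move: x Fx; exact/subsetPset/ndF/leq_maxl.
    - by move: y Gy; exact/subsetPset/ndG/leq_maxr.
  by move=> [i _ []/= ? ?]; split; exists i.
have [? ?] := Foo k; have [? ?] := Goo k.
split; first exact: measurableX.
by rewrite product_measure1E// lte_mul_pinfty// ge0_fin_numE.
Qed.

Section lebesgue_measure_row.
Context {R : realType}.

Definition consr n (z : measurableTypeR R * 'rV[R]_n) : 'rV[R]_n.+1 :=
  row_mx (const_mx z.1 : 'rV[R]_1) z.2.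

Let unconsr n (x : 'rV[R]_n.+1) : measurableTypeR R * 'rV[R]_n :=
  (x ord0 ord0, \row_j x ord0 (lift ord0 j)).

Lemma consr0 n (z : measurableTypeR R * 'rV[R]_n) : consr z ord0 ord0 = z.1.
Proof.
have -> : ord0 = lshift n (ord0 : 'I_1) :> 'I_n.+1 by exact/val_inj.
by rewrite (row_mxEl (const_mx z.1 : 'rV_1) z.2) mxE.
Qed.

Lemma consrS n (z : measurableTypeR R * 'rV[R]_n) (j : 'I_n) :
  consr z ord0 (lift ord0 j) = z.2 ord0 j.
Proof.
have -> : lift ord0 j = rshift 1 j :> 'I_n.+1 by exact/val_inj.
exact: (row_mxEr (const_mx z.1 : 'rV_1) z.2).
Qed.

Let consrK n : cancel (@consr n) (@unconsr n).
Proof.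
move=> [a y]; rewrite /unconsr consr0; congr pair.
by apply/rowP => j; rewrite mxE consrS.
Qed.

Lemma measurable_coord n (i : 'I_n) :
  measurable_fun [set: 'rV[R]_n] (fun x => x ord0 i : measurableTypeR R).
Proof.
move=> _ A mA; apply: sub_sigma_algebra.
case: n i => [[] []//|n i].
rewrite -bigcup_mkord_ord; exists i; first exact: ltn_ord.
by exists A => //; rewrite inord_val.
Qed.

Lemma measurable_fun_rowP d (T : measurableType d) n (f : T -> 'rV[R]_n) :
  (forall i, measurable_fun [set: T] (fun t => f t ord0 i : measurableTypeR R)) ->
  measurable_fun [set: T] f.
Proof.
move=> mf.
suff: g_sigma_preimage (fun i => (fun x : 'rV[R]_n => x ord0 i : R) \o f)
    `<=` measurable.
  rewrite g_sigma_preimage_comp => prefS _ A mA.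
  by apply: prefS; exists A.
apply: smallest_sub; first exact: sigma_algebra_measurable.
case: n => [|n] in f mf *; first by rewrite big_ord0.
rewrite -bigcup_mkord_ord; apply: bigcup_sub => i Ii.
by move=> A [B mB <-]; exact: mf.
Qed.

Let measurable_consr n : measurable_fun [set: _] (@consr n).
Proof.
apply: measurable_fun_rowP => i.
have [j ->|->] := unliftP ord0 i.
  apply: (@eq_measurable_fun _ _ _ _ _
      (fun z : measurableTypeR R * 'rV[R]_n => z.2 ord0 j)).
    by move=> z _; rewrite consrS.
  exact: (measurableT_comp (measurable_coord j) measurable_snd).
apply: (@eq_measurable_fun _ _ _ _ _ fst); last exact: measurable_fst.
by move=> z _; rewrite consr0.
Qed.

Let measurable_unconsr n : measurable_fun [set: _] (@unconsr n).
Proof.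
apply/measurable_fun_pairP; split; first exact: measurable_coord.
apply: measurable_fun_rowP => j.
apply: (@eq_measurable_fun _ _ _ _ _
    (fun x : 'rV[R]_n.+1 => x ord0 (lift ord0 j))).
  by move=> x _ /=; rewrite mxE.
exact: measurable_coord.
Qed.

Section extend.
Context n (m : {sigma_finite_measure set 'rV[R]_n -> \bar R}).

Definition lebesgue_consr : set 'rV[R]_n.+1 -> \bar R :=
  pushforward (@lebesgue_measure R \x m)%E (@consr n).

Let mc := @measurable_consr n.

Let lebesgue_consr0 : lebesgue_consr set0 = 0%E.
Proof. by rewrite /lebesgue_consr /pushforward preimage_set0 measure0. Qed.

Let lebesgue_consr_ge0 A : (0 <= lebesgue_consr A)%E.
Proof. by rewrite /lebesgue_consr /pushforward. Qed.

Let lebesgue_consr_sigma_additive : semi_sigma_additive lebesgue_consr.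
Proof. by rewrite /lebesgue_consr; exact: measure_semi_sigma_additive. Qed.

HB.instance Definition _ := isMeasure.Build _ _ _ lebesgue_consr
  lebesgue_consr0 lebesgue_consr_ge0 lebesgue_consr_sigma_additive.

Let lebesgue_consr_sigma_finite : sigma_finite setT lebesgue_consr.
Proof.
have [F TF Foo] := sigma_finite_prod (@lebesgue_measure R) m.
exists (fun k => @unconsr n @^-1` F k).
  by rewrite -preimage_bigcup -TF preimage_setT.
move=> k; have [mF Fk] := Foo k; split.
  by rewrite -[X in measurable X]setTI; exact: measurable_unconsr.
rewrite /lebesgue_consr /pushforward -comp_preimage.
by rewrite (_ : _ \o _ = id) ?preimage_id//; apply/funext => z; exact: consrK.
Qed.

HB.instance Definition _ := Measure_isSigmaFinite.Build _ _ _ lebesgue_consr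
  lebesgue_consr_sigma_finite.

End extend.

(* Lebesgue measure on R^n: the product of n copies of the one-dimensional
   one, see [lebesgue_row_box]. *)
Fixpoint lebesgue_row n : {sigma_finite_measure set 'rV[R]_n -> \bar R} :=
  match n with
  | 0 => \d_(0 : 'rV[R]_0)
  | n'.+1 => lebesgue_consr (lebesgue_row n')
  end.

Lemma lebesgue_row_box n (A : 'I_n -> set (measurableTypeR R)) :
  (forall i, measurable (A i)) ->
  lebesgue_row n [set x | forall i, A i (x ord0 i)] =
  (\prod_(i < n) lebesgue_measure (A i))%E.
Proof.
elim: n A => [|n IH] A mA.
  rewrite big_ord0 /= diracE mem_set// => -[].
  by [].
rewrite big_ord_recl -IH// /= /lebesgue_consr /pushforward.
rewrite -product_measure1E//; last first.
  rewrite [X in measurable X](_ : _ = \bigcap_(i in [set: 'I_n])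
      ((fun x : 'rV[R]_n => x ord0 i : measurableTypeR R) @^-1`
        A (lift ord0 i))).
    apply: fin_bigcap_measurable => // i _.
    by rewrite -[X in measurable X]setTI; exact: measurable_coord.
  by apply/seteqP; split=> x Ax i => [_|]; exact: Ax.
congr (_ _); apply/seteqP; split => z /=.
  move=> Az; split; first by have := Az ord0; rewrite consr0.
  by move=> i; have := Az (lift ord0 i); rewrite consrS.
move=> [A0 AS] i; have [j ->|->] := unliftP ord0 i; first by rewrite consrS.
by rewrite consr0.
Qed.

End lebesgue_measure_row.

Section weighted_sobolev.
Context {R : realType} {N : nat}.
Implicit Types (Omega : set 'rV[R]_N) (u v g phi : 'rV[R]_N -> R).
Implicit Types (p q alpha gamma : R).

Local Notation mu := (@lebesgue_row R N).

(* The library's norm on row vectors is the sup norm, which induces the same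
   topology but is not |x|. *)
Definition enorm (x : 'rV[R]_N) : R := Num.sqrt (\sum_i x ord0 i ^+ 2).

Definition eball (r : R) : set 'rV[R]_N := [set x | enorm x < r].

Definition partial (i : 'I_N) phi : 'rV[R]_N -> R :=
  fun x => 'D_(delta_mx ord0 i) phi x.

Definition iter_partial (s : seq 'I_N) phi := foldr partial phi s.

Definition smooth phi := forall s : seq 'I_N,
  continuous (iter_partial s phi) /\
  forall x i, derivable (iter_partial s phi) x (delta_mx ord0 i).

(* C_0^oo(Omega), the functions being extended by 0 outside Omega *)
Definition test_function Omega phi :=
  [/\ smooth phi, compact (closure [set x | phi x != 0])
    & closure [set x | phi x != 0] `<=` Omega].

Definition L1loc Omega u := measurable_fun Omega u /\
  forall K, K `<=` Omega -> compact K ->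
    (\int[mu]_(x in K) `|u x|%:E < +oo)%E.

Definition weak_partial (i : 'I_N) Omega u g :=
  [/\ L1loc Omega u, L1loc Omega g &
      forall phi, test_function Omega phi ->
        \int[mu]_(x in Omega) (u x * partial i phi x) =
        - \int[mu]_(x in Omega) (g x * phi x)].

(* The chosen representative of the distributional gradient; it is meaningful
   only when all the weak partial derivatives exist. *)
Definition wgrad Omega u (x : 'rV[R]_N) : 'rV[R]_N :=
  \row_i (get (weak_partial i Omega u) : 'rV[R]_N -> R) x.

(* The prefix w stands for the weight |x|^alpha. *)
Definition wint p alpha Omega u : \bar R :=
  (\int[mu]_(x in Omega) (`|u x| `^ p * enorm x `^ alpha)%:E)%E.

Definition wnorm p alpha Omega u : \bar R := (wint p alpha Omega u `^ p^-1)%E.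

Definition wLp p alpha Omega u :=
  measurable_fun Omega u /\ (wnorm p alpha Omega u < +oo)%E.

Definition wgradn Omega u (x : 'rV[R]_N) : R := enorm (wgrad Omega u x).

Definition wW1p_norm p alpha Omega u : \bar R :=
  ((wnorm p alpha Omega u `^ p + wnorm p alpha Omega (wgradn Omega u) `^ p)
     `^ p^-1)%E.

Definition wW1p p alpha Omega u :=
  [/\ wLp p alpha Omega u, forall i, exists g, weak_partial i Omega u g
    & (wW1p_norm p alpha Omega u < +oo)%E].

Definition wW1p0 p alpha Omega u := wW1p p alpha Omega u /\
  forall e : R, 0 < e -> exists2 phi, test_function Omega phi
    & (wW1p_norm p alpha Omega (fun x => u x - phi x)%R < e%:E)%E.

(* Both integrals may a priori be infinite, hence the extended reals. *)
Definition weighted_quotient p q alpha gamma Omega v : \bar R :=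
  (wint p alpha Omega (wgradn Omega v) / wint q gamma Omega v `^ (p / q))%E.

(* As a function space, W_0^{1,p} is taken modulo a.e. equality: nonzero means
   not a.e. zero. *)
Definition admissible p alpha Omega v :=
  wW1p0 p alpha Omega v /\ ~ {ae mu, forall x, Omega x -> v x = 0}.

Definition minimizer p q alpha gamma Omega v :=
  admissible p alpha Omega v /\
  weighted_quotient p q alpha gamma Omega v =
  ereal_inf [set weighted_quotient p q alpha gamma Omega w
            | w in admissible p alpha Omega].

Definition radially_symmetric Omega v :=
  exists f : R -> R, {ae mu, forall x, Omega x -> v x = f (enorm x)}.

End weighted_sobolev.
Arguments eball {R} N r.

Definition q0 {R : realType} (N : nat) (p alpha : R) : \bar R :=
  if N%:R <= p then
    if alpha <= p - N%:R then +oo%E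
    else ((2 * N%:R - p + alpha) * p / (N%:R - p + alpha))%:E
  else
    if alpha <= 0 then (N%:R * p / (N%:R - p))%:E
    else ((N%:R + alpha) * p / (N%:R - p + alpha))%:E.

(* Main.v *)
From HB Require Import structures.
Require Import Defs.
From mathcomp Require Import all_boot all_order all_algebra.
From mathcomp Require Import all_classical all_reals all_analysis.
From mathcomp Require Import measurable_realfun.
From mathcomp Require Import ring lra.

Set Implicit Arguments.
Unset Strict Implicit.
Unset Printing Implicit Defensive.

Import Order.TTheory GRing.Theory Num.Theory.
Import numFieldNormedType.Exports.

Local Open Scope classical_set_scope.
Local Open Scope ring_scope.

(** For large gamma the weight |x|^gamma only sees the layer of width about
1/gamma along the boundary sphere |x| = r. A radial function has to fill the
whole layer, while a bump of diameter about 1/gamma fills one of the roughly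
gamma^(N-1) cells of that size in the layer; since p < q, the quotient rewards
concentration, and the bump wins.

Write D(v) and W(v) for the numerator integral and for the integral in the
denominator. A product bump rescaled by 1/gamma and centred at
(r - 2N/gamma) e_1 satisfies D <= A gamma^(p-N) and
W >= B r^gamma gamma^(-N), with A and B independent of gamma
([competitor_bounds]).

For the radial side, a test function vanishes on |x| = r, so its value at
distance s from the origin is an integral of its gradient along a ray. Averaged
over directions and combined with the bound E on the gradient integral, this
bounds its mean over the sphere of radius s by a constant times
E^(1/p) s^(-(alpha+N-1)/p) (r-s)^(1-1/p) ([sphere_bound]). The bound survives
the passage to the limit defining W_0 as soon as 2^p D(v) < E, for almost
every s ([sphere_limit]). If v is radial then |v| is constant on almost every
sphere ([radial_sph]), so that the bound on the mean is a pointwise one, and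
integration gives
W(v) <= C E^(q/p) int_0^r s^m (r-s)^k ds <= C' E^(q/p) r^gamma gamma^(-k-1)
with k = q (1 - 1/p) and m = gamma + O(1) ([radial_wint_le],
[profile_integral_le]).

Let v be a radial minimizer and U an upper bound for the quotient of the bump.
Then D(v) <= U W(v)^(p/q), and E can be taken to be 2^(p+1) U W(v)^(p/q). The
factor W(v) cancels from the radial estimate, and what remains is
1 <= C'' gamma^(-(N-1)(q/p-1)) ([exponent_bound]), which fails for large gamma
because N >= 2 and p < q.

Two facts about the ambient objects carry this argument: polar coordinates
([polar_coordinates]), and the almost everywhere uniqueness of weak derivatives
([du_bois_reymond], [wgrad_ae_eq]), through which the gradient chosen in the
definition of the norm agrees with the classical one on test functions and is
additive. *)

(** * Borel sets and Lebesgue measure on row vectors *)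

Section row_measure.
Context {R : realType}.

Definition obox n (a b : 'I_n -> R) : set 'rV[R]_n :=
  [set x | forall i, a i < x ord0 i < b i].

Lemma oboxE n (a b : 'I_n -> R) :
  obox a b = [set x | forall i, (`]a i, b i[%classic : set R) (x ord0 i)].
Proof.
by apply/seteqP; split => x xab i; have := xab i; rewrite /= in_itv.
Qed.

Lemma measurable_box n (A : 'I_n -> set (measurableTypeR R)) :
  (forall i, measurable (A i)) -> measurable [set x : 'rV[R]_n | forall i, A i (x ord0 i)].
Proof.
move=> mA; rewrite [X in measurable X](_ : _ = \bigcap_(i in [set: 'I_n])
    ((fun x : 'rV[R]_n => x ord0 i : measurableTypeR R) @^-1` A i)).
  apply: fin_bigcap_measurable => // i _.
  by rewrite -[X in measurable X]setTI; exact: measurable_coord.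
by apply/seteqP; split=> x Ax i => [_|]; exact: Ax.
Qed.

Lemma measurable_obox n (a b : 'I_n -> R) : measurable (obox a b).
Proof. rewrite oboxE.
by apply: (@measurable_box n (fun i => `]a i, b i[%classic)) => i; exact: measurable_itv. Qed.

Lemma lebesgue_obox n (a b : 'I_n -> R) : (forall i, a i <= b i) ->
  lebesgue_row n (obox a b) = (\prod_(i < n) (b i - a i))%:E.
Proof.
move=> ab; rewrite oboxE (@lebesgue_row_box _ n (fun i => `]a i, b i[%classic)); last first.
  by move=> i; exact: measurable_itv.
rewrite -prodEFin; apply: eq_bigr => i _.
rewrite lebesgue_measure_itv/= lte_fin; case: ltgtP (ab i) => // -> _.
by rewrite subrr.
Qed.

Lemma lebesgue_obox_lty n (a b : 'I_n -> R) : (lebesgue_row n (obox a b) < +oo)%E.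
Proof.
apply: (@le_lt_trans _ _ (lebesgue_row n (obox a (fun i => Num.max (a i) (b i))))).
  apply: le_measure; rewrite ?inE; try exact: measurable_obox.
  by move=> x xab i; have /andP[-> /= ?] := xab i; rewrite lt_max orbC (_ : _ < b i).
by rewrite lebesgue_obox ?ltry// => i; rewrite le_max lexx.
Qed.

Lemma row_ballP n (x : 'rV[R]_n) (e : R) (y : 'rV[R]_n) : 0 < e ->
  ball x e y <-> forall i, `|x ord0 i - y ord0 i| < e.
Proof.
move=> e0; split=> [[_ +] i|xy]; first exact.
by split=> // i j; rewrite ord1; exact: xy.
Qed.

Definition cbox n (a b : 'I_n -> R) : set 'rV[R]_n :=
  [set x | forall i, a i <= x ord0 i <= b i].

(** Boxes with rational corners suffice, so there are countably many. The closed
boxes are kept inside the set as well, which makes their indicators limits of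
test functions. *)
Lemma open_box_cover n (A : set 'rV[R]_n) : open A ->
  exists (D : set nat) (a b : nat -> 'I_n -> R),
    A = \bigcup_(k in D) obox (a k) (b k) /\
    forall k, D k -> cbox (a k) (b k) `<=` A.
Proof.
move=> oA.
(* the boxes are enumerated by their rational corners *)
pose c (k : nat) : option {ffun 'I_n -> rat * rat} := unpickle k.
pose a k i : R := if c k is Some p then ratr (p i).1 else 0.
pose b k i : R := if c k is Some p then ratr (p i).2 else 0.
exists [set k | cbox (a k) (b k) `<=` A], a, b; split => //.
apply/seteqP; split; last first.
  by move=> x [k] /= + xab; apply => i; have /andP[? ?] := xab i; rewrite !ltW.
move=> x Ax; have /nbhs_ballP[e /= e0 xeA] := oA _ Ax.
have H i : exists p : rat * rat, (x ord0 i - e < ratr p.1 < x ord0 i) &&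
    (x ord0 i < ratr p.2 < x ord0 i + e).
  have /rat_in_itvoo[q1] : x ord0 i - e < x ord0 i by rewrite ltrBlDr ltrDl.
  have /rat_in_itvoo[q2] : x ord0 i < x ord0 i + e by rewrite ltrDl.
  by rewrite !in_itv/= => h1 h2; exists (q1, q2); rewrite /= h2 h1.
have [p Hp] := choice H; exists (pickle (finfun p)).
  move=> y /= yp; apply: xeA; apply/row_ballP => // i.
  have /andP[/andP[h1 h2] /andP[h3 h4]] := Hp i; have := yp i.
  rewrite /a /b /c pickleK ffunE => /andP[y1 y2].
  rewrite ltr_norml; apply/andP; split.
    rewrite ltrBrDl ltrBlDr.
    exact: le_lt_trans y2 _.
  by rewrite ltrBlDl -ltrBlDr; exact: lt_le_trans y1.
move=> i; have /andP[/andP[_ h2] /andP[h3 _]] := Hp i.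
by rewrite /a /b /c pickleK ffunE h2.
Qed.

Lemma open_measurable_row n (A : set 'rV[R]_n) : open A -> measurable A.
Proof.
move=> /open_box_cover[D [a [b [-> _]]]].
by apply: bigcup_measurable => k _; exact: measurable_obox.
Qed.

Lemma closed_measurable_row n (A : set 'rV[R]_n) : closed A -> measurable A.
Proof. by move/closed_openC/open_measurable_row/measurableC; rewrite setCK. Qed.

Lemma continuous_measurable_row n (f : 'rV[R]_n -> R) :
  continuous f -> measurable_fun setT f.
Proof.
move=> /continuousP cf; apply: (measurability _ (RGenOpens.measurableE R)) => //.
move=> _ [_ [a [b ->] <-]]; apply: open_measurable_row; rewrite setTI.
by apply: cf; exact: itv_open.
Qed.

Lemma obox_setI n (a b c d : 'I_n -> R) : obox a b `&` obox c d =
  obox (fun i => Num.max (a i) (c i)) (fun i => Num.min (b i) (d i)).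
Proof.
apply/seteqP; split => x.
  move=> [h1 h2] i; have /andP[? ?] := h1 i; have /andP[? ?] := h2 i.
  by rewrite gt_max lt_min; apply/andP; split; apply/andP.
move=> h; split => i; have := h i; rewrite gt_max lt_min => /andP[/andP[? ?] /andP[? ?]];
  by apply/andP.
Qed.

Definition obox_sets n : set (set 'rV[R]_n) :=
  [set A | exists a b, A = obox a b].

Lemma obox_cover n : \bigcup_k obox (fun _ : 'I_n => - k%:R) (fun=> k%:R) = [set: 'rV[R]_n].
Proof.
apply/seteqP; split => // x _.
exists (Num.truncn (\sum_i `|x ord0 i|)).+1 => // i.
rewrite -ltr_norml; apply: le_lt_trans (truncnS_gt _).
by rewrite (bigD1 i)//= lerDl sumr_ge0.
Qed.

(** A slab between two coordinate hyperplanes is a countable union of open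
boxes, so the boxes generate the product sigma-algebra; being stable under
intersection they also determine measures, which is how the scaling behaviour of
Lebesgue measure is obtained. *)
Lemma measurable_rowE n : @measurable _ 'rV[R]_n = <<s @obox_sets n >>.
Proof.
apply/seteqP; split; last first.
  apply: smallest_sub; first exact: sigma_algebra_measurable.
  by move=> _ [a [b ->]]; exact: measurable_obox.
apply: smallest_sub; first exact: smallest_sigma_algebra.
case: n => [|n]; first by rewrite big_ord0.
rewrite -bigcup_mkord_ord; apply: bigcup_sub => i _.
move=> _ [A mA <-]; rewrite setTI.
set f := fun x : 'rV[R]_n.+1 => x ord0 (inord i).
pose ST : measurableType _ := g_sigma_algebraType (@obox_sets n.+1).
suff mf : @measurable_fun _ _ ST (measurableTypeR R) setT f.
  by have := mf measurableT _ mA; rewrite setTI.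
apply: (measurability _ (RGenOpens.measurableE R)) => //.
move=> _ [_ [a [b ->] <-]]; rewrite setTI.
have -> : f @^-1` `]a, b[%classic = \bigcup_k (obox
    (fun j : 'I_n.+1 => if j == inord i then a else - k%:R)
    (fun j => if j == inord i then b else k%:R)).
  apply/seteqP; split => x /=; rewrite /f in_itv/=.
    have : setT x by [].
    rewrite -obox_cover => -[k _ xk] xab; exists k => // j.
    by case: eqP => [->//|_]; exact: xk.
  by move=> [k _ /(_ (inord i))]; rewrite eqxx.
apply: (@bigcupT_measurable _ ST) => k; apply: sub_sigma_algebra.
by eexists; eexists.
Qed.

Lemma row_measure_unique n (m1 m2 : {measure set 'rV[R]_n -> \bar R}) :
  (forall a b, m1 (obox a b) = m2 (obox a b)) ->
  (forall a b, m1 (obox a b) < +oo)%E ->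
  forall A, measurable A -> m1 A = m2 A.
Proof.
move=> m12 m1oo A mA.
apply: (measure_unique (@obox_sets n) (fun k => obox (fun=> - k%:R) (fun=> k%:R))) => //.
- exact: measurable_rowE.
- by move=> _ _ [a [b ->]] [c [d ->]]; rewrite obox_setI; eexists; eexists.
- by move=> k; eexists; eexists.
- exact: obox_cover.
- by move=> _ [a [b ->]].
Qed.

Lemma measurable_affine_row n (a : R) (b : 'rV[R]_n) :
  measurable_fun setT (fun x : 'rV[R]_n => a *: x + b).
Proof.
apply: measurable_fun_rowP => i.
apply: (@eq_measurable_fun _ _ _ _ _ (fun x : 'rV[R]_n => a * x ord0 i + b ord0 i)).
  by move=> x _; rewrite !mxE.
apply: measurable_funD; last exact: measurable_cst.
by apply: measurable_funM; [exact: measurable_cst|exact: measurable_coord].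
Qed.

Lemma preimage_affine_obox n (a : R) (b : 'rV[R]_n) (c d : 'I_n -> R) : 0 < a ->
  (fun x : 'rV[R]_n => a *: x + b) @^-1` obox c d =
  obox (fun i => (c i - b ord0 i) / a) (fun i => (d i - b ord0 i) / a).
Proof.
move=> a0; apply/seteqP; split => x xcd i; have := xcd i; rewrite !mxE;
  by rewrite ltr_pdivrMr// ltr_pdivlMr// ltrBlDr ltrBrDr (mulrC _ a).
Qed.

(** Both sides are measures in [A], and they agree on boxes. *)
Lemma lebesgue_row_affine n (a : R) (b : 'rV[R]_n) (A : set 'rV[R]_n) :
  0 < a -> measurable A ->
  lebesgue_row n ((fun x => a *: x + b) @^-1` A) = ((a ^- n)%:E * lebesgue_row n A)%E.
Proof.
move=> a0 mA; have an0 : 0 <= a ^- n by rewrite invr_ge0 exprn_ge0// ltW.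
have mf := @measurable_affine_row n a b.
rewrite -[LHS]/(pushforward (lebesgue_row n) (fun x => a *: x + b) A).
rewrite -[RHS]/(mscale (NngNum an0) (lebesgue_row n) A).
apply: row_measure_unique => //.
  move=> c d; rewrite [LHS](_ : _ = lebesgue_row n ((fun x => a *: x + b) @^-1` (obox c d)))//.
  rewrite [RHS](_ : _ = ((a ^- n)%:E * lebesgue_row n (obox c d))%E)//.
  rewrite preimage_affine_obox//.
  have [/forallP cd|] := boolP [forall i, c i <= d i].
    rewrite !lebesgue_obox; last 2 first.
    - exact: cd.
    - by move=> i; rewrite ler_pM2r ?invr_gt0// lerD2r; exact: cd.
    rewrite -EFinM; congr EFin.
    rewrite (_ : a ^- n = \prod_(i < n) a^-1); last by rewrite prodr_const card_ord exprVn.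
    rewrite -big_split/=; apply: eq_bigr => i _.
    by rewrite -mulrBl opprD addrACA opprK addNr addr0 mulrC.
  rewrite negb_forall => /existsP[i]; rewrite -ltNge => cdi.
  rewrite (_ : obox _ _ = set0); last first.
    apply/seteqP; split => // x /(_ i)/andP[h1 /(lt_trans h1)].
    by rewrite ltr_pM2r ?invr_gt0// ltrD2r ltNge ltW.
  rewrite (_ : obox _ _ = set0); last first.
    by apply/seteqP; split => // x /(_ i)/andP[h1 /(lt_trans h1)]; rewrite ltNge ltW.
  by rewrite !measure0 mule0.
move=> c d; rewrite [ltLHS](_ : _ = lebesgue_row n ((fun x => a *: x + b) @^-1` (obox c d)))//.
by rewrite preimage_affine_obox// lebesgue_obox_lty.
Qed.

Lemma ge0_integral_affine_row n (a : R) (b : 'rV[R]_n) (f : 'rV[R]_n -> \bar R) :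
  0 < a -> measurable_fun setT f -> (forall x, 0 <= f x)%E ->
  (\int[lebesgue_row n]_x f (a *: x + b)%R =
   (a ^- n)%:E * \int[lebesgue_row n]_x f x)%E.
Proof.
move=> a0 mf f0; have an0 : 0 <= a ^- n by rewrite invr_ge0 exprn_ge0// ltW.
have mphi := @measurable_affine_row n a b.
transitivity (\int[pushforward (lebesgue_row n) (fun x => (a *: x + b)%R)]_x f x)%E.
  by rewrite ge0_integral_pushforward.
rewrite -(ge0_integral_mscale _ measurableT (NngNum an0))//.
by apply: eq_measure_integral => A mA _; exact: lebesgue_row_affine.
Qed.

Lemma integral_translate_row n (b : 'rV[R]_n) (f : 'rV[R]_n -> \bar R) :
  measurable_fun setT f ->
  (\int[lebesgue_row n]_x f (x + b)%R = \int[lebesgue_row n]_x f x)%E.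
Proof.
move=> mf.
have H g : measurable_fun setT g -> (forall x, 0 <= g x)%E ->
    (\int[lebesgue_row n]_x g (x + b)%R = \int[lebesgue_row n]_x g x)%E.
  move=> mg g0; have := ge0_integral_affine_row b (@ltr01 R) mg g0.
  rewrite expr1n invr1 mul1e => <-.
  by apply: eq_integral => x _; rewrite scale1r.
rewrite integralE [RHS]integralE; congr (_ - _)%E.
  rewrite -(H f^\+%E (measurable_funepos mf)); last by move=> x; exact: funepos_ge0.
  by apply: eq_integral => x _; rewrite !funeposE.
rewrite -(H f^\-%E (measurable_funeneg mf)); last by move=> x; exact: funeneg_ge0.
by apply: eq_integral => x _; rewrite !funenegE.
Qed.

Lemma lebesgue_measure_scale (a : R) (A : set (measurableTypeR R)) :
  0 < a -> measurable A ->
  (lebesgue_measure A = a%:E * lebesgue_measure (( *%R a) @^-1` A))%E.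
Proof.
move=> a0 mA; have a0' := ltW a0.
have mf : @measurable_fun _ _ (measurableTypeR R) (measurableTypeR R) setT ( *%R a).
  exact: mulrl_measurable.
pose m := measure_function_pushforward__canonical__measure_function_Measure
  (@lebesgue_measure R) mf.
rewrite -[RHS]/(mscale (NngNum a0') m A).
apply: lebesgue_measure_unique => // _ [[c d] _ <-].
rewrite [RHS](_ : _ = (a%:E * lebesgue_measure (( *%R a) @^-1` `]c, d]%classic))%E)//.
rewrite (_ : ( *%R a) @^-1` `]c, d]%classic = `]c / a, d / a]%classic); last first.
  by apply/seteqP; split => x /=; rewrite !in_itv/= ltr_pdivrMr// ler_pdivlMr// mulrC.
rewrite !lebesgue_measure_itv/= !lte_fin ltr_pM2r ?invr_gt0//.
case: ifPn => _; last by rewrite mule0.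
by rewrite -EFinM mulrBr !mulrA !(mulrC a) !mulfK ?gt_eqF.
Qed.

Lemma ge0_integral_scale (a : R) (f : R -> \bar R) :
  0 < a -> measurable_fun setT f -> (forall x, 0 <= f x)%E ->
  (\int[@lebesgue_measure R]_x f x = a%:E * \int[@lebesgue_measure R]_x f (a * x)%R)%E.
Proof.
move=> a0 mf f0; have a0' := ltW a0.
have mphi : @measurable_fun _ _ (measurableTypeR R) (measurableTypeR R) setT ( *%R a).
  exact: mulrl_measurable.
pose m := measure_function_pushforward__canonical__measure_function_Measure
  (@lebesgue_measure R) mphi.
transitivity (a%:E * \int[m]_x f x)%E; last first.
  by rewrite ge0_integral_pushforward.
rewrite -(@ge0_integral_mscale _ _ _ m setT measurableT (NngNum a0') f)//.
by apply: eq_measure_integral => A mA _; exact: lebesgue_measure_scale.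
Qed.

Lemma continuous_enorm n : continuous (@enorm R n).
Proof.
move=> x; apply: continuous_comp; last exact: sqrt_continuous.
apply: (continuous_big add_continuous (F := fun i (y : 'rV[R]_n) => y ord0 i ^+ 2)).
by move=> i _ y; apply: continuousM; exact: coord_continuous.
Qed.

Lemma measurable_enorm n : measurable_fun setT (@enorm R n).
Proof. by apply: continuous_measurable_row; exact: continuous_enorm. Qed.

Lemma open_eball n (r : R) : open (@eball R n r).
Proof.
rewrite (_ : eball n r = (@enorm R n) @^-1` [set s | s < r])//.
by apply: open_comp; [move=> x _; exact: continuous_enorm|exact: open_lt].
Qed.

Lemma enorm_ge0 n (x : 'rV[R]_n) : 0 <= enorm x.
Proof. exact: sqrtr_ge0. Qed.

Lemma le_coord_enorm n (x : 'rV[R]_n) i : `|x ord0 i| <= enorm x.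
Proof.
rewrite /enorm -sqrtr_sqr ler_wsqrtr// (bigD1 i)//= lerDl.
by apply: sumr_ge0 => j _; exact: sqr_ge0.
Qed.

Lemma enorm_le_sum n (x : 'rV[R]_n) : enorm x <= \sum_i `|x ord0 i|.
Proof.
have s0 : 0 <= \sum_i `|x ord0 i| by exact: sumr_ge0.
rewrite /enorm -[leRHS]ger0_norm// -sqrtr_sqr ler_wsqrtr//.
rewrite expr2 mulr_suml; apply: ler_sum => i _.
rewrite -real_normK ?num_real// expr2.
by rewrite ler_wpM2l// (bigD1 i)//= lerDl sumr_ge0.
Qed.

Lemma enormZ n (a : R) (x : 'rV[R]_n) : enorm (a *: x) = `|a| * enorm x.
Proof.
rewrite /enorm -sqrtr_sqr -sqrtrM ?sqr_ge0// mulr_sumr; congr Num.sqrt.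
by apply: eq_bigr => i _; rewrite mxE exprMn.
Qed.

Lemma enorm0 n : enorm (0 : 'rV[R]_n) = 0.
Proof. by rewrite -(scale0r (0 : 'rV[R]_n)) enormZ normr0 mul0r. Qed.

Lemma enorm_eq0 n (x : 'rV[R]_n) : (enorm x == 0) = (x == 0).
Proof.
apply/eqP/eqP => [x0|->]; last exact: enorm0.
apply/rowP => i; rewrite mxE; apply/eqP; rewrite -normr_le0 -x0.
exact: le_coord_enorm.
Qed.

End row_measure.

(** * Smooth bumps and product test functions *)

Section smooth1.
Context {R : realType}.
Implicit Types f g : R -> R.

(** Only differentiability at each order is recorded, not continuity of the last
derivative: quantified over all [n], this is the same as smoothness. *)
Fixpoint Ck n f : Prop :=
  if n is n'.+1 then (forall x, derivable f x 1) /\ Ck n' (derive1 f) else True.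

Definition smooth1 f := forall n, Ck n f.

Lemma smooth1_derivable f x : smooth1 f -> derivable f x 1.
Proof. by move=> /(_ 1%N)[]. Qed.

Lemma smooth1_derive f : smooth1 f -> smooth1 (derive1 f).
Proof. by move=> sf n; have [] := sf n.+1. Qed.

Lemma derivable_continuous1 f x : derivable f x 1 -> {for x, continuous f}.
Proof. by move=> /derivable1_diffP/differentiable_continuous. Qed.

Lemma smooth1_continuous f : smooth1 f -> continuous f.
Proof. by move=> sf x; apply/derivable_continuous1/smooth1_derivable. Qed.

Lemma CkS n f : Ck n.+1 f -> Ck n f.
Proof.
elim: n f => // n IH f [df] Cf; split=> //; exact: IH.
Qed.

Lemma is_derive_derive1 f f' : (forall x : R, is_derive x 1 f (f' x)) -> derive1 f = f'.
Proof. by move=> ff'; apply/funext => x; rewrite derive1E; case: (ff' x). Qed.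

Lemma derive1_is_derive f x : derivable f x 1 -> is_derive x 1 f (derive1 f x).
Proof. by move=> df; rewrite derive1E; exact: derivableP. Qed.

Lemma CkD n f g : Ck n f -> Ck n g -> Ck n (f \+ g).
Proof.
elim: n f g => // n IH f g [df Cf] [dg Cg]; split.
  by move=> x; exact: derivableD.
rewrite (_ : derive1 (f \+ g) = derive1 f \+ derive1 g); first exact: IH.
apply: is_derive_derive1 => x.
by apply: is_deriveD; exact: derive1_is_derive.
Qed.

Lemma CkM n f g : Ck n f -> Ck n g -> Ck n (f \* g).
Proof.
elim: n f g => // n IH f g Cf Cg; have [df Cf'] := Cf; have [dg Cg'] := Cg; split.
  by move=> x; exact: derivableM.
rewrite (_ : derive1 (f \* g) = (f \* derive1 g) \+ (g \* derive1 f)).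
  by apply: CkD; apply: IH => //; exact: CkS.
apply: is_derive_derive1 => x.
by apply: is_deriveM; exact: derive1_is_derive.
Qed.

Lemma is_derive_affine f (a b x : R) : derivable f (a * x + b) 1 ->
  is_derive x 1 (fun t => f (a * t + b)) (a * derive1 f (a * x + b)).
Proof.
move=> df.
have h : is_derive x 1 (fun t : R => a * t + b) (a *: 1 + 0).
  apply: is_deriveD; exact: is_deriveZ.
have := @is_derive1_comp R f (fun t => a * t + b) x _ _ (derive1_is_derive df) h.
by rewrite addr0 /= scaler1 mulrC; exact.
Qed.

Lemma Ck_cst n (c : R) : Ck n (cst c).
Proof.
elim: n c => // n IH c; split=> [x|]; first exact: derivable_cst.
rewrite (_ : derive1 (cst c) = cst 0); first exact: IH.
by apply: is_derive_derive1 => x; exact: is_derive_cst.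
Qed.

Lemma Ck_affine n f (a b : R) : Ck n f -> Ck n (fun t => f (a * t + b)).
Proof.
elim: n f => // n IH f [df Cf]; split=> [x|].
  by have [] := is_derive_affine (df (a * x + b)).
rewrite (_ : derive1 _ = cst a \* (fun t => derive1 f (a * t + b))).
  by apply: CkM; [exact: Ck_cst|exact: IH].
by apply: is_derive_derive1 => x; exact: is_derive_affine.
Qed.

Lemma smooth1M f g : smooth1 f -> smooth1 g -> smooth1 (f \* g).
Proof. by move=> sf sg n; exact: CkM. Qed.

Lemma smooth1_affine f (a b : R) : smooth1 f -> smooth1 (fun t => f (a * t + b)).
Proof. by move=> sf n; exact: Ck_affine. Qed.

(** Polynomials in 1/t times exp(-1/t) form a class closed under
differentiation, extended by 0 to t <= 0; this gives the smoothness of exp(-1/t)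
by induction on the order without an explicit formula for the derivatives. *)
Definition flat (P : {poly R}) (t : R) : R :=
  if 0 < t then P.[t^-1] * expR (- t^-1) else 0.

(** The exponential beats the polynomial: exp(1/t) is at least one term of its
series, of degree two more than needed to absorb P(1/t). The factor t^2 left over
makes the derivative at 0 vanish. *)
Lemma flat_bound (P : {poly R}) : exists2 C : R, 0 <= C &
  forall t, 0 < t -> t < 1 -> `|flat P t| <= C * t ^+ 2.
Proof.
pose d := size P; pose K := \sum_(i < d) `|P`_i|.
have K0 : 0 <= K by exact: sumr_ge0.
exists (K * (d.+2)`!%:R); first by rewrite mulr_ge0.
move=> t t0 t1; rewrite /flat t0 normrM.
have s1 : 1 <= t^-1 by rewrite invf_ge1// ltW.
have s0 : 0 < t^-1 by rewrite invr_gt0.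
have hP : `|P.[t^-1]| <= K * t^-1 ^+ d.
  rewrite horner_coef mulr_suml; apply: le_trans (ler_norm_sum _ _ _) _.
  apply: ler_sum => i _; rewrite normrM ler_wpM2l// normrX (ger0_norm (ltW s0)).
  by rewrite ler_weXn2l// ltnW.
rewrite (ger0_norm (expR_ge0 _)).
have he : expR (- t^-1) <= (d.+2)`!%:R * t ^+ d.+2.
  rewrite expRN -[leRHS]invrK lef_pV2 ?posrE ?expR_gt0//; last first.
    by rewrite invr_gt0 mulr_gt0 ?exprn_gt0 ?ltr0n ?fact_gt0.
  rewrite invfM -exprVn mulrC; apply: le_trans (expR_ge1Dxn d.+1 (ltW s0)).
  by rewrite lerDr.
apply: le_trans (ler_pM _ _ hP he) _ => //.
rewrite mulrACA (_ : t^-1 ^+ d * t ^+ d.+2 = t ^+ 2)//.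
by rewrite -[d.+2]addn2 exprD mulrA -exprMn mulVf ?gt_eqF// expr1n mul1r.
Qed.

Lemma is_derive_flat (P : {poly R}) (t : R) :
  is_derive t 1 (flat P) (flat ('X^2 * (P - P^`())) t).
Proof.
have [t0|t0|t0] := ltgtP t 0.
- rewrite {2}/flat ltNge (ltW t0)/=.
  have d0 : is_derive t 1 (cst 0 : R -> R) (0 : R) by exact: is_derive_cst.
  apply: near_eq_is_derive d0.
  near=> x; rewrite /flat ltNge (_ : x <= 0)//=.
  by near: x; apply: filterS (lt_nbhsl t0) => x; exact: ltW.
- have nf : \near t, P.[t^-1] * expR (- t^-1) = flat P t.
    near=> x; rewrite /flat (_ : 0 < x)//.
    by near: x; exact: (lt_nbhsr t0).
  apply: near_eq_is_derive nf _.
  have tn0 : t != 0 by rewrite gt_eqF.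
  have dV : is_derive t 1 (fun x : R => x^-1) (- t ^- 2 *: 1).
    exact: is_deriveV.
  have dP : is_derive (t^-1) 1 (horner P) (P^`()).[t^-1].
    by rewrite derivE; apply: derive1_is_derive; exact: derivable_horner.
  have d1 : is_derive t 1 (fun x : R => P.[x^-1]) ((P^`()).[t^-1] * (- t ^- 2 *: 1)).
    exact: (is_derive1_comp dP dV).
  have dE : is_derive (- t^-1) 1 (@expR R) (expR (- t^-1)) by exact: is_derive_expR.
  have dN : is_derive t 1 (fun x : R => - x^-1) (- (- t ^- 2 *: 1)).
    exact: is_deriveN.
  have d2 : is_derive t 1 (fun x : R => expR (- x^-1)) (expR (- t^-1) * (- (- t ^- 2 *: 1))).
    exact: (@is_derive1_comp R (@expR R) (fun x => - x^-1) t _ _ dE dN).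
  apply: is_derive_eq (is_deriveM d1 d2) _.
  rewrite /flat t0 !hornerE /= !scaler1 /GRing.scale/=.
  by rewrite -exprVn; ring.
- subst t; rewrite {2}/flat ltxx.
  have [C C0 hC] := flat_bound P.
  suff H : h^-1 *: (flat P (h *: 1 + 0) - flat P 0) @[h --> 0^'] --> (0 : R).
    by apply: DeriveDef; [apply/cvg_ex; exists 0|apply/cvg_lim].
  apply/cvgrPdist_le => /= e e0; near=> h.
  have hn0 : h != 0 by near: h; exact: nbhs_dnbhs_neq.
  rewrite sub0r normrN {2}/flat ltxx subr0 addr0 /GRing.scale/= mulr1.
  have [h0|h0|h0] := ltgtP h 0; last by rewrite h0 eqxx in hn0.
    by rewrite /flat ltNge (ltW h0)/= mulr0 normr0 ltW.
  have h1 : h < 1.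
    rewrite -(ger0_norm (ltW h0)).
    by near: h; apply: dnbhs0_lt.
  rewrite normrM ger0_norm ?invr_ge0 ?(ltW h0)//.
  apply: (@le_trans _ _ (h^-1 * (C * h ^+ 2))).
    by rewrite ler_wpM2l ?invr_ge0 ?(ltW h0)// hC.
  rewrite mulrCA expr2 mulKf//.
  apply: (@le_trans _ _ ((C + 1) * (e / (C + 1)))); last first.
    by rewrite mulrC divfK// gt_eqF// ltr_wpDl.
  apply: ler_pM => //; [exact: ltW|by rewrite lerDl|].
  rewrite -(ger0_norm (ltW h0)).
  by near: h; apply: dnbhs0_le; rewrite divr_gt0// ltr_wpDl.
Unshelve. all: by end_near. Qed.

Lemma Ck_flat n (P : {poly R}) : Ck n (flat P).
Proof.
elim: n P => // n IH P; split=> [x|]; first by have [] := is_derive_flat P x.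
by rewrite (is_derive_derive1 (is_derive_flat P)); exact: IH.
Qed.

Definition expinv (t : R) : R := if 0 < t then expR (- t^-1) else 0.

Lemma smooth1_expinv : smooth1 expinv.
Proof.
move=> n; rewrite (_ : expinv = flat 1); first exact: Ck_flat.
by apply/funext => t; rewrite /expinv /flat hornerC mul1r.
Qed.

Lemma expinv_ge0 t : 0 <= expinv t.
Proof. by rewrite /expinv; case: ifPn => // _; exact: expR_ge0. Qed.

Lemma expinv_gt0 t : 0 < t -> 0 < expinv t.
Proof. by rewrite /expinv => ->; exact: expR_gt0. Qed.

Lemma expinv_le1 t : expinv t <= 1.
Proof.
rewrite /expinv; case: ifPn => // t0.
by rewrite expR_le1 oppr_le0 invr_ge0 ltW.
Qed.

Lemma expinv_eq0 t : t <= 0 -> expinv t = 0.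
Proof. by rewrite /expinv leNgt => /negbTE ->. Qed.

Lemma expinv_le s t : s <= t -> expinv s <= expinv t.
Proof.
rewrite /expinv => st; case: ifPn => [s0|_]; last exact: expinv_ge0.
by rewrite (lt_le_trans s0 st) ler_expR lerN2 lef_pV2// posrE (lt_le_trans s0).
Qed.

Lemma cvg_expinv (c : R) : 0 < c -> expinv (n.+1%:R * c) @[n --> \oo] --> (1 : R).
Proof.
move=> c0.
have -> : (fun n => expinv (n.+1%:R * c)) = (fun n => expR (- (c^-1 * harmonic n))).
  by apply/funext => n; rewrite /expinv mulr_gt0// invfM mulrC.
rewrite -(@expR0 R) -oppr0 -(mulr0 c^-1).
apply: continuous_cvg; first exact: continuous_expR.
by apply: cvgN; apply: cvgMr; exact: cvg_harmonic.
Qed.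

(** The slope [k] serves two purposes: as it grows the bump converges to the
indicator of the open interval, and tuned to the length of the interval it makes
all bumps rescaled copies of one another. *)
Definition bump (a b k t : R) : R := expinv (k * (t - a)) * expinv (k * (b - t)).

Lemma smooth1_bump (a b k : R) : smooth1 (bump a b k).
Proof.
rewrite (_ : bump a b k = (fun t => expinv (k * t + (- (k * a)))) \*
   (fun t => expinv ((- k) * t + k * b))); last first.
  by apply/funext => t; rewrite /bump /= !mulrBr mulNr (addrC (- _)).
by apply: smooth1M; apply: smooth1_affine; exact: smooth1_expinv.
Qed.

Lemma bump_ge0 (a b k t : R) : 0 <= bump a b k t.
Proof. by rewrite mulr_ge0// expinv_ge0. Qed.

Lemma bump_le1 (a b k t : R) : bump a b k t <= 1.
Proof. by rewrite mulr_ile1// ?expinv_ge0 ?expinv_le1. Qed.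

Lemma bump_neq0 (a b k t : R) : 0 < k -> bump a b k t != 0 -> a < t < b.
Proof.
move=> k0; apply: contraNT; rewrite negb_and -!leNgt => /orP[h|h]; apply/eqP.
  by rewrite /bump expinv_eq0 ?mul0r// pmulr_rle0// subr_le0.
by rewrite /bump mulrC expinv_eq0 ?mul0r// pmulr_rle0// subr_le0.
Qed.

(** Directional derivatives in several variables become ordinary derivatives
along a line, where the one-dimensional theorems apply. *)
Lemma is_derive_line (V : normedModType R) (f : V -> R) (x v : V) (t d : R) :
  is_derive t 1 (fun h : R => f (h *: v + x)) d <-> is_derive (t *: v + x) v f d.
Proof.
have E : (fun h : R => h^-1 *: (f ((h *: 1 + t) *: v + x) - f (t *: v + x))) =
    (fun h : R => h^-1 *: (f (h *: v + (t *: v + x)) - f (t *: v + x))).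
  by apply/funext => h; rewrite [_%:A]mulr1 scalerDl addrA.
split=> -[/= h1 h2]; apply: DeriveDef; move: h1 h2; by rewrite /derivable /derive/= E.
Qed.

Definition prodfun n (F : 'I_n -> R -> R) (x : 'rV[R]_n) : R := \prod_i F i (x ord0 i).

Lemma prodfun_continuous n (F : 'I_n -> R -> R) : (forall i, smooth1 (F i)) -> continuous (prodfun F).
Proof.
move=> sF.
apply: (continuous_big (@mul_continuous R) (F := fun i (y : 'rV[R]_n) => F i (y ord0 i))).
move=> i _ y; apply: continuous_comp; first exact: coord_continuous.
exact: smooth1_continuous.
Qed.

(** Products of one-variable functions are stable under partial
differentiation, which reduces their smoothness to that of the factors. *)
Definition pderiv n (j : 'I_n) (F : 'I_n -> R -> R) : 'I_n -> R -> R :=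
  fun i => if i == j then derive1 (F i) else F i.

Lemma is_derive_prodfun n (F : 'I_n -> R -> R) (x : 'rV[R]_n) (j : 'I_n) :
  (forall i, smooth1 (F i)) ->
  is_derive x (delta_mx ord0 j) (prodfun F) (prodfun (pderiv j F) x).
Proof.
move=> sF; have [+ _] := @is_derive_line _ (prodfun F) x (delta_mx ord0 j) 0 (prodfun (pderiv j F) x).
rewrite scale0r add0r; apply.
pose c := \prod_(i | i != j) F i (x ord0 i).
rewrite (_ : (fun h => _) = (fun h => c * F j (1 * h + x ord0 j))); last first.
  apply/funext => h; rewrite /prodfun (bigD1 j)//= mulrC; congr (_ * _).
    by apply: eq_bigr => i ij; rewrite !mxE eqxx/= (negbTE ij) mulr0 add0r.
  by rewrite !mxE !eqxx/= mul1r mulr1.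
rewrite (_ : prodfun (pderiv j F) x = c * derive1 (F j) (1 * 0 + x ord0 j)); last first.
  rewrite /prodfun (bigD1 j)//= mulrC; congr (_ * _).
    by apply: eq_bigr => i ij; rewrite /pderiv (negbTE ij).
  by rewrite /pderiv eqxx mulr0 add0r.
have := @is_derive_affine (F j) 1 (x ord0 j) 0 (smooth1_derivable (sF j)).
by rewrite mul1r => h; exact: is_deriveZ.
Qed.

Lemma smooth1_pderiv n (F : 'I_n -> R -> R) j : (forall i, smooth1 (F i)) ->
  forall i, smooth1 (pderiv j F i).
Proof. by move=> sF i; rewrite /pderiv; case: ifPn => // _; exact: smooth1_derive. Qed.

Lemma partial_prodfun n (F : 'I_n -> R -> R) j : (forall i, smooth1 (F i)) ->
  partial j (prodfun F) = prodfun (pderiv j F).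
Proof.
by move=> sF; apply/funext => x; rewrite /partial; have [] := is_derive_prodfun x j sF.
Qed.

Lemma smooth_prodfun n (F : 'I_n -> R -> R) : (forall i, smooth1 (F i)) -> smooth (prodfun F).
Proof.
move=> sF s.
have [G sG ->] : exists2 G : 'I_n -> R -> R, (forall i, smooth1 (G i)) &
    iter_partial s (prodfun F) = prodfun G.
  elim: s => [|j s [G sG E]]; first by exists F.
  exists (pderiv j G); first exact: smooth1_pderiv.
  by rewrite /= E partial_prodfun.
split; first exact: prodfun_continuous.
by move=> x i; have [] := is_derive_prodfun x i sG.
Qed.

Lemma closed_cbox n (a b : 'I_n -> R) : closed (cbox a b).
Proof.
rewrite (_ : cbox a b = \bigcap_i ((fun x : 'rV[R]_n => x ord0 i) @^-1` `[a i, b i]%classic)).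
  apply: closed_bigI => i _; apply: preimage_closed; last exact: itv_closed.
  by move=> x _; exact: coord_continuous.
by apply/seteqP; split => [x xab i _|x xab i] /=; have := xab i;
  rewrite ?in_itv/=; exact.
Qed.

Lemma compact_cbox n (a b : 'I_n -> R) : compact (cbox a b).
Proof.
have -> : cbox a b = [set v : 'rV[R]_n | forall i, `[a i, b i]%classic (v ord0 i)].
  by apply/seteqP; split => x xab i; have := xab i; rewrite /= in_itv.
by apply: (@rV_compact R n (fun i => `[a i, b i]%classic)) => i; exact: segment_compact.
Qed.

Lemma test_function_prodfun n (F : 'I_n -> R -> R) (a b : 'I_n -> R) (Omega : set 'rV[R]_n) :
  (forall i, smooth1 (F i)) -> (forall i t, F i t != 0 -> a i <= t <= b i) ->
  cbox a b `<=` Omega -> test_function Omega (prodfun F).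
Proof.
move=> sF F0 abO.
have H : closure [set x | prodfun F x != 0] `<=` cbox a b.
  rewrite [X in _ `<=` X](closure_id (cbox a b)).1; last exact: closed_cbox.
  apply: closure_subset => x /= /prodf_neq0 h i; apply: F0; exact: h.
split; first exact: smooth_prodfun.
  by apply: subclosed_compact H; [exact: closed_closure|exact: compact_cbox].
exact: subset_trans abO.
Qed.

Definition boxbump n (a b : 'I_n -> R) (k : R) : 'rV[R]_n -> R :=
  prodfun (fun i => bump (a i) (b i) k).

Lemma test_function_boxbump n (a b : 'I_n -> R) (k : R) (Omega : set 'rV[R]_n) :
  0 < k -> cbox a b `<=` Omega -> test_function Omega (boxbump a b k).
Proof.
move=> k0 abO; apply: (@test_function_prodfun _ _ a b) => //.
  by move=> i; exact: smooth1_bump.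
by move=> i t /(bump_neq0 k0)/andP[? ?]; rewrite !ltW.
Qed.

Lemma boxbump_ge0 n (a b : 'I_n -> R) (k : R) x : 0 <= boxbump a b k x.
Proof. by apply: prodr_ge0 => i _; exact: bump_ge0. Qed.

Lemma boxbump_le1 n (a b : 'I_n -> R) (k : R) x : boxbump a b k x <= 1.
Proof. by apply: prodr_ile1 => i _; rewrite bump_ge0 bump_le1. Qed.

Lemma boxbump_eq0 n (a b : 'I_n -> R) (k : R) x : 0 < k -> ~ obox a b x ->
  boxbump a b k x = 0.
Proof.
move=> k0; apply: contra_notP => /eqP/prodf_neq0 h i.
by apply: bump_neq0 k0 _; exact: h.
Qed.

(** The limit is the indicator of the open box, at its boundary points as well,
where every bump vanishes. *)
Lemma cvg_boxbump n (a b : 'I_n -> R) x :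
  boxbump a b k.+1%:R x @[k --> \oo] --> (\1_(obox a b) x : R).
Proof.
rewrite indicE; case: (boolP (x \in obox a b)); rewrite ?inE ?notin_setE => xab; last first.
  by under eq_cvg do rewrite boxbump_eq0//; exact: cvg_cst.
rewrite (_ : true%:R = \prod_(i < n) (1 : R)); last by rewrite big1.
apply: (cvg_big (@mul_continuous R)) => i _; have /andP[ha hb] := xab i.
by rewrite -[X in _ --> X](mulr1 (1 : R)); apply: cvgM; apply: cvg_expinv; rewrite subr_gt0.
Qed.

End smooth1.

(** * Integration by parts *)

Section compact_support.
Context {R : realType} {n : nat}.
Local Notation mu := (@lebesgue_row R n).
Implicit Types (f g phi : 'rV[R]_n -> R) (Omega : set 'rV[R]_n).

(** Vanishing outside a cube, a form of compact support that is convenient for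
integrability and is inherited by partial derivatives. *)
Definition boxed f := exists K : R, forall x, f x != 0 -> cbox (fun=> - K) (fun=> K) x.

Lemma cbox_le (K L : R) : K <= L ->
  cbox (fun _ : 'I_n => - K) (fun=> K) `<=` cbox (fun=> - L) (fun=> L).
Proof.
move=> KL x xK i; have /andP[h1 h2] := xK i.
by rewrite (le_trans _ h1) ?lerN2// (le_trans h2).
Qed.

Lemma measurable_cbox (a b : 'I_n -> R) : measurable (cbox a b).
Proof. by apply: closed_measurable_row; exact: closed_cbox. Qed.

Lemma lebesgue_cbox_lty (a b : 'I_n -> R) : (mu (cbox a b) < +oo)%E.
Proof.
apply: le_lt_trans (lebesgue_obox_lty (fun i => a i - 1) (fun i => b i + 1)).
apply: le_measure; rewrite ?inE; [exact: measurable_cbox|exact: measurable_obox|].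
move=> x xab i; have /andP[h1 h2] := xab i.
by rewrite (lt_le_trans _ h1) ?ltrBlDr ?ltrDl// (le_lt_trans h2)// ltrDl.
Qed.

Lemma compact_sub_cbox (A : set 'rV[R]_n) : compact A ->
  exists K : R, A `<=` cbox (fun=> - K) (fun=> K).
Proof.
move=> /compact_bounded[M [Mr hM]]; exists (`|M| + 1) => x Ax i.
have := hM (`|M| + 1) _ x Ax; rewrite (le_lt_trans (ler_norm M)) ?ltrDl// => /(_ isT) h.
rewrite -ler_norml; apply: le_trans h.
rewrite [leRHS]mx_normrE; apply: (le_trans _ (le_bigmax _ _ (ord0, i))) => //=.
Qed.

Lemma bounded_boxed f : continuous f -> boxed f ->
  exists2 M : R, 0 <= M & forall x, `|f x| <= M.
Proof.
move=> cf [K fK].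
have : compact (f @` cbox (fun=> - K) (fun=> K)).
  apply: continuous_compact; last exact: compact_cbox.
  by apply: continuous_subspaceT.
move=> /compact_bounded[M [Mr hM]]; exists (`|M| + 1); first by rewrite addr_ge0.
move=> x; have [->|fx] := eqVneq (f x) 0; first by rewrite normr0 addr_ge0.
apply: hM; first by rewrite (le_lt_trans (ler_norm M)) ?ltrDl.
by exists x => //; exact: fK.
Qed.

Lemma integrable_indic_cbox (a b : 'I_n -> R) :
  mu.-integrable setT (fun x => (\1_(cbox a b) x)%:E).
Proof.
have mA := measurable_cbox a b.
apply/integrableP; split; first exact/measurable_EFinP.
rewrite (eq_integral (fun x => (\1_(cbox a b) x)%:E)); last first.
  by move=> t _; rewrite gee0_abs// lee_fin.
by rewrite integral_indic// setIT lebesgue_cbox_lty.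
Qed.

Lemma le_bounded_cbox_integrable (h : 'rV[R]_n -> R) (a b : 'I_n -> R) (M : R) :
  measurable_fun setT h -> (forall x, `|h x| <= M) ->
  (forall x, h x != 0 -> cbox a b x) -> mu.-integrable setT (EFin \o h).
Proof.
move=> mh hM h0.
have I : mu.-integrable setT (fun x => (M * \1_(cbox a b) x)%:E).
  rewrite (_ : (fun _ => _) = (fun x => M%:E * (\1_(cbox a b) x)%:E)%E); last first.
    by apply/funext => x; rewrite EFinM.
  apply: integrableZl => //.
  exact: integrable_indic_cbox.
apply: le_integrable I => //; first exact/measurable_EFinP.
move=> x _ /=; rewrite lee_fin indicE; have [hx|hx] := eqVneq (h x) 0.
  by rewrite hx normr0.
by rewrite mem_set ?mulr1; [rewrite (le_trans (hM x))// ler_norm|exact: h0].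
Qed.

Lemma integrable_boxed f : continuous f -> boxed f -> mu.-integrable setT (EFin \o f).
Proof.
move=> cf bf; have [M _ fM] := bounded_boxed cf bf; have [K fK] := bf.
apply: le_bounded_cbox_integrable fM fK => //.
exact: continuous_measurable_row.
Qed.

Definition C1 f := [/\ continuous f, forall x i, derivable f x (delta_mx ord0 i)
  & forall i, continuous (partial i f)].

Lemma C1_is_derive f x i : C1 f -> is_derive x (delta_mx ord0 i) f (partial i f x).
Proof. by move=> [_ df _]; apply: derivableP; exact: df. Qed.

Lemma partial_eq0 f (A : set 'rV[R]_n) i x : open A -> A x ->
  (forall y, A y -> f y = 0) -> partial i f x = 0.
Proof.
move=> oA Ax fA; rewrite /partial (_ : 'D__ f x = 'D_(delta_mx ord0 i) (cst 0 : _ -> R) x).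
  exact: derive_cst.
apply: near_eq_derive; move: (open_nbhs_nbhs (conj oA Ax)).
by apply: filterS => y Ay; exact: fA.
Qed.

Lemma boxed_partial f i : boxed f -> boxed (partial i f).
Proof.
move=> [K fK]; exists K => x; apply: contra_neqP => xK.
apply: (@partial_eq0 _ (~` cbox (fun=> - K) (fun=> K))) => //.
  exact/closed_openC/closed_cbox.
by move=> y yK; apply/eqP; apply: contra_notT yK; exact: fK.
Qed.

(** The mean value theorem along a coordinate line; it dominates the difference
quotients below by the supremum of the partial derivative. *)
Lemma C1_increment f (x : 'rV[R]_n) i (h : R) : C1 f -> 0 < h ->
  exists c : R, f (h *: delta_mx ord0 i + x) - f x = h * partial i f (c *: delta_mx ord0 i + x).
Proof.
move=> Cf h0; set v : 'rV[R]_n := delta_mx ord0 i.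
have d (t : R) : is_derive t 1 (fun s : R => f (s *: v + x)) (partial i f (t *: v + x)).
  by apply/is_derive_line; exact: C1_is_derive.
have [|c _] := @MVT_segment R (fun s => f (s *: v + x))
    (fun s => partial i f (s *: v + x)) 0 h (ltW h0) (fun t _ => d t).
  apply: continuous_subspaceT => t; apply: derivable_continuous1; have [] := d t; exact.
by rewrite scale0r add0r subr0 mulrC => ?; exists c.
Qed.

(** By translation invariance the difference quotients of [f] have integral
zero; they converge to the partial derivative and are dominated by a constant on
a fixed box. *)
Lemma integral_partial_eq0 f i : C1 f -> boxed f -> (\int[mu]_x (partial i f x)%:E = 0)%E.
Proof.
move=> Cf bf; have [cf df cdf] := Cf; set v : 'rV[R]_n := delta_mx ord0 i.
have mf : measurable_fun setT f by exact: continuous_measurable_row.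
have [M M0 hM] := bounded_boxed (cdf i) (boxed_partial i bf).
pose h k : R := harmonic k.
have h0 k : 0 < h k by exact: harmonic_gt0.
pose G k (x : 'rV[R]_n) := (h k)^-1 * (f (x + h k *: v) - f x).
have mfh k : measurable_fun setT (fun x : 'rV[R]_n => f (x + h k *: v)).
  apply: measurableT_comp mf _.
  apply: eq_measurable_fun (measurable_affine_row 1 (h k *: v)) => x _.
  by rewrite scale1r.
have mG k : measurable_fun setT (G k).
  by apply: measurable_funM => //; apply: measurable_funB.
have [K fK] := bf.
have K1 : K <= K + 1 by rewrite lerDl.
have GK k x : G k x != 0 -> cbox (fun=> - (K + 1)) (fun=> K + 1) x.
  apply: contra_neqP => xK; rewrite /G.
  have -> : f x = 0.
    by apply/eqP; apply: contra_notT xK => /fK; exact: cbox_le.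
  rewrite subr0 (_ : f _ = 0) ?mulr0//.
  apply/eqP; apply: contra_notT xK => /fK xK j; have /andP[] := xK j.
  have hk1 : h k <= 1 by rewrite /h /= invf_le1// ler1n.
  rewrite !mxE eqxx /=; case: (j == i); rewrite ?mulr1 ?mulr0 ?addr0.
    by have := h0 k; move: (h k) hk1 (x ord0 j) => *; lra.
  by move: (x ord0 j) => *; lra.
have hG k x : `|G k x| <= M.
  have [c] := C1_increment x i Cf (h0 k); rewrite -/v (addrC _ x) /G => ->.
  by rewrite mulKf ?gt_eqF// hM.
(* here the translation invariance of Lebesgue measure is used *)
have IG k : (\int[mu]_x (G k x)%:E = 0)%E.
  under eq_integral do rewrite EFinM.
  have if1 : mu.-integrable setT (EFin \o f) by exact: integrable_boxed.
  have if2 : mu.-integrable setT (EFin \o (fun x : 'rV[R]_n => f (x + h k *: v))).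
    have -> : (fun x : 'rV[R]_n => f (x + h k *: v)) = (fun x => h k * G k x + f x).
      by apply/funext => x; rewrite /G mulVKf ?gt_eqF// subrK.
    rewrite (_ : EFin \o _ = (fun x => (h k)%:E * (G k x)%:E) \+ (EFin \o f))%E; last first.
      by apply/funext => x; rewrite /= EFinD EFinM.
    apply: integrableD => //; apply: integrableZl => //.
    exact: le_bounded_cbox_integrable (hG k) (GK k).
  rewrite integralZl//; last first.
    rewrite (_ : (fun x => (f (x + h k *: v) - f x)%:E) = 
      ((EFin \o (fun x => f (x + h k *: v)%R)) \- (EFin \o f))%E)//.
    exact: integrableB.
  rewrite integralB_EFin//.
  have -> := @integral_translate_row R n (h k *: v) (EFin \o f) _.
    by rewrite subee ?mule0//; exact: integrable_fin_num.
  exact/measurable_EFinP.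
have I1 : mu.-integrable setT (fun x => (M * \1_(cbox (fun=> - (K + 1)) (fun=> K + 1)) x)%:E).
  rewrite (_ : (fun _ => _) = (fun x => M%:E * (\1_(cbox (fun=> - (K + 1)) (fun=> K + 1)) x)%:E)%E); last first.
    by apply/funext => x; rewrite EFinM.
  apply: integrableZl => //.
  exact: integrable_indic_cbox.
have [||||_ _] := @dominated_convergence _ _ _ mu setT measurableT
    (fun k x => (G k x)%:E) (EFin \o partial i f) _ _ _ _ I1 _.
- by move=> k; exact/measurable_EFinP.
- by apply/measurable_EFinP; apply: continuous_measurable_row; exact: cdf.
- apply: aeW => x _; apply: cvg_EFin; first exact: nearW.
  have := df x i; rewrite /derivable -/v => /cvg_ex[l hl].
  rewrite /partial /derive -/v (cvg_lim _ hl)//.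
  have [/(_ hl) + _] := cvgr_dnbhsP (fun t : R => t^-1 *: (f (t *: v + x) - f x)) 0 l.
  move=> /(_ h); have hh : (forall k, h k != 0) /\ h @ \oo --> (0 : R).
    by split => [k|]; [rewrite gt_eqF|exact: cvg_harmonic].
  move=> /(_ hh).
  apply: cvg_trans; apply: near_eq_cvg; apply: nearW => k /=.
  by rewrite /G (addrC x).
- apply: aeW => x k _; rewrite abse_EFin lee_fin indicE.
  have [hx|hx] := eqVneq (G k x) 0; first by rewrite hx normr0 mulr_ge0.
  by rewrite mem_set ?mulr1//; exact: GK hx.
- have -> : [sequence (\int[mu]_x (G k x)%:E)%E]_k = cst 0%E.
    by apply/funext => k; exact: IG.
  by move=> /cvg_lim <-//; rewrite lim_cst.
Qed.

Lemma continuous_boxedM f g : continuous f -> continuous g -> continuous (fun x => f x * g x).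
Proof. by move=> cf cg x; apply: continuousM; [exact: cf|exact: cg]. Qed.

Lemma boxedMl f g : boxed f -> boxed (fun x => f x * g x).
Proof. by move=> [K fK]; exists K => x; rewrite mulf_eq0 negb_or => /andP[/fK]. Qed.

Lemma partialM f g i : C1 f -> C1 g ->
  partial i (fun x => f x * g x) = (fun x => f x * partial i g x + g x * partial i f x).
Proof.
move=> Cf Cg; apply/funext => x; have [_ df _] := Cf; have [_ dg _] := Cg.
by rewrite /partial (@deriveM _ _ f g).
Qed.

Lemma C1M f g : C1 f -> C1 g -> C1 (fun x => f x * g x).
Proof.
move=> Cf Cg; have [cf df cdf] := Cf; have [cg dg cdg] := Cg; split.
- exact: continuous_boxedM.
- by move=> x i; apply: (@derivableM _ _ f g).
- move=> i; rewrite partialM// => x.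
  have c1 := @continuous_boxedM _ _ cf (cdg i) x.
  have c2 := @continuous_boxedM _ _ cg (cdf i) x.
  exact: (@cvgD _ _ _ _ _ (fun y => f y * partial i g y) (fun y => g y * partial i f y) _ _ c1 c2).
Qed.

(** The product of the two functions has a partial derivative of integral zero. *)
Lemma integration_by_parts_row f g i : C1 f -> C1 g -> boxed f ->
  \int[mu]_x (f x * partial i g x) = - \int[mu]_x (partial i f x * g x).
Proof.
move=> Cf Cg bf; have [cf _ cdf] := Cf; have [cg _ cdg] := Cg.
have := integral_partial_eq0 i (C1M Cf Cg) (boxedMl g bf).
rewrite partialM// => H.
have i1 : mu.-integrable setT (EFin \o (fun x => f x * partial i g x)).
  by apply: integrable_boxed; [exact: continuous_boxedM|exact: boxedMl].
have i2 : mu.-integrable setT (EFin \o (fun x => partial i f x * g x)).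
  by apply: integrable_boxed; [exact: continuous_boxedM|exact/boxedMl/boxed_partial].
apply/eqP; rewrite -addr_eq0 -RintegralD//; apply/eqP.
by rewrite /Rintegral (eq_integral (fun x => (f x * partial i g x + g x * partial i f x)%:E)) ?H// => x _; rewrite (mulrC (g x)).
Qed.

Lemma smooth_C1 phi : smooth phi -> C1 phi.
Proof.
move=> s; split; first by have [] := s [::].
  by have [_] := s [::].
by move=> i; have [] := s [:: i].
Qed.

Lemma test_function_C1 Omega phi : test_function Omega phi -> C1 phi.
Proof. by move=> [/smooth_C1]. Qed.

Lemma test_function_boxed Omega phi : test_function Omega phi -> boxed phi.
Proof.
move=> [_ /compact_sub_cbox[K hK] _]; exists K => x phix; apply: hK.
exact: subset_closure.
Qed.

Lemma test_function_eq0 Omega phi x : test_function Omega phi -> ~ Omega x -> phi x = 0.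
Proof.
by move=> [_ _ sub]; apply: contra_notP => /eqP phix; apply/sub/subset_closure.
Qed.

Lemma test_function_partial_eq0 Omega phi i x : test_function Omega phi ->
  ~ Omega x -> partial i phi x = 0.
Proof.
move=> [_ _ sub] Ox.
apply: (@partial_eq0 _ (~` closure [set x | phi x != 0])).
- exact/closed_openC/closed_closure.
- by move/sub.
- by move=> y hy; apply/eqP; apply: contra_notT hy => hy; apply: subset_closure; exact: hy.
Qed.

Lemma integrable_L1loc Omega f : measurable Omega ->
  mu.-integrable setT (EFin \o f) -> L1loc Omega f.
Proof.
move=> mO If; have /integrableP[/measurable_EFinP mf _] := If.
split=> [|K KO cK]; first exact: measurable_funTS.
have mK : measurable K.
  by apply: closed_measurable_row; apply: compact_closed => //; exact: norm_hausdorff.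
have /integrableP[_ ] := integrableS measurableT mK (@subsetT _ K) If.
exact.
Qed.

Lemma Rintegral_eq0_setT Omega f : (forall x, ~ Omega x -> f x = 0) ->
  \int[mu]_(x in Omega) f x = \int[mu]_x f x.
Proof.
move=> f0; rewrite Rintegral_mkcond; congr Rintegral; apply/funext => x.
by rewrite patchE; case: ifPn => //; rewrite notin_setE => /f0.
Qed.

(** Integration by parts over the whole space applies, since both functions
vanish outside the domain. *)
Lemma weak_partial_test Omega phi i : measurable Omega -> test_function Omega phi ->
  weak_partial i Omega phi (partial i phi).
Proof.
move=> mO tphi; have C := test_function_C1 tphi; have [c _ cd] := C.
have b := test_function_boxed tphi; split.
- by apply: integrable_L1loc => //; exact: integrable_boxed.
- by apply: integrable_L1loc => //; apply: integrable_boxed => //; exact: boxed_partial.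
move=> psi tpsi.
rewrite (@Rintegral_eq0_setT Omega (fun x => phi x * partial i psi x)); last first.
  by move=> x Ox; rewrite (test_function_eq0 tphi) ?mul0r.
rewrite (@Rintegral_eq0_setT Omega (fun x => partial i phi x * psi x)); last first.
  by move=> x Ox; rewrite (test_function_eq0 tpsi) ?mulr0.
by apply: integration_by_parts_row => //; exact: (test_function_C1 tpsi).
Qed.

End compact_support.

(** * Almost everywhere uniqueness of weak derivatives *)

Section density.
Context d (T : measurableType d) (R : realType) (mu : {measure set T -> \bar R}).
Variables (f : T -> \bar R) (mf : measurable_fun setT f) (f0 : forall x, (0 <= f x)%E).

(** A function whose integral vanishes on boxes has positive and negative parts
that define, as densities, two measures agreeing on boxes, hence equal. *)
Definition density (A : set T) : \bar R := (\int[mu]_(x in A) f x)%E.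

Let density0 : density set0 = 0%E.
Proof. exact: integral_set0. Qed.

Let density_ge0 A : (0 <= density A)%E.
Proof. by apply: integral_ge0 => x _. Qed.

Let density_sigma_additive : semi_sigma_additive density.
Proof. exact: semi_sigma_additive_nng_induced. Qed.

HB.instance Definition _ := isMeasure.Build _ _ _ density
  density0 density_ge0 density_sigma_additive.

Definition density_measure : {measure set T -> \bar R} := density.

End density.

Section uniqueness.
Context {R : realType} {n : nat}.
Local Notation mu := (@lebesgue_row R n).
Implicit Types (f g phi : 'rV[R]_n -> R) (Omega : set 'rV[R]_n).

Lemma fin_num_sube_eq0 (x y : \bar R) :
  x \is a fin_num -> y \is a fin_num -> (x - y = 0)%E -> x = y.
Proof.
move: x y => [x||] [y||]//= _ _; rewrite -EFinB => -[] /eqP.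
by rewrite subr_eq0 => /eqP ->.
Qed.

Lemma ae_eq0_box g : mu.-integrable setT (EFin \o g) ->
  (forall a b, (\int[mu]_(x in obox a b) (g x)%:E = 0)%E) ->
  {ae mu, forall x, g x = 0}.
Proof.
move=> Ig g0; have /integrableP[mg _] := Ig.
pose mp := density_measure mu (measurable_funepos mg) (funepos_ge0 (EFin \o g)).
pose mn := density_measure mu (measurable_funeneg mg) (funeneg_ge0 (EFin \o g)).
have Ip A : measurable A -> mu.-integrable A (EFin \o g)^\+%E.
  by move=> mA; apply: integrableS (integrable_funepos measurableT Ig).
have In A : measurable A -> mu.-integrable A (EFin \o g)^\-%E.
  by move=> mA; apply: integrableS (integrable_funeneg measurableT Ig).
have fp A : measurable A -> (\int[mu]_(x in A) (EFin \o g)^\+ x)%E \is a fin_num.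
  by move=> mA; apply: integrable_fin_num => //; exact: Ip.
have fn A : measurable A -> (\int[mu]_(x in A) (EFin \o g)^\- x)%E \is a fin_num.
  by move=> mA; apply: integrable_fin_num => //; exact: In.
have E A : measurable A -> mp A = mn A.
  apply: row_measure_unique => a b.
    have mo := @measurable_obox R n a b.
    have := g0 a b; rewrite integralE; exact: fin_num_sube_eq0 (fp _ mo) (fn _ mo).
  by rewrite [ltLHS](_ : _ = \int[mu]_(x in obox a b) (EFin \o g)^\+ x)%E// ltey_eq fp//; exact: measurable_obox.
have : ae_eq mu setT (EFin \o g) (cst 0%E).
  apply: integral_ae_eq => // A _ mA; rewrite integral0 integralE.
  have := E A mA; rewrite /mp /mn /density_measure /= /density => ->.
  by rewrite subee// fn.
by apply: filterS => x /(_ I) /= [].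
Qed.

(** Bumps over a closed box contained in the domain converge boundedly to the
indicator of the open box, so the integral of [g] over such a box vanishes.
Countably many of these boxes cover the domain, and on each of them [g] vanishes
almost everywhere because its integral over all smaller boxes does. *)
Lemma du_bois_reymond Omega g : open Omega -> L1loc Omega g ->
  (forall phi, test_function Omega phi -> \int[mu]_(x in Omega) (g x * phi x) = 0) ->
  {ae mu, forall x, Omega x -> g x = 0}.
Proof.
move=> oO [mg Lg] g0; have mO := open_measurable_row oO.
have Icb a b : cbox a b `<=` Omega -> mu.-integrable (cbox a b) (EFin \o g).
  move=> abO; apply/integrableP; split.
    by apply/measurable_EFinP; apply: measurable_funS mg.
  by apply: Lg => //; exact: compact_cbox.
have Z a b : cbox a b `<=` Omega -> (\int[mu]_(x in obox a b) (g x)%:E = 0)%E.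
  move=> abO.
  have sub : obox a b `<=` cbox a b.
    by move=> x xab i; have /andP[? ?] := xab i; rewrite !ltW.
  have mo := @measurable_obox R n a b.
  have Io : mu.-integrable (obox a b) (EFin \o g).
    by apply: integrableS (Icb _ _ abO) => //; exact: measurable_cbox.
  have mgo : measurable_fun (obox a b) g.
    by apply: measurable_funS mg => //; exact: subset_trans abO.
  have [|||||_ _] := @dominated_convergence _ _ _ mu (obox a b) mo
    (fun k x => (g x * boxbump a b k.+1%:R x)%:E) (EFin \o g) (fun x => `|g x|%:E).
  - move=> k; apply/measurable_EFinP; apply: measurable_funM => //.
    apply: measurable_funTS; apply: continuous_measurable_row; apply: prodfun_continuous.
    by move=> i; exact: smooth1_bump.
  - exact/measurable_EFinP.
  - apply: aeW => x xab; apply: cvg_EFin; first exact: nearW.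
    rewrite /= -[X in _ --> X]mulr1; apply: cvgMr.
    by have := @cvg_boxbump R n a b x; rewrite indicE mem_set.
  - exact: (integrable_abse Io).
  - apply: aeW => x k _; rewrite abse_EFin lee_fin normrM [X in _ * X]ger0_norm ?boxbump_ge0//.
    by rewrite ler_piMr// boxbump_le1.
  have -> : [sequence (\int[mu]_(x in obox a b) (g x * boxbump a b k.+1%:R x)%:E)%E]_k = cst 0%E.
      apply/funext => k; rewrite /=.
      have t := @test_function_boxbump R n a b k.+1%:R Omega (ltr0Sn _ _) abO.
      have E0 x : ~ obox a b x -> boxbump a b k.+1%:R x = 0.
        by apply: boxbump_eq0; rewrite ltr0Sn.
      have := g0 _ t; rewrite Rintegral_eq0_setT; last first.
        by move=> x Ox; rewrite E0 ?mulr0// => /sub/abO.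
      rewrite -(@Rintegral_eq0_setT _ _ (obox a b)); last first.
        by move=> x Ox; rewrite E0 ?mulr0.
      rewrite /Rintegral => e0; rewrite -[LHS]fineK ?e0//.
      apply: integrable_fin_num => //.
      apply: le_integrable Io => //.
        apply/measurable_EFinP; apply: measurable_funM => //.
        apply: measurable_funTS; apply: continuous_measurable_row; apply: prodfun_continuous.
        by move=> i; exact: smooth1_bump.
      move=> x _ /=; rewrite lee_fin normrM [X in _ * X]ger0_norm ?boxbump_ge0//.
      by rewrite ler_piMr// boxbump_le1.
  by move=> /cvg_lim <-//; rewrite lim_cst.
have [D [a [b [OE abO]]]] := open_box_cover oO.
suff H k : D k -> {ae mu, forall x, obox (a k) (b k) x -> g x = 0}.
  have : mu.-negligible (\bigcup_k [set x | D k /\ ~ (obox (a k) (b k) x -> g x = 0)]).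
    apply: negligible_bigcup => k; have [Dk|nDk] := pselect (D k).
      by apply: negligibleS (H k Dk) => x [].
    by apply: negligibleS (negligible_set0 mu) => x [].
  apply: negligibleS => x /= /not_implyP[]; rewrite {1}OE => -[k Dk xk] gx.
  by exists k => //; split=> // /(_ xk).
move=> Dk; have mo := @measurable_obox R n (a k) (b k).
have sub : obox (a k) (b k) `<=` cbox (a k) (b k).
  by move=> x xab i; have /andP[? ?] := xab i; rewrite !ltW.
have Io : mu.-integrable (obox (a k) (b k)) (EFin \o g).
  by apply: integrableS (Icb _ _ (abO _ Dk)) => //; exact: measurable_cbox.
have : {ae mu, forall x, (g \_ (obox (a k) (b k))) x = 0}.
  apply: ae_eq0_box.
    by rewrite -restrict_EFin; exact: ((integrable_mkcond _ mo).1 Io).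
  move=> c d; rewrite -[LHS]/(\int[mu]_(x in obox c d) (EFin \o (g \_ (obox (a k) (b k)))) x)%E.
  rewrite -restrict_EFin -integral_mkcondr obox_setI Z// => x xcd.
  apply: (abO k Dk) => i; have := xcd i; rewrite ge_max le_min.
  by move=> /andP[/andP[_ ->] /andP[_ ->]].
by apply: filterS => x + xk; rewrite patchE mem_set.
Qed.

Lemma L1loc_test_integrable Omega g phi : open Omega -> L1loc Omega g ->
  test_function Omega phi -> mu.-integrable Omega (EFin \o (fun x => g x * phi x)).
Proof.
move=> oO [mg Lg] tphi; have mO := open_measurable_row oO.
have [cphi _ _] := test_function_C1 tphi; have [sphi cK KO] := tphi.
have [M M0 hM] := bounded_boxed cphi (test_function_boxed tphi).
set K := closure [set x | phi x != 0] in cK KO.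
have mK : measurable K by apply: closed_measurable_row; exact: closed_closure.
have mphi : measurable_fun setT phi by exact: continuous_measurable_row.
have IK : mu.-integrable K (EFin \o (fun x => g x * phi x)).
  have I : mu.-integrable K (fun x => M%:E * (g x)%:E)%E.
    apply: integrableZl => //; apply/integrableP; split.
      by apply/measurable_EFinP; exact: measurable_funS mg.
    exact: Lg.
  apply: le_integrable I => //.
    apply/measurable_EFinP; apply: measurable_funM; first exact: measurable_funS mg.
    exact: measurable_funTS.
  by move=> x _ /=; rewrite lee_fin !normrM mulrC ler_wpM2r// (ger0_norm M0).
have := integrableS measurableT mO (@subsetT _ Omega) ((integrable_mkcond _ mK).1 IK).
apply: eq_integrable => // x _; rewrite patchE; case: ifPn => // /negP xK.
rewrite /= (_ : phi x = 0) ?mulr0//; apply/eqP; apply/negPn/negP => phix.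
by apply: xK; rewrite inE; apply: subset_closure.
Qed.

Lemma L1locB Omega g h : measurable Omega -> L1loc Omega g -> L1loc Omega h ->
  L1loc Omega (fun x => g x - h x).
Proof.
move=> mO [mg Lg] [mh Lh]; split; first exact: measurable_funB.
move=> K KO cK.
have mK : measurable K.
  by apply: closed_measurable_row; apply: compact_closed => //; exact: norm_hausdorff.
have Ig : mu.-integrable K (EFin \o g).
  apply/integrableP; split; last exact: Lg.
  by apply/measurable_EFinP; exact: measurable_funS mg.
have Ih : mu.-integrable K (EFin \o h).
  apply/integrableP; split; last exact: Lh.
  by apply/measurable_EFinP; exact: measurable_funS mh.
by have /integrableP[_] := integrableB mK Ig Ih.
Qed.

(** Integrals on the domain are only linear when they are finite; this holds
because a test function and its partial derivatives are supported in a compact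
set, where [u], [w], [g] and [h] are integrable. *)
Lemma weak_partialB Omega i u w g h : open Omega ->
  weak_partial i Omega u g -> weak_partial i Omega w h ->
  weak_partial i Omega (fun x => u x - w x) (fun x => g x - h x).
Proof.
move=> oO [Lu Lg ug] [Lw Lh wh]; have mO := open_measurable_row oO.
split; [exact: L1locB|exact: L1locB|move=> phi tphi].
(* so that the integrals against the partial derivatives of phi are finite *)
have tdphi : test_function Omega (partial i phi).
  have [sphi cK KO] := tphi.
  have sub : closure [set x | partial i phi x != 0] `<=` closure [set x | phi x != 0].
    rewrite [X in _ `<=` X](closure_id _).1; last exact: closed_closure.
    apply: closure_subset => x /= h0; apply: contrapT => xK; move/negP: h0; apply.
    apply/eqP; apply: (@partial_eq0 _ _ _ (~` closure [set x | phi x != 0])) => //.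
      exact/closed_openC/closed_closure.
    by move=> y hy; apply/eqP; apply: contra_notT hy => hy; apply: subset_closure; exact: hy.
  split.
  - by move=> s; have := sphi (rcons s i); rewrite /iter_partial foldr_rcons.
  - by apply: subclosed_compact sub; [exact: closed_closure|].
  - exact: subset_trans KO.
have E (a b c : 'rV[R]_n -> R) : \int[mu]_(x in Omega) ((a x - b x) * c x) =
   \int[mu]_(x in Omega) (a x * c x - b x * c x).
  by apply: eq_Rintegral => x _; rewrite mulrBl.
rewrite !E RintegralB//; [|exact: L1loc_test_integrable..].
rewrite RintegralB//; [|exact: L1loc_test_integrable..].
by rewrite ug// wh// opprB opprK addrC.
Qed.

Lemma weak_partial_unique Omega i u g h : open Omega ->
  weak_partial i Omega u g -> weak_partial i Omega u h ->
  {ae mu, forall x, Omega x -> g x = h x}.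
Proof.
move=> oO [Lu Lg ug] [_ Lh uh]; have mO := open_measurable_row oO.
have : {ae mu, forall x, Omega x -> g x - h x = 0}.
  apply: (@du_bois_reymond _ (fun x => g x - h x)) => //; first exact: L1locB.
  move=> phi tphi.
  rewrite (_ : Rintegral _ _ _ = \int[mu]_(x in Omega) (g x * phi x - h x * phi x)); last first.
    by apply: eq_Rintegral => x _; rewrite mulrBl.
  rewrite RintegralB//; [|exact: L1loc_test_integrable..].
  have := ug _ tphi; rewrite uh// => /oppr_inj ->; exact: subrr.
by apply: filterS => x h0 /h0 /eqP; rewrite subr_eq0 => /eqP.
Qed.

(** The gradient in the definition of the weighted norm is a chosen
representative; any other choice of weak partial derivatives computes the same
integrals. *)
Lemma wgrad_ae_eq Omega u (G : 'I_n -> 'rV[R]_n -> R) : open Omega ->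
  (forall i, weak_partial i Omega u (G i)) ->
  {ae mu, forall x, Omega x -> wgrad Omega u x = \row_i G i x}.
Proof.
move=> oO uG.
have H i : {ae mu, forall x, Omega x -> (get (weak_partial i Omega u) : 'rV[R]_n -> R) x = G i x}.
  apply: (weak_partial_unique oO) (uG i).
  by apply: getPex; exists (G i).
have {}H : {ae mu, forall x, forall i, Omega x -> (get (weak_partial i Omega u) : 'rV[R]_n -> R) x = G i x}.
  exact: filter_forall.
by apply: filterS H => x H Ox; apply/rowP => i; rewrite !mxE H.
Qed.

End uniqueness.

(** * Directional derivatives and polar coordinates *)

Section directional.
Context {R : realType} {n : nat}.
Implicit Types (f : 'rV[R]_n -> R) (x u w : 'rV[R]_n).

(** Here the intermediate point has to be controlled for both signs of [s]: it
must tend to [x] with [s]. *)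
Lemma C1_increment_le f x i (s : R) : C1 f -> exists c : R, `|c| <= `|s| /\
  f (s *: delta_mx ord0 i + x) - f x = s * partial i f (c *: delta_mx ord0 i + x).
Proof.
move=> Cf; set v : 'rV[R]_n := delta_mx ord0 i.
have pos y (t : R) : 0 < t -> exists c : R, 0 <= c <= t /\
    f (t *: v + y) - f y = t * partial i f (c *: v + y).
  move=> t0.
  have d (r : R) : is_derive r 1 (fun s : R => f (s *: v + y)) (partial i f (r *: v + y)).
    by apply/is_derive_line; exact: C1_is_derive.
  have [|c] := @MVT_segment R (fun s => f (s *: v + y))
      (fun s => partial i f (s *: v + y)) 0 t (ltW t0) (fun t _ => d t).
    apply: continuous_subspaceT => r; apply: derivable_continuous1; have [] := d r; exact.
  by rewrite in_itv /= scale0r add0r subr0 mulrC => ? ?; exists c.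
have [s0|s0|->] := ltgtP s 0; last first.
- by exists 0; rewrite normr0 scale0r add0r subrr mul0r.
- by have [c [/andP[c0 cs] ->]] := pos x s s0; exists c; rewrite !ger0_norm// ltW.
have [|c [/andP[c0 cs] E]] := pos (s *: v + x) (- s); first by rewrite oppr_gt0.
exists (c + s); split.
  by rewrite (ltr0_norm s0) ler_norml; move: c0 cs s0; clear; lra.
move: E; rewrite !addrA -!scalerDl addNr scale0r add0r => E.
by apply: oppr_inj; rewrite opprB E mulNr.
Qed.

(** Adding one coordinate direction at a time: the increment along the new
coordinate is evaluated by the mean value theorem at a point that converges to
[x], where the partial derivative is continuous. This replaces the
differentiability of functions with continuous partial derivatives. *)
Lemma is_derive_add_coord f x u i (c d : R) : C1 f -> is_derive x u f d ->
  is_derive x (c *: delta_mx ord0 i + u) f (c * partial i f x + d).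
Proof.
move=> Cf [du <-]; have [_ _ cdf] := Cf; set v : 'rV[R]_n := delta_mx ord0 i.
have [th Hth] := choice (fun h => C1_increment_le (h *: u + x) i (h * c) Cf).
have hc0 : h * c @[h --> (0 : R)^'] --> (0 : R).
  rewrite -[X in _ --> X](mul0r c); apply: cvgMl.
  by apply: cvg_within_filter; exact: cvg_id.
have th0 : th h @[h --> (0 : R)^'] --> (0 : R).
  apply/norm_cvg0P.
  have hc0' : `|h * c| @[h --> (0 : R)^'] --> (0 : R) by apply/norm_cvg0P.
  have nr : \forall h \near (0 : R)^', (cst 0 : R -> R) h <= `|th h| <= `|h * c|.
    by apply: nearW => h; rewrite normr_ge0 /=; have [] := Hth h.
  exact: (squeeze_cvgr nr (cvg_cst _) hc0').
have H1 : th h *: v + (h *: u + x) @[h --> (0 : R)^'] --> x.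
  rewrite -[X in _ --> X]add0r; apply: cvgD.
    by rewrite -[X in _ --> X](scale0r v); apply: cvgZr_tmp.
  rewrite -[X in _ --> X]add0r; apply: cvgD; last exact: cvg_cst.
  rewrite -[X in _ --> X](scale0r u); apply: cvgZr_tmp.
  by apply: cvg_within_filter; exact: cvg_id.
have H2 : c * partial i f (th h *: v + (h *: u + x)) @[h --> (0 : R)^'] --> c * partial i f x.
  by apply: cvgMr; apply: (continuous_cvg _ (cdf i x) H1).
have H3 : h^-1 *: (f (h *: u + x) - f x) @[h --> (0 : R)^'] --> 'D_u f x by exact: du.
have H : c * partial i f (th h *: v + (h *: u + x)) + h^-1 *: (f (h *: u + x) - f x)
    @[h --> (0 : R)^'] --> c * partial i f x + 'D_u f x by exact: (cvgD H2 H3).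
have nE : \forall h \near (0 : R)^',
    c * partial i f (th h *: v + (h *: u + x)) + h^-1 *: (f (h *: u + x) - f x) =
    h^-1 *: (f (h *: (c *: v + u) + x) - f x).
  near=> h.
  have h0 : h != 0 by near: h; exact: nbhs_dnbhs_neq.
  have [_ E] := Hth h.
  have -> : h *: (c *: v + u) + x = (h * c) *: v + (h *: u + x).
    by rewrite scalerDr scalerA addrA.
  move/eqP: E; rewrite subr_eq => /eqP ->.
  by rewrite -/v /GRing.scale/=; field.
suff L : h^-1 *: (f (h *: (c *: v + u) + x) - f x) @[h --> (0 : R)^'] -->
    c * partial i f x + 'D_u f x.
  by apply: DeriveDef; [apply/cvg_ex; eexists; exact: L|exact: cvg_lim L].
exact: cvg_trans (near_eq_cvg nE) H.
Unshelve. all: by end_near. Qed.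

Lemma C1_is_derive_dir f x w : C1 f ->
  is_derive x w f (\sum_i w ord0 i * partial i f x).
Proof.
move=> Cf; rewrite [X in is_derive x X](row_sum_delta w).
elim: (index_enum _) => [|i s IH]; first by rewrite !big_nil; exact: is_derive0.
by rewrite !big_cons; exact: is_derive_add_coord.
Qed.

End directional.

Section polar.
Context {R : realType} {n : nat}.
Local Notation N := n.+1.
Local Notation mu := (@lebesgue_row R N).
Local Notation leb := (@lebesgue_measure R).
Local Open Scope ereal_scope.

(** Directions are averaged over a shell of positive volume instead of the unit
sphere, so that no surface measure is needed: [y / |y|] runs over all directions
as [y] runs over the shell. *)
Definition shell : set 'rV[R]_N := [set y | (1 <= enorm y <= 2)%R].

Lemma measurable_shell : measurable shell.
Proof.
rewrite (_ : shell = (@enorm R N) @^-1` `[1%R, 2%R]%classic).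
  by rewrite -[X in measurable X]setTI; apply: measurable_enorm.
by apply/seteqP; split => y; rewrite /= in_itv.
Qed.

(** Inversion is not continuous at 0; writing 1/x as x (x^2)^(-1) reduces its
measurability to that of the real power. *)
Lemma measurable_inv d (T : measurableType d) (f : T -> R) :
  measurable_fun setT f -> measurable_fun setT (fun x => (f x)^-1%R).
Proof.
move=> mf; rewrite (_ : (fun x => _) = (fun x => f x * ((f x ^+ 2) `^ (-1)))%R).
  apply: measurable_funM => //.
  by apply: measurableT_comp (measurable_powR _) _; exact: measurable_funX.
apply/funext => x; rewrite powR_inv1 ?sqr_ge0//.
have [->|fx] := eqVneq (f x) 0%R; first by rewrite invr0 mul0r.
by rewrite expr2 invfM mulrA mulfV// mul1r.
Qed.

Lemma measurable_scale_row d (T : measurableType d) (f : T -> R) (g : T -> 'rV[R]_N) :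
  measurable_fun setT f -> measurable_fun setT g ->
  measurable_fun setT (fun x => (f x *: g x)%R).
Proof.
move=> mf mg; apply: measurable_fun_rowP => i.
apply: (@eq_measurable_fun _ _ _ _ _ (fun x => f x * g x ord0 i)%R).
  by move=> x _; rewrite mxE.
apply: measurable_funM => //.
exact: (measurableT_comp (measurable_coord i) mg).
Qed.

(** The constant relating the shell average to the surface integral, computed as
the integral of t^(n - 2N) over [1/2, 1] where n = N - 1. *)
Definition polar_const : \bar R :=
  \int[leb]_t (\1_(`[2^-1%R, 1%R]%classic) t * t ^+ n * t^-1 ^+ (N + N))%:E.

Lemma row0_box : [set 0%R] = [set x : 'rV[R]_N | forall i, [set 0%R] (x ord0 i)].
Proof.
apply/seteqP; split => [x -> i|x x0] /=; first by rewrite mxE.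
by apply/rowP => i; rewrite x0 mxE.
Qed.

Lemma null_row0 : mu [set 0%R] = 0.
Proof.
rewrite row0_box (@lebesgue_row_box _ _ (fun=> [set 0%R])) => [|i].
  by rewrite big_ord_recl lebesgue_measure_set1 mul0e.
exact: measurable_set1.
Qed.

(** Scaling s by |y| replaces the direction y/|y| by y itself; scaling the
vector then gives the integral of F(z) against a kernel in t. At each z <> 0, a
last scaling of t by |z| shows that the integral of the kernel does not depend on
z: it is the polar constant. Only Tonelli and one-parameter scalings are used. *)
Lemma polar_coordinates (F : 'rV[R]_N -> \bar R) :
  measurable_fun setT F -> (forall x, 0 <= F x) ->
  \int[leb]_s ((\1_(`]0%R, +oo[%classic) s * s ^+ n)%:E *
     \int[mu]_y ((\1_shell y)%:E * F ((s / enorm y) *: y)%R)) =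
  polar_const * \int[mu]_x F x.
Proof.
move=> mF F0.
pose P (s : R) : R := (\1_(`]0%R, +oo[%classic) s * s ^+ n)%R.
have P0 s : (0 <= P s)%R.
  rewrite /P indicE; case: (boolP (s \in _)); rewrite ?mul0r ?mul1r// inE /= in_itv /= andbT => s0.
  by rewrite exprn_ge0// ltW.
have mP : measurable_fun setT P.
  apply: measurable_funM; last exact: exprn_measurable.
  by apply: measurable_indic; exact: measurable_itv.
pose Q (y : 'rV[R]_N) : R := \1_shell y.
have Q0 y : (0 <= Q y)%R by [].
have mQ : measurable_fun setT Q by apply: measurable_indic; exact: measurable_shell.
have me : measurable_fun setT (@enorm R N) := measurable_enorm (n := N).
have me' d (T : measurableType d) (g : T -> 'rV[R]_N) : measurable_fun setT g ->
    measurable_fun setT (fun x => enorm (g x)).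
  by move=> mg; exact: measurableT_comp me mg.
have mei d (T : measurableType d) (g : T -> 'rV[R]_N) : measurable_fun setT g ->
    measurable_fun setT (fun x => (enorm (g x))^-1%R).
  by move=> mg; apply: measurable_inv; exact: me'.
have eN (z : 'rV[R]_N) : (0 <= enorm z ^+ N)%R by apply: exprn_ge0; exact: enorm_ge0.
have m1 : measurable_fun setT (fun z : measurableTypeR R * 'rV[R]_N => z.1) by exact: measurable_fst.
have m2 : measurable_fun setT (fun z : measurableTypeR R * 'rV[R]_N => z.2) by exact: measurable_snd.
have mF' d (T : measurableType d) (g : T -> 'rV[R]_N) : measurable_fun setT g ->
    measurable_fun setT (fun x => F (g x)).
  by move=> mg; exact: measurableT_comp mF mg.
transitivity (\int[leb]_s \int[mu]_y ((P s * Q y)%:E * F ((s / enorm y) *: y)%R)).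
  apply: eq_integral => s _; rewrite -ge0_integralZl//.
  - by apply: eq_integral => y _; rewrite EFinM muleA.
  - apply: emeasurable_funM; first exact/measurable_EFinP.
    apply: mF'; apply: measurable_scale_row; last exact: measurable_id.
    by apply: measurable_funM => //; exact: mei.
  - by move=> y _; rewrite mule_ge0// lee_fin.
  - by rewrite lee_fin; exact: P0.
rewrite (@fubini_tonelli _ _ _ _ _ leb mu
  (fun z => (P z.1 * Q z.2)%:E * F ((z.1 / enorm z.2) *: z.2)%R)); last 2 first.
- apply: emeasurable_funM.
    apply/measurable_EFinP; apply: measurable_funM; exact: measurableT_comp.
  apply: mF'; apply: measurable_scale_row => //.
  by apply: measurable_funM => //; exact: mei.
- by move=> z; rewrite mule_ge0// lee_fin mulr_ge0.
transitivity (\int[mu]_y \int[leb]_t ((P t * (Q y * enorm y ^+ N))%:E * F (t *: y)%R)).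
  apply: eq_integral => y _ /=.
  rewrite /Q indicE; have [yA|yA] := boolP (y \in shell); last first.
    by rewrite !(integral0_eq, integral0_eq)// => s _; rewrite ?mul0r mulr0 mul0e.
  move: yA; rewrite inE /shell /= => /andP[y1 _].
  have y0 : (0 < enorm y)%R by exact: lt_le_trans y1.
  rewrite (@ge0_integral_scale _ (enorm y)
    (fun s => (P s * 1)%:E * F ((s / enorm y) *: y)%R))//; last 2 first.
  - apply: emeasurable_funM.
      by apply/measurable_EFinP; apply: measurable_funM.
    apply: mF'; apply: measurable_scale_row; last exact: measurable_cst.
    by apply: measurable_funM.
  - by move=> s; rewrite mule_ge0// lee_fin mulr1.
  rewrite -ge0_integralZl//; last 3 first.
  - apply: emeasurable_funM.
      apply/measurable_EFinP; apply: measurable_funM => //.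
      by apply: measurableT_comp => //; exact: mulrl_measurable.
    apply: mF'; apply: measurable_scale_row; last exact: measurable_cst.
    by apply: measurable_funM => //; exact: mulrl_measurable.
  - by move=> s _; rewrite mule_ge0// lee_fin mulr1.
  - by rewrite lee_fin enorm_ge0.
  apply: eq_integral => t _; rewrite muleA -EFinM; congr (_%:E * F (_ *: _)%R).
    rewrite mulr1 mul1r /P !indicE exprMn exprS.
    rewrite (_ : ((enorm y * t)%R \in `]0%R, +oo[%classic) = (t \in `]0%R, +oo[%classic)); last first.
      by apply/idP/idP; rewrite !inE/= !in_itv/= !andbT pmulr_rgt0.
    by ring.
  by rewrite mulrAC divff ?mul1r// gt_eqF.
rewrite -(@fubini_tonelli _ _ _ _ _ leb mu
  (fun z => (P z.1 * (Q z.2 * enorm z.2 ^+ N))%:E * F (z.1 *: z.2)%R)); last 2 first.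
- apply: emeasurable_funM.
    apply/measurable_EFinP; apply: measurable_funM; first exact: measurableT_comp.
    apply: measurable_funM; first exact: measurableT_comp.
    by apply: measurable_funX; exact: me'.
  by apply: mF'; exact: measurable_scale_row.
- move=> z; rewrite mule_ge0// lee_fin; apply: mulr_ge0; first exact: P0.
  by apply: mulr_ge0; [exact: Q0|exact: eN].
transitivity (\int[leb]_t \int[mu]_z
   ((P t * t^-1 ^+ (N + N) * (Q (t^-1 *: z) * enorm z ^+ N))%:E * F z)).
  apply: eq_integral => t _ /=.
  have [t0|t0] := ltP 0%R t; last first.
    have -> : P t = 0%R.
      rewrite /P indicE memNset ?mul0r//= in_itv/= andbT.
      by apply/negP; rewrite -leNgt.
    by rewrite !integral0_eq// => s _; rewrite ?mul0r mul0e.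
  have ti0 : (0 < t^-1)%R by rewrite invr_gt0.
  have := @ge0_integral_affine_row R N t 0
    (fun z => (P t * t^-1 ^+ N * (Q (t^-1 *: z) * enorm z ^+ N))%:E * F z) t0.
  have mz : measurable_fun setT (fun z : 'rV[R]_N => (P t * t^-1 ^+ N * (Q (t^-1 *: z) * enorm z ^+ N))%:E * F z).
    apply: emeasurable_funM => //; apply/measurable_EFinP.
    apply: measurable_funM => //; apply: measurable_funM; last first.
      by apply: measurable_funX; exact: me.
    by apply: measurableT_comp => //; exact: measurable_scale_row.
  have z0 z : 0 <= (P t * t^-1 ^+ N * (Q (t^-1 *: z) * enorm z ^+ N))%:E * F z.
    rewrite mule_ge0// lee_fin; apply: mulr_ge0; last by apply: mulr_ge0; [exact: Q0|exact: eN].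
    by apply: mulr_ge0; [exact: P0|apply/exprn_ge0/ltW].
  move=> /(_ mz z0) E.
  transitivity (\int[mu]_x ((P t * t^-1 ^+ N * (Q (t^-1 *: (t *: x + 0)) * enorm (t *: x + 0) ^+ N))%:E * F (t *: x + 0)%R)).
    apply: eq_integral => y _; rewrite addr0 scalerA mulVf ?gt_eqF// scale1r.
    congr (_%:E * _); rewrite enormZ (ger0_norm (ltW t0)) exprMn.
    have tt : (t^-1 ^+ N * t ^+ N = 1)%R by rewrite -exprMn mulVf ?gt_eqF// expr1n.
    transitivity (P t * (Q y * enorm y ^+ N) * (t^-1 ^+ N * t ^+ N))%R; last by ring.
    by rewrite tt mulr1.
  rewrite E -ge0_integralZl//; last by rewrite lee_fin invr_ge0 exprn_ge0// ltW.
  apply: eq_integral => z _; rewrite muleA -EFinM; congr (_%:E * _).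
  by rewrite -exprVn exprD; ring.
have mti : measurable_fun setT (fun w : measurableTypeR R * 'rV[R]_N => w.1^-1%R) by exact: measurable_inv.
have PV t k : (0 <= P t * t^-1 ^+ k)%R.
  have [t0|t0] := ltP 0%R t; first by rewrite mulr_ge0// exprn_ge0// invr_ge0 ltW.
  by rewrite /P indicE memNset ?mul0r//= in_itv/= andbT => h; move: t0; rewrite leNgt h.
have mK : measurable_fun setT (fun w : measurableTypeR R * 'rV[R]_N =>
    (P w.1 * w.1^-1 ^+ (N + N) * (Q (w.1^-1 *: w.2) * enorm w.2 ^+ N))%R).
  apply: measurable_funM.
    by apply: measurable_funM; [exact: measurableT_comp|exact: measurable_funX].
  apply: measurable_funM; last by apply: measurable_funX; exact: me'.
  by apply: measurableT_comp => //; exact: measurable_scale_row.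
have K0 t z : (0 <= P t * t^-1 ^+ (N + N) * (Q (t^-1 *: z) * enorm z ^+ N))%R.
  by apply: mulr_ge0; [exact: PV|apply: mulr_ge0; [exact: Q0|exact: eN]].
pose K (w : measurableTypeR R * 'rV[R]_N) :=
  (P w.1 * w.1^-1 ^+ (N + N) * (Q (w.1^-1 *: w.2) * enorm w.2 ^+ N))%:E * F w.2.
have mKF : measurable_fun setT K.
  by apply: emeasurable_funM; [exact/measurable_EFinP|exact: mF'].
have KF0 w : 0 <= K w by rewrite mule_ge0// lee_fin.
rewrite (@fubini_tonelli _ _ _ _ _ leb mu K)//.
have pc0 : 0 <= polar_const.
  apply: integral_ge0 => t _; rewrite lee_fin indicE.
  case: (boolP (t \in _)); rewrite ?mul0r ?mul1r// inE /= in_itv /= => /andP[t0 _].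
  have t0' : (0 <= t)%R by apply: le_trans t0; rewrite invr_ge0.
  by rewrite mulr_ge0// exprn_ge0// invr_ge0.
rewrite -ge0_integralZl//.
apply: ge0_ae_eq_integral => //.
- exact: (measurable_fun_fubini_tonelli_G K).
- by apply: emeasurable_funM => //; exact: measurable_cst.
- by move=> z _; apply: integral_ge0.
- by move=> z _; rewrite mule_ge0.
exists [set 0%R]; split => //.
- rewrite row0_box; apply: (@measurable_box R N (fun=> [set 0%R])) => i.
  exact: measurable_set1.
- exact: null_row0.
move=> z; apply: contra_notP => /eqP z0 _ /=.
have ez : (0 < enorm z)%R by rewrite lt_neqAle enorm_ge0 eq_sym enorm_eq0 z0.
pose c (t : R) : R := (\1_(`[2^-1%R, 1%R]%classic) t * t ^+ n * t^-1 ^+ (N + N))%R.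
have c0 t : (0 <= c t)%R.
  rewrite /c indicE.
  case: (boolP (t \in _)); rewrite ?mul0r ?mul1r// inE /= in_itv /= => /andP[t0 _].
  have t0' : (0 <= t)%R by apply: le_trans t0; rewrite invr_ge0.
  by rewrite mulr_ge0// exprn_ge0// invr_ge0.
have cE (t : R) : (enorm z * (P (enorm z * t)%R * (enorm z * t)^-1 ^+ (N + N) *
     (Q ((enorm z * t)^-1 *: z) * enorm z ^+ N)) = c t)%R.
  rewrite /c /P /Q !indicE.
  have [t0|t0] := ltP 0%R t; last first.
    rewrite memNset/=; last first.
      by rewrite in_itv/= andbT pmulr_rgt0// => h; move: t0; rewrite leNgt h.
    have -> : (t \in `[2^-1%R, 1%R]%classic) = false.
      apply/negbTE/negP; rewrite inE/= in_itv/= => /andP[h _].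
      by move: t0; rewrite leNgt (lt_le_trans _ h)// invr_gt0.
    by rewrite !mul0r mulr0.
  rewrite mem_set/=; last by rewrite in_itv/= andbT mulr_gt0.
  have -> : ((enorm z * t)^-1 *: z \in shell) = (t \in `[2^-1%R, 1%R]%classic).
    apply/idP/idP; rewrite !inE /shell /= in_itv/= enormZ ger0_norm ?invr_ge0 ?mulr_ge0 ?(ltW t0) ?enorm_ge0//;
      rewrite invfM mulrAC mulVf ?gt_eqF// mul1r.
      move=> /andP[h1 h2]; rewrite -[t]invrK lef_pV2 ?posrE ?invr_gt0// h2/=.
      by rewrite invf_le1// invr_gt0.
    move=> /andP[h1 h2]; rewrite invf_ge1// h2/=.
    by rewrite -[leRHS]invrK lef_pV2 ?posrE// invr_gt0.
  set b := (_ \in _)%:R; set e := enorm z.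
  have e0 : (e ^+ N * e^-1 ^+ N = 1)%R.
    by rewrite -exprMn divff ?expr1n// gt_eqF.
  rewrite exprMn invfM exprMn (exprD e^-1).
  transitivity ((e * e ^+ n) * e^-1 ^+ N * (e ^+ N * e^-1 ^+ N) *
    (b * t ^+ n * t^-1 ^+ (N + N)))%R; last by rewrite e0 mulr1 -exprS e0 mul1r.
  move: (e^-1 ^+ N)%R (t^-1 ^+ (N + N))%R (e ^+ N)%R (e ^+ n)%R (t ^+ n)%R => *.
  by ring.
have mc : measurable_fun setT c.
  apply: measurable_funM; last by apply: measurable_funX; exact: measurable_inv.
  apply: measurable_funM; last exact: exprn_measurable.
  by apply: measurable_indic; exact: measurable_itv.
have mKz : measurable_fun setT (fun t : R => K (t, z)).
  exact: (measurableT_comp mKF (@pair2_measurable _ _ _ _ z)).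
rewrite /polar_const [RHS]muleC -[RHS]ge0_integralZl//; last 2 first.
- by apply/measurable_EFinP.
- by move=> t _; rewrite lee_fin; exact: c0.
rewrite (@ge0_integral_scale _ (enorm z) (fun t => K (t, z)))//.
rewrite -ge0_integralZl//; last 2 first.
- by apply: (measurableT_comp mKz); exact: mulrl_measurable.
- by rewrite lee_fin ltW.
apply: eq_integral => t _; rewrite /K muleA [RHS]muleC -EFinM; congr (_%:E * _).
exact: cE.
Qed.

Lemma integral_scaled_indic d (T : measurableType d) (m : {measure set T -> \bar R})
    (k : R) (A : set T) : (0 <= k)%R -> measurable A ->
  \int[m]_x (k * \1_A x)%:E = k%:E * m A.
Proof.
move=> k0 mA; under eq_integral do rewrite EFinM.
rewrite ge0_integralZl//.
- by rewrite integral_indic// setIT.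
- exact/measurable_EFinP/measurable_indic.
Qed.

Let measurable_polar : measurable_fun setT
  (fun t : R => (\1_(`[2^-1%R, 1%R]%classic) t * t ^+ n * t^-1 ^+ (N + N))%R).
Proof.
apply: measurable_funM; last by apply: measurable_funX; exact: measurable_inv.
apply: measurable_funM; last exact: exprn_measurable.
by apply: measurable_indic; exact: measurable_itv.
Qed.

Let lebesgue_half : leb `[2^-1%R, 1%R]%classic = (2^-1)%:E.
Proof.
rewrite lebesgue_measure_itv/= lte_fin invf_lt1// ltr1n/= -EFinB; congr EFin.
by field.
Qed.

Lemma polar_const_gt0 : 0 < polar_const.
Proof.
have k0 : (0 <= 2^-1 ^+ n :> R)%R by rewrite exprn_ge0.
apply: (@lt_le_trans _ _ ((2^-1 ^+ n)%:E * (2^-1)%:E)).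
  by rewrite -EFinM lte_fin mulr_gt0// exprn_gt0.
rewrite -lebesgue_half -integral_scaled_indic//.
apply: ge0_le_integral => //.
- by apply/measurable_EFinP; apply: measurable_funM.
- exact/measurable_EFinP.
move=> t _; rewrite lee_fin !indicE; case: (boolP (t \in _)); last first.
  by rewrite mulr0 !mul0r.
rewrite inE /= in_itv/= => /andP[t0 t1]; rewrite mulr1 mul1r.
have t0' : (0 < t)%R by apply: lt_le_trans t0; rewrite invr_gt0.
rewrite -[leLHS]mulr1 ler_pM//.
  by rewrite lerXn2r// nnegrE// ltW.
by rewrite exprn_ege1// invf_ge1.
Qed.

Lemma polar_const_fin : polar_const \is a fin_num.
Proof.
have k0 : (0 <= 2 ^+ (N + N) :> R)%R by rewrite exprn_ge0.
rewrite ge0_fin_numE; last exact: ltW polar_const_gt0.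
apply: (@le_lt_trans _ _ ((2 ^+ (N + N))%:E * (2^-1)%:E)); last by rewrite -EFinM ltry.
rewrite -lebesgue_half -integral_scaled_indic//.
apply: ge0_le_integral => //.
- move=> t _; rewrite lee_fin indicE.
  case: (boolP (t \in _)); rewrite ?mul0r ?mul1r// inE /= in_itv /= => /andP[t0 _].
  have t0' : (0 <= t)%R by apply: le_trans t0; rewrite invr_ge0.
  by rewrite mulr_ge0// exprn_ge0// invr_ge0.
- exact/measurable_EFinP.
- by apply/measurable_EFinP; apply: measurable_funM.
move=> t _; rewrite lee_fin !indicE; case: (boolP (t \in _)); last first.
  by rewrite mulr0 !mul0r.
rewrite inE /= in_itv/= => /andP[t0 t1]; rewrite mulr1 mul1r.
have t0' : (0 < t)%R by apply: lt_le_trans t0; rewrite invr_gt0.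
rewrite -[leRHS]mul1r ler_pM//.
- by rewrite exprn_ge0// ltW.
- by rewrite exprn_ge0// invr_ge0 ltW.
- by rewrite exprn_ile1// ltW.
by rewrite lerXn2r ?nnegrE ?invr_ge0 ?(ltW t0')// -[leRHS]invrK lef_pV2 ?posrE ?invr_gt0.
Qed.

End polar.

(** * Means over spheres and the radial estimate for test functions *)

Section sphere.
Context {R : realType} {n : nat}.
Local Notation N := n.+1.
Local Notation mu := (@lebesgue_row R N).
Local Notation leb := (@lebesgue_measure R).
Local Notation shell := (@shell R n).

(** Up to a constant, the integral of [F] over the sphere of radius [s] against
the uniform measure. *)
Definition sph (F : 'rV[R]_N -> \bar R) (s : R) : \bar R :=
  (\int[mu]_y ((\1_shell y)%:E * F ((s / enorm y) *: y)%R))%E.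

Lemma enorm_dir (y : 'rV[R]_N) (s : R) : shell y -> 0 <= s ->
  enorm ((s / enorm y) *: y) = s.
Proof.
move=> /andP[y1 _] s0; have y0 : 0 < enorm y by exact: lt_le_trans y1.
by rewrite enormZ ger0_norm ?divfK ?gt_eqF// divr_ge0// enorm_ge0.
Qed.

Let measurable_dir : measurable_fun setT
  (fun z : measurableTypeR R * 'rV[R]_N => (z.1 / enorm z.2) *: z.2).
Proof.
apply: measurable_scale_row; last exact: measurable_snd.
apply: measurable_funM; first exact: measurable_fst.
by apply: measurable_inv; apply: (measurableT_comp (@measurable_enorm R N)).
Qed.

Let measurable_dir2 (s : R) : measurable_fun setT
  (fun y : 'rV[R]_N => (s / enorm y) *: y).
Proof.
apply: measurable_scale_row => //.
by apply: measurable_funM => //; apply: measurable_inv; exact: measurable_enorm.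
Qed.

Let mQ : measurable_fun setT (\1_shell : 'rV[R]_N -> R).
Proof. by apply: measurable_indic; exact: measurable_shell. Qed.

Lemma measurable_sph_int (F : 'rV[R]_N -> \bar R) (s : R) : measurable_fun setT F ->
  measurable_fun setT (fun y => (\1_shell y)%:E * F ((s / enorm y) *: y)%R)%E.
Proof.
move=> mF; apply: emeasurable_funM; first exact/measurable_EFinP.
exact: (measurableT_comp mF).
Qed.

Lemma measurable_sph_pair (F : 'rV[R]_N -> \bar R) : measurable_fun setT F ->
  measurable_fun setT (fun z : measurableTypeR R * 'rV[R]_N =>
   (\1_shell z.2)%:E * F ((z.1 / enorm z.2) *: z.2)%R)%E.
Proof.
move=> mF; apply: emeasurable_funM; last exact: (measurableT_comp mF).
by apply/measurable_EFinP; apply: (measurableT_comp mQ).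
Qed.

Lemma sph_int_ge0 (F : 'rV[R]_N -> \bar R) (s : R) y : (forall x, 0 <= F x)%E ->
  (0 <= (\1_shell y)%:E * F ((s / enorm y) *: y)%R)%E.
Proof. by move=> F0; rewrite mule_ge0// lee_fin. Qed.

Lemma sph_ge0 (F : 'rV[R]_N -> \bar R) s : (forall x, 0 <= F x)%E -> (0 <= sph F s)%E.
Proof. by move=> F0; apply: integral_ge0 => y _; exact: sph_int_ge0. Qed.

Lemma measurable_sph (F : 'rV[R]_N -> \bar R) : measurable_fun setT F ->
  (forall x, 0 <= F x)%E -> measurable_fun setT (sph F).
Proof.
move=> mF F0.
apply: (@measurable_fun_fubini_tonelli_F _ _ _ _ _ mu (fun z : measurableTypeR R * 'rV[R]_N =>
   (\1_shell z.2)%:E * F ((z.1 / enorm z.2) *: z.2)%R)%E).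
  exact: measurable_sph_pair.
by move=> z; exact: sph_int_ge0.
Qed.

Lemma le_sph (F G : 'rV[R]_N -> \bar R) s : 0 <= s ->
  measurable_fun setT F -> measurable_fun setT G ->
  (forall x, 0 <= F x)%E -> (forall x, enorm x = s -> F x <= G x)%E ->
  (sph F s <= sph G s)%E.
Proof.
move=> s0 mF mG F0 FG; apply: ge0_le_integral => //.
- by move=> y _; exact: sph_int_ge0.
- exact: measurable_sph_int.
- exact: measurable_sph_int.
- move=> y _; rewrite indicE; case: (boolP (y \in shell)); last by rewrite !mul0e.
  by rewrite inE => ys; rewrite !mul1e; apply: FG; exact: enorm_dir.
Qed.

Lemma eq_sph (F G : 'rV[R]_N -> \bar R) s : 0 <= s ->
  (forall x, enorm x = s -> F x = G x)%E -> sph F s = sph G s.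
Proof.
move=> s0 FG; apply: eq_integral => y _.
rewrite indicE; case: (boolP (y \in shell)); last by rewrite !mul0e.
by rewrite inE => ys; rewrite !mul1e; apply: FG; exact: enorm_dir.
Qed.

Lemma sphD (F G : 'rV[R]_N -> \bar R) s :
  measurable_fun setT F -> measurable_fun setT G ->
  (forall x, 0 <= F x)%E -> (forall x, 0 <= G x)%E ->
  sph (fun x => F x + G x)%E s = (sph F s + sph G s)%E.
Proof.
move=> mF mG F0 G0; rewrite /sph -ge0_integralD//.
- by apply: eq_integral => y _; rewrite ge0_muleDr.
- by move=> y _; exact: sph_int_ge0.
- exact: measurable_sph_int.
- by move=> y _; exact: sph_int_ge0.
- exact: measurable_sph_int.
Qed.

Lemma sphZ (F : 'rV[R]_N -> \bar R) (c s : R) : 0 <= c ->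
  measurable_fun setT F -> (forall x, 0 <= F x)%E ->
  sph (fun x => c%:E * F x)%E s = (c%:E * sph F s)%E.
Proof.
move=> c0 mF F0; rewrite /sph -ge0_integralZl//.
- by apply: eq_integral => y _; rewrite muleCA.
- exact: measurable_sph_int.
- by move=> y _; exact: sph_int_ge0.
Qed.

Lemma sph_radial (g : R -> R) (F : 'rV[R]_N -> \bar R) (s : R) : 0 <= s ->
  0 <= g s -> measurable_fun setT F -> (forall x, 0 <= F x)%E ->
  sph (fun x => (g (enorm x))%:E * F x)%E s = ((g s)%:E * sph F s)%E.
Proof.
move=> s0 g0 mF F0; rewrite -sphZ//.
by apply: eq_sph => // x ->.
Qed.

Definition shell_vol : R := fine (mu shell).

Lemma lebesgue_shell : mu shell = shell_vol%:E.
Proof.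
rewrite /shell_vol fineK// ge0_fin_numE//.
apply: le_lt_trans (lebesgue_cbox_lty (fun=> - 2) (fun=> 2)).
apply: le_measure; rewrite ?inE; [exact: measurable_shell|exact: measurable_cbox|].
move=> x /andP[_ x2] i; rewrite -ler_norml; apply: le_trans x2; exact: le_coord_enorm.
Qed.

Lemma sph_cst (c s : R) : 0 <= c -> sph (fun=> c%:E) s = (c * shell_vol)%:E.
Proof.
move=> c0; rewrite /sph; under eq_integral do rewrite -EFinM mulrC.
rewrite integral_scaled_indic//; last exact: measurable_shell.
by rewrite EFinM -lebesgue_shell.
Qed.

Lemma polar_sph (F : 'rV[R]_N -> \bar R) :
  measurable_fun setT F -> (forall x, 0 <= F x)%E ->
  (\int[leb]_s ((\1_(`]0%R, +oo[%classic) s * s ^+ n)%:E * sph F s) =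
  @polar_const R n * \int[mu]_x F x)%E.
Proof. exact: polar_coordinates. Qed.

Lemma shell_vol_gt0 : 0 < shell_vol.
Proof.
rewrite lt_neqAle fine_ge0// andbT; apply/eqP => M0.
have := @polar_sph (cst 1%E) (measurable_cst _) (fun=> lee01).
rewrite integral0_eq; last first.
  by move=> s _; rewrite (sph_cst _ (ler01)) -M0 mulr0 mule0.
move=> /esym/eqP; rewrite mule_eq0 gt_eqF ?polar_const_gt0//= integral_cst// mul1e.
apply/negP; rewrite gt_eqF//.
apply: (@lt_le_trans _ _ (mu (obox (fun=> 0) (fun=> 1)))).
  by rewrite lebesgue_obox// big1 ?lte_fin// => i _; rewrite subr0.
by apply: le_measure; rewrite ?inE//; exact: measurable_obox.
Qed.

(** For u <= th this is clear and otherwise (u/th)^p >= u/th. With th chosen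
according to the radius, this pointwise inequality takes the place of Hoelder's
inequality. *)
Lemma le_threshold_powR (u th p : R) : 0 <= u -> 0 < th -> 1 <= p ->
  u <= th + th `^ (1 - p) * u `^ p.
Proof.
move=> u0 th0 p1; have [uth|uth] := leP u th.
  by apply: (le_trans uth); rewrite lerDl mulr_ge0// powR_ge0.
have u0' : 0 < u by exact: lt_trans uth.
apply: (@le_trans _ _ (th `^ (1 - p) * u `^ p)); last by rewrite lerDr ltW.
have -> : th `^ (1 - p) = th / th `^ p.
  by rewrite powRB ?powRr1 ?(ltW th0)// (gt_eqF th0) implybT.
have -> : th / th `^ p * u `^ p = th * (u / th) `^ p.
  rewrite powRM ?invr_ge0 ?(ltW th0)// -[th^-1]powR_inv1 ?(ltW th0)// -powRrM mulN1r powRN.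
  by rewrite -mulrA (mulrC _ (u `^ p)).
rewrite mulrC -ler_pdivrMr//; apply: le1r_powR => //.
by rewrite ler_pdivlMr// mul1r ltW.
Qed.

Lemma radius_weight_ge0 (t : R) : 0 <= \1_(`]0%R, +oo[%classic) t * t ^+ n.
Proof.
rewrite indicE; case: (boolP (t \in _)); rewrite ?mul0r ?mul1r// inE /= in_itv /= andbT => t0.
by rewrite exprn_ge0// ltW.
Qed.

Lemma measurable_radius_weight :
  measurable_fun setT (fun t : R => \1_(`]0%R, +oo[%classic) t * t ^+ n).
Proof.
apply: measurable_funM; last exact: exprn_measurable.
by apply: measurable_indic; exact: measurable_itv.
Qed.

Lemma integral_indicE d (T : measurableType d) (m : {measure set T -> \bar R})
    (D : set T) (f : T -> \bar R) :
  (\int[m]_(x in D) f x = \int[m]_x ((\1_D x)%:E * f x))%E.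
Proof.
rewrite integral_mkcond; apply: eq_integral => x _.
by rewrite patchE indicE; case: ifPn => _; rewrite ?mul1e ?mul0e.
Qed.

Definition gradn (phi : 'rV[R]_N -> R) (x : 'rV[R]_N) : R := enorm (\row_i partial i phi x).

Lemma gradn_ge0 phi x : 0 <= gradn phi x.
Proof. exact: enorm_ge0. Qed.

Lemma measurable_gradn phi : C1 phi -> measurable_fun setT (gradn phi).
Proof.
move=> [_ _ cd]; apply: (measurableT_comp (@measurable_enorm R N)).
apply: measurable_fun_rowP => i.
apply: (@eq_measurable_fun _ _ _ _ _ (partial i phi)); first by move=> x _; rewrite mxE.
exact: continuous_measurable_row.
Qed.

Lemma continuous_ray (f : 'rV[R]_N -> R) (w : 'rV[R]_N) : continuous f ->
  continuous (fun t : R => f (t *: w)).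
Proof.
move=> cf t; apply: (@continuous_comp _ _ _ (fun t : R => t *: w) f); last exact: cf.
exact: scalel_continuous.
Qed.

(** The fundamental theorem of calculus along the ray through [y], from radius
[s] to the sphere of radius [r] where [phi] vanishes. Bounding each coordinate of
the direction by 1 costs the factor N. *)
Lemma ray_bound (r s : R) phi (y : 'rV[R]_N) : C1 phi ->
  (forall x, r <= enorm x -> phi x = 0) -> shell y -> 0 <= s -> s < r ->
  (`|phi ((s / enorm y) *: y)|%:E <=
   \int[leb]_t ((\1_(`[s, r]%classic) t)%:E * (N%:R * gradn phi ((t / enorm y) *: y))%:E))%E.
Proof.
move=> Cphi phi0 ys s0 sr; have [cphi _ cd] := Cphi.
pose w := (enorm y)^-1 *: y.
have wE t : (t / enorm y) *: y = t *: w by rewrite scalerA.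
have w1 i : `|w ord0 i| <= 1.
  apply: le_trans (le_coord_enorm _ _) _.
  by have := enorm_dir ys (@ler01 R); rewrite wE scale1r => ->.
pose F t := phi (t *: w).
pose f (t : R) := \sum_i w ord0 i * partial i phi (t *: w).
have dF (t : R) : is_derive t 1 F (f t).
  have /is_derive_line := C1_is_derive_dir (t *: w + 0) w Cphi.
  rewrite addr0; congr is_derive; apply/funext => h; by rewrite addr0.
have cF : continuous F by exact: continuous_ray.
have cf : continuous f.
  apply: (continuous_big add_continuous
    (F := fun i (t : R) => w ord0 i * partial i phi (t *: w))) => i _ t.
  by apply: cvgMr; exact: (continuous_ray (cd i)).
have E : (\int[leb]_(t in `[s, r]) (f t)%:E = (F r)%:E - (F s)%:E)%E.
  apply: continuous_FTC2 => //.
  - exact: continuous_subspaceT.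
  - split.
    + by move=> t _; have [] := dF t.
    + by apply: cvg_at_right_filter; exact: cF.
    + by apply: cvg_at_left_filter; exact: cF.
  - by move=> t _; rewrite derive1E; have [] := dF t.
have r0 : 0 <= r by exact/ltW/(le_lt_trans s0).
rewrite -integral_indicE wE.
have -> : `|phi (s *: w)|%:E = `|(F r)%:E - (F s)%:E|%E.
  by rewrite /F [phi (r *: w)]phi0 ?sub0e -?wE ?enorm_dir// wE -EFinN abse_EFin normrN.
rewrite -E.
have mf : measurable_fun setT f by exact: continuous_measurable_fun.
apply: le_trans (le_abse_integral _ _ _) _ => //.
  exact/measurable_EFinP/measurable_funTS.
apply: ge0_le_integral => //.
- by apply: measurableT_comp => //; exact/measurable_EFinP/measurable_funTS.
- apply/measurable_EFinP; apply: measurable_funTS; apply: measurable_funM => //.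
  apply: (measurableT_comp (measurable_gradn Cphi)).
  by apply: measurable_scale_row => //; exact: measurable_funM.
move=> t _; rewrite abse_EFin lee_fin wE /f.
apply: le_trans (ler_norm_sum _ _ _) _.
have -> : N%:R * gradn phi (t *: w) = \sum_(i < N) gradn phi (t *: w).
  by rewrite sumr_const card_ord mulr_natl.
apply: ler_sum => i _; rewrite normrM -[leRHS]mul1r ler_pM//.
rewrite /gradn; apply: le_trans (le_coord_enorm _ i).
by rewrite mxE.
Qed.

Definition kappa : R := fine (@polar_const R n).

Lemma kappaE : @polar_const R n = kappa%:E.
Proof. by rewrite /kappa fineK// polar_const_fin. Qed.

Lemma kappa_gt0 : 0 < kappa.
Proof. by rewrite -lte_fin -kappaE polar_const_gt0. Qed.

Definition sphere_const : R := N%:R * (shell_vol + kappa).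

(** The function of the radius that Hoelder's inequality along rays produces;
it blows up at 0 and vanishes like (r-s)^(1-1/p) at the boundary. *)
Definition sphere_profile (r p alpha E s : R) : R :=
  E `^ p^-1 * s `^ (- ((alpha + n%:R) / p)) * (r - s) `^ (1 - p^-1).

(** After averaging [ray_bound] over directions, the gradient at radius t >= s
is split by [le_threshold_powR] into a constant th and a multiple of the p-th power. The
constant contributes th (r-s); in the second term t^(n+alpha) >= s^(n+alpha)
lets polar coordinates recover the weighted gradient integral. The choice of th
balances the two terms. *)
Lemma sphere_bound (r p alpha E s : R) phi :
  0 < s -> s < r -> 1 <= p -> 0 <= alpha -> 0 < E -> C1 phi ->
  (forall x, r <= enorm x -> phi x = 0) ->
  (\int[mu]_x (gradn phi x `^ p * enorm x `^ alpha)%:E <= E%:E)%E ->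
  (sph (fun x => `|phi x|%:E) s <= (sphere_const * sphere_profile r p alpha E s)%:E)%E.
Proof.
move=> s0 sr p1 al0 E0 Cphi phi0 HE; have p0 : 0 < p by exact: lt_le_trans p1.
have mg := measurable_gradn Cphi.
pose G x := (gradn phi x `^ p * enorm x `^ alpha)%:E.
have mG : measurable_fun setT G.
  apply/measurable_EFinP; apply: measurable_funM.
    exact: (measurableT_comp (measurable_powR p) mg).
  exact: (measurableT_comp (measurable_powR alpha) (@measurable_enorm R N)).
have G0 x : (0 <= G x)%E by rewrite lee_fin mulr_ge0// powR_ge0.
(* th makes both contributions equal to a multiple of sphere_profile, see thE
   and ccE *)
pose th := E `^ p^-1 * s `^ (- ((alpha + n%:R) / p)) * (r - s) `^ (- p^-1).
have rs0 : 0 < r - s by rewrite subr_gt0.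
have th0 : 0 < th by rewrite !mulr_gt0// powR_gt0.
have thE : th * (r - s) = sphere_profile r p alpha E s.
  rewrite /th /sphere_profile -mulrA; congr (_ * _).
  rewrite -[X in _ * X]powRr1 ?ltW// -powRD ?(gt_eqF rs0) ?implybT//.
  by rewrite (addrC (- p^-1)).
pose cc := th `^ (1 - p) * s `^ (- (alpha + n%:R)).
have cc0 : 0 <= cc by rewrite mulr_ge0// powR_ge0.
have ccE : cc * E = th * (r - s).
  have thp : th `^ p = E * s `^ (- (alpha + n%:R)) / (r - s).
    rewrite /th !powRM ?mulr_ge0 ?powR_ge0// -!powRrM mulVf ?gt_eqF// powRr1 ?ltW//.
    by rewrite mulNr divfK ?gt_eqF// mulNr mulVf ?gt_eqF// powR_inv1 ?ltW.
  rewrite /cc powRB ?(gt_eqF th0) ?implybT// powRr1 ?ltW// thp.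
  have sn0 : s `^ (- (alpha + n%:R)) != 0 by rewrite gt_eqF ?powR_gt0.
  by field; rewrite sn0 !gt_eqF.
have N0 : 0 <= N%:R :> R by [].
have mI : measurable_fun setT (\1_(`[s, r]%classic) : R -> R).
  by apply: measurable_indic; exact: measurable_itv.
have mgE : measurable_fun setT (fun x => (gradn phi x)%:E) by exact/measurable_EFinP.
have gE0 x : (0 <= (gradn phi x)%:E)%E by rewrite lee_fin gradn_ge0.
have [cphi _ _] := Cphi.
have mphi : measurable_fun setT (fun x => `|phi x|%:E).
  apply/measurable_EFinP; apply: measurableT_comp => //.
  exact: continuous_measurable_row.
apply: (@le_trans _ _ (\int[leb]_t ((\1_(`[s, r]%classic) t)%:E *
    (N%:R%:E * sph (fun x => (gradn phi x)%:E) t)))%E).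
  pose k (z : measurableTypeR R * 'rV[R]_N) := ((\1_shell z.2)%:E *
     ((\1_(`[s, r]%classic) z.1)%:E * (N%:R * gradn phi ((z.1 / enorm z.2) *: z.2))%:E))%E.
  have k0 z : (0 <= k z)%E.
    apply: mule_ge0; first by rewrite lee_fin.
    apply: mule_ge0; first by rewrite lee_fin.
    by rewrite lee_fin mulr_ge0// gradn_ge0.
  have mk : measurable_fun setT k.
    apply: emeasurable_funM; first by apply/measurable_EFinP; apply: (measurableT_comp mQ).
    apply: emeasurable_funM; first by apply/measurable_EFinP; apply: (measurableT_comp mI).
    apply/measurable_EFinP; apply: measurable_funM => //.
    exact: (measurableT_comp mg).
  apply: (@le_trans _ _ (\int[mu]_y \int[leb]_t k (t, y))%E).
    apply: ge0_le_integral => //.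
    - exact: (measurable_sph_int s mphi).
    - exact: (measurable_fun_fubini_tonelli_G k).
    - move=> y _; rewrite /k /= indicE; case: (boolP (y \in shell)) => [|_]; last first.
        by rewrite mul0e; apply: integral_ge0 => t _; rewrite mul0e.
      rewrite inE => ys; rewrite mul1e; under eq_integral do rewrite mul1e.
      by apply: ray_bound => //; exact: ltW.
  rewrite -(fubini_tonelli k)//; apply: ge0_le_integral => //.
  - by move=> t _; apply: integral_ge0.
  - exact: (measurable_fun_fubini_tonelli_F k).
  - apply: emeasurable_funM; first exact/measurable_EFinP.
    by apply: emeasurable_funM => //; exact: measurable_sph.
  - move=> t _; rewrite -sphZ// -sphZ//; last 2 first.
    + by apply: emeasurable_funM.
    + by move=> x; rewrite mule_ge0.
have mPG : measurable_fun setT (fun t : R => (\1_(`]0%R, +oo[%classic) t * t ^+ n)%:E * sph G t)%E.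
  apply: emeasurable_funM; last exact: measurable_sph.
  by apply/measurable_EFinP; exact: measurable_radius_weight.
have PG0 t : (0 <= (\1_(`]0%R, +oo[%classic) t * t ^+ n)%:E * sph G t)%E.
  by apply: mule_ge0; [rewrite lee_fin radius_weight_ge0|exact: sph_ge0].
have th0' := ltW th0; have sM : 0 <= shell_vol := ltW shell_vol_gt0.
have sM0 : 0 <= N%:R * th * shell_vol by apply: mulr_ge0 => //; exact: mulr_ge0.
have Nc0 : 0 <= N%:R * cc by rewrite mulr_ge0.
apply: (@le_trans _ _ (\int[leb]_t (((N%:R * th * shell_vol) * \1_(`[s, r]%classic) t)%:E +
   (N%:R * cc)%:E * ((\1_(`]0%R, +oo[%classic) t * t ^+ n)%:E * sph G t)))%E).
  apply: ge0_le_integral => //.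
  - by move=> t _; rewrite mule_ge0 ?lee_fin// mule_ge0// sph_ge0.
  - apply: emeasurable_funM; first exact/measurable_EFinP.
    by apply: emeasurable_funM => //; exact: measurable_sph.
  - apply: emeasurable_funD; last by apply: emeasurable_funM.
    by apply/measurable_EFinP; apply: measurable_funM.
  - move=> t _; rewrite indicE; case: (boolP (t \in _)) => [|_]; last first.
      by rewrite mul0e mulr0 add0e mule_ge0.
    rewrite inE /= in_itv/= => /andP[st tr].
    have t0 : 0 < t by exact: lt_le_trans st.
    rewrite mul1e mulr1 indicE mem_set/= ?in_itv/= ?t0// mul1r.
    apply: (@le_trans _ _ (N%:R%:E * (th * shell_vol)%:E + N%:R%:E * ((cc * t ^+ n)%:E * sph G t))%E); last first.
      by rewrite !EFinM !muleA.
    rewrite -ge0_muleDr; last 2 first.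
    + by rewrite lee_fin; exact: mulr_ge0.
    + by rewrite mule_ge0 ?sph_ge0// lee_fin mulr_ge0// exprn_ge0// ltW.
    apply: lee_wpmul2l => //.
    have cct0 : 0 <= cc * t ^+ n by rewrite mulr_ge0// exprn_ge0// ltW.
    have mcG : measurable_fun setT (fun x => (cc * t ^+ n)%:E * G x)%E by apply: emeasurable_funM.
    have cG0 x : (0 <= (cc * t ^+ n)%:E * G x)%E by rewrite mule_ge0.
    rewrite -(sph_cst t th0') -(sphZ t cct0 mG G0) -sphD//.
    apply: le_sph => //; first exact: ltW.
      by apply: emeasurable_funD.
    move=> x xt; rewrite /G -EFinM -EFinD lee_fin.
    apply: le_trans (le_threshold_powR (gradn_ge0 phi x) th0 p1) _; rewrite lerD2l xt.
    set u := gradn phi x `^ p.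
    have -> : cc * t ^+ n * (u * t `^ alpha) =
        th `^ (1 - p) * u * (s `^ (- (alpha + n%:R)) * (t `^ n%:R * t `^ alpha)).
      by rewrite /cc powR_mulrn ?(ltW t0)//; ring.
    rewrite ler_peMr ?mulr_ge0 ?powR_ge0//.
    rewrite -powRD ?(gt_eqF t0) ?implybT// powRN (addrC n%:R).
    rewrite ler_pdivlMl ?powR_gt0// mulr1 ge0_ler_powR ?nnegrE ?(ltW s0) ?(ltW t0)//.
    by rewrite addr_ge0.
rewrite ge0_integralD//; last 4 first.
- by move=> t _; rewrite lee_fin mulr_ge0.
- by apply/measurable_EFinP; apply: measurable_funM.
- by move=> t _; rewrite mule_ge0.
- by apply: emeasurable_funM.
rewrite integral_scaled_indic// ge0_integralZl//.
have L : leb `[s, r]%classic = (r - s)%:E by rewrite lebesgue_measure_itv/= lte_fin sr -EFinB.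
have PS := polar_sph mG G0; rewrite kappaE in PS.
rewrite [X in (X <= _)%E](_ : _ = ((N%:R * th * shell_vol)%:E * (r - s)%:E +
    (N%:R * cc)%:E * (kappa%:E * \int[mu]_x G x))%E); last first.
  by congr (_ * _ + _ * _)%E; [exact: L|exact: PS].
rewrite -[((N%:R * th * shell_vol)%:E * _)%E]EFinM.
apply: (@le_trans _ _ ((N%:R * th * shell_vol * (r - s))%:E + (N%:R * cc)%:E * (kappa%:E * E%:E))%E).
  apply: leeD2l; apply: lee_wpmul2l; first by rewrite lee_fin mulr_ge0.
  by apply: lee_wpmul2l => //; rewrite lee_fin ltW// kappa_gt0.
rewrite -!EFinM -EFinD lee_fin -thE /sphere_const.
rewrite [leLHS](_ : _ = N%:R * shell_vol * (th * (r - s)) + N%:R * kappa * (cc * E)); last by ring.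
by rewrite ccE le_eqVlt; apply/orP; left; apply/eqP; ring.
Qed.

End sphere.

(** * Passage to the limit and radial functions *)

Section limit.
Context {R : realType} {n : nat}.
Local Notation N := n.+1.
Local Notation mu := (@lebesgue_row R N).
Local Notation leb := (@lebesgue_measure R).
Implicit Types (u v phi : 'rV[R]_N -> R) (Omega : set 'rV[R]_N).

Lemma measurable_enorm_row (D : set 'rV[R]_N) (g : 'I_N -> 'rV[R]_N -> R) :
  (forall i, measurable_fun D (g i)) -> measurable_fun D (fun x => enorm (\row_i g i x)).
Proof.
move=> mg; rewrite /enorm.
apply: (@measurableT_comp _ _ _ _ _ _ (@Num.sqrt R)).
  by apply: continuous_measurable_fun; exact: sqrt_continuous.
under eq_fun do under eq_bigr do rewrite mxE.
by apply: measurable_sum => i; exact: measurable_funX.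
Qed.

Lemma measurable_wgradn Omega u : (forall i, exists g, weak_partial i Omega u g) ->
  measurable_fun Omega (wgradn Omega u).
Proof.
move=> wu; apply: measurable_enorm_row => i.
by have [_ []] := getPex (wu i).
Qed.

Lemma measurable_weight p alpha Omega u : measurable Omega -> measurable_fun Omega u ->
  measurable_fun Omega (fun x => (`|u x| `^ p * enorm x `^ alpha)%:E).
Proof.
move=> mO mu'; apply/measurable_EFinP; apply: measurable_funM.
  by apply: (measurableT_comp (measurable_powR p)); exact: measurableT_comp.
apply: measurable_funTS; exact: (measurableT_comp (measurable_powR alpha) (@measurable_enorm R N)).
Qed.

Lemma weight_ge0 p alpha u x : (0 <= (`|u x| `^ p * enorm x `^ alpha)%:E)%E.
Proof. by rewrite lee_fin mulr_ge0// powR_ge0. Qed.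

Lemma wint_ge0 p alpha Omega u : (0 <= wint p alpha Omega u)%E.
Proof. by apply: integral_ge0 => x _; exact: weight_ge0. Qed.

Lemma poweR_invK (p : R) (x : \bar R) : p != 0 -> (0 <= x)%E -> ((x `^ p^-1) `^ p)%E = x.
Proof. by move=> p0 x0; rewrite -poweRrM mulVf// poweRe1. Qed.

Lemma wW1p_normE p alpha Omega u : p != 0 ->
  wW1p_norm p alpha Omega u =
  ((wint p alpha Omega u + wint p alpha Omega (wgradn Omega u)) `^ p^-1)%E.
Proof.
move=> p0; rewrite /wW1p_norm /wnorm.
move: (wint_ge0 p alpha Omega u) (wint_ge0 p alpha Omega (wgradn Omega u)).
move: (wint _ _ _ u) (wint _ _ _ (wgradn _ _)) => A B A0 B0.
by rewrite !poweR_invK.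
Qed.

Lemma wW1p_norm_lt p alpha Omega u (e : R) : 0 < p -> 0 < e ->
  (wW1p_norm p alpha Omega u < (e `^ p^-1)%:E)%E ->
  (wint p alpha Omega u <= e%:E)%E /\ (wint p alpha Omega (wgradn Omega u) <= e%:E)%E.
Proof.
move=> p0 e0; rewrite wW1p_normE ?gt_eqF// => lte.
move: (wint_ge0 p alpha Omega u) (wint_ge0 p alpha Omega (wgradn Omega u)) lte.
move: (wint _ _ _ u) (wint _ _ _ (wgradn _ _)) => A B A0 B0 lte.
have AB : (A + B <= e%:E)%E.
  rewrite leNgt; apply/negP => h; move: lte; apply/negP; rewrite -leNgt.
  rewrite -poweR_EFin; apply: gt0_ler_poweR; rewrite ?invr_ge0 ?ltW// ?in_itv/= ?leey ?andbT.
    by rewrite lee_fin ltW.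
  exact: adde_ge0.
by split; apply: le_trans AB; [exact: leeDl|exact: leeDr].
Qed.

(** The norm of a difference is at most twice the larger norm, and the power of
the larger norm is at most the sum of the two powers. *)
Lemma enormB_powR (a b : 'rV[R]_N) (p : R) : 0 <= p ->
  enorm (a - b) `^ p <= 2 `^ p * (enorm a `^ p + enorm b `^ p).
Proof.
move=> p0.
have H : enorm (a - b) <= 2 * Num.max (enorm a) (enorm b).
  rewrite -[leRHS]ger0_norm; last by rewrite mulr_ge0// le_max enorm_ge0.
  rewrite -sqrtr_sqr ler_wsqrtr//.
  apply: (@le_trans _ _ (\sum_i (2 * a ord0 i ^+ 2 + 2 * b ord0 i ^+ 2))).
    apply: ler_sum => i _; rewrite !mxE.
    have := sqr_ge0 (a ord0 i + b ord0 i); set s := a _ _; set t := b _ _.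
    by rewrite !expr2 => ?; nra.
  rewrite big_split/= -!mulr_sumr exprMn.
  have sqE (c : 'rV[R]_N) : \sum_i c ord0 i ^+ 2 = enorm c ^+ 2.
    by rewrite sqr_sqrtr// sumr_ge0// => i _; exact: sqr_ge0.
  rewrite !sqE.
  have h1 : enorm a ^+ 2 <= Num.max (enorm a) (enorm b) ^+ 2.
    by rewrite lerXn2r ?nnegrE ?enorm_ge0 ?le_max ?enorm_ge0 ?lexx.
  have h2 : enorm b ^+ 2 <= Num.max (enorm a) (enorm b) ^+ 2.
    by rewrite lerXn2r ?nnegrE ?enorm_ge0 ?le_max ?enorm_ge0 ?lexx ?orbT.
  by move: h1 h2; set A := enorm a ^+ 2; set B := enorm b ^+ 2; set C := _ ^+ 2; lra.
apply: (@le_trans _ _ ((2 * Num.max (enorm a) (enorm b)) `^ p)).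
  by rewrite ge0_ler_powR// nnegrE ?enorm_ge0// mulr_ge0// le_max enorm_ge0.
rewrite powRM ?le_max ?enorm_ge0// ler_wpM2l ?powR_ge0//.
by case: (leP (enorm a) (enorm b)) => _; rewrite ?lerDl ?lerDr powR_ge0.
Qed.

Lemma gradn_eq0 Omega phi x : test_function Omega phi -> ~ Omega x -> gradn phi x = 0.
Proof.
move=> tphi Ox; rewrite /gradn (_ : \row__ _ = 0) ?enorm0//.
by apply/rowP => i; rewrite !mxE (test_function_partial_eq0 _ tphi).
Qed.

Lemma integral_eq0_setT d (T : measurableType d) (m : {measure set T -> \bar R})
    (D : set T) (f : T -> \bar R) : (forall x, ~ D x -> f x = 0%E) ->
  (\int[m]_(x in D) f x = \int[m]_x f x)%E.
Proof.
move=> f0; rewrite integral_mkcond; apply: eq_integral => x _.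
by rewrite patchE; case: ifPn => //; rewrite notin_setE => /f0.
Qed.

(** The gradient of [phi] differs from that of [v] by the gradient of [v - phi],
so its p-th power integrates to at most 2^p times the sum of the two integrals. *)
Lemma W0_approx p alpha Omega v (e : R) : open Omega -> 1 <= p -> 0 < e ->
  wW1p0 p alpha Omega v ->
  exists2 phi, test_function Omega phi &
    (wint p alpha Omega (fun x => v x - phi x)%R <= e%:E)%E /\
    (\int[mu]_x (gradn phi x `^ p * enorm x `^ alpha)%:E <=
      (2 `^ p)%:E * (wint p alpha Omega (wgradn Omega v) + e%:E))%E.
Proof.
move=> oO p1 e0 [[_ wv _] app]; have mO := open_measurable_row oO.
have p0 : 0 < p by exact: lt_le_trans p1.
have [phi tphi /(wW1p_norm_lt p0 e0)[h1 h2]] := app (e `^ p^-1) (powR_gt0 _ e0).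
exists phi => //; split => //.
have wphi i := weak_partial_test i mO tphi.
have wvphi i := weak_partialB oO (getPex (wv i)) (wphi i).
have Cphi := test_function_C1 tphi.
have mgv := measurable_wgradn wv.
have mgvp : measurable_fun Omega (wgradn Omega (fun x => v x - phi x)).
  by apply: measurable_wgradn => i; eexists; exact: wvphi.
rewrite -(@integral_eq0_setT _ _ _ Omega); last first.
  by move=> x Ox; rewrite (gradn_eq0 tphi)// powR0 ?gt_eqF// mul0r.
apply: (@le_trans _ _ ((2 `^ p)%:E * (wint p alpha Omega (wgradn Omega v) +
    wint p alpha Omega (wgradn Omega (fun x => v x - phi x)%R)))%E); last first.
  apply: lee_wpmul2l; first by rewrite lee_fin powR_ge0.
  exact: leeD2l.
rewrite /wint -ge0_integralD//; last 4 first.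
- by move=> x _; exact: weight_ge0.
- exact: measurable_weight.
- by move=> x _; exact: weight_ge0.
- exact: measurable_weight.
rewrite -ge0_integralZl//; last 2 first.
- by apply: emeasurable_funD; exact: measurable_weight.
- by move=> x _; apply: adde_ge0; exact: weight_ge0.
apply: ae_ge0_le_integral => //.
- by move=> x _; rewrite lee_fin mulr_ge0// powR_ge0.
- apply: (eq_measurable_fun (fun x => (`|gradn phi x| `^ p * enorm x `^ alpha)%:E)).
    by move=> x _; rewrite ger0_norm// gradn_ge0.
  by apply: measurable_weight => //; apply: measurable_funTS; exact: measurable_gradn.
- by move=> x _; apply: mule_ge0; [rewrite lee_fin powR_ge0|apply: adde_ge0; exact: weight_ge0].
- apply: emeasurable_funM; first exact: measurable_cst.
  by apply: emeasurable_funD; exact: measurable_weight.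
apply: filterS (wgrad_ae_eq oO wvphi) => x E Ox.
rewrite -EFinD -EFinM lee_fin !ger0_norm; [|exact: enorm_ge0..].
rewrite -mulrDl mulrA ler_wpM2r ?powR_ge0//.
rewrite /wgradn (E Ox).
rewrite /gradn (_ : \row_i partial i phi x = wgrad Omega v x -
   \row_i ((get (weak_partial i Omega v) : 'rV[R]_N -> R) x - partial i phi x)).
  exact/enormB_powR/ltW.
by apply/rowP => i; rewrite !mxE subKr.
Qed.

Lemma measurable_sphere_profile (r p alpha E : R) : measurable_fun setT (sphere_profile (n := n) r p alpha E).
Proof.
apply: measurable_funM; first apply: measurable_funM.
- exact: measurable_cst.
- exact: measurable_powR.
- by apply: (measurableT_comp (measurable_powR _)); exact: measurable_funB.
Qed.

Lemma sphere_profile_ge0 (r p alpha E s : R) : 0 <= sphere_profile (n := n) r p alpha E s.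
Proof. by rewrite /sphere_profile; apply: mulr_ge0; [apply: mulr_ge0; exact: powR_ge0|exact: powR_ge0]. Qed.

Lemma sphere_const_gt0 : 0 < sphere_const (R := R) (n := n).
Proof. by rewrite mulr_gt0// addr_gt0 ?shell_vol_gt0 ?kappa_gt0. Qed.

(** Again [le_threshold_powR], with a threshold absorbing half of the lower
bound [c]: a large mean of |w| on a sphere forces a large mean of |w|^p. *)
Lemma sph_powR_ge (w : 'rV[R]_N -> R) (p alpha c a s : R) :
  measurable_fun setT w -> 1 <= p -> 0 <= alpha -> 0 < c -> 0 < a -> a <= s ->
  (c%:E <= sph (fun x => `|w x|%:E) s)%E ->
  ((c / 2 * (c / (2 * shell_vol (R := R) (n := n))) `^ (p - 1) * (a ^+ n * a `^ alpha))%:E <=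
   (s ^+ n)%:E * sph (fun x => (`|w x| `^ p * enorm x `^ alpha)%:E) s)%E.
Proof.
move=> mw p1 al0 c0 a0 as_ hc; have s0 : 0 < s by exact: lt_le_trans as_.
set M := shell_vol (R := R) (n := n) in hc *; have M0 : 0 < M := shell_vol_gt0.
pose d := c / (2 * M); have d0 : 0 < d by rewrite divr_gt0// mulr_gt0.
have maw : measurable_fun setT (fun x => `|w x|) by exact: measurableT_comp.
have mwp : measurable_fun setT (fun x => (`|w x| `^ p)%:E).
  by apply/measurable_EFinP; exact: (measurableT_comp (measurable_powR p) maw).
have wp0 x : (0 <= (`|w x| `^ p)%:E)%E by rewrite lee_fin powR_ge0.
have -> : sph (fun x => (`|w x| `^ p * enorm x `^ alpha)%:E) s =
    ((s `^ alpha)%:E * sph (fun x => (`|w x| `^ p)%:E) s)%E.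
  have <- := @sph_radial R n (fun t => t `^ alpha) (fun x => (`|w x| `^ p)%:E) s (ltW s0) (powR_ge0 _ _) mwp wp0.
  by apply: eq_sph => [|x _]; [exact: ltW|rewrite -EFinM mulrC].
have dp0 : 0 <= d `^ (1 - p) by exact: powR_ge0.
have H : (c%:E <= (c / 2)%:E + (d `^ (1 - p))%:E * sph (fun x => (`|w x| `^ p)%:E) s)%E.
  have -> : c / 2 = d * M.
    by rewrite /d; field; rewrite gt_eqF.
  apply: (le_trans hc); rewrite -(sph_cst s (ltW d0)) -sphZ// -sphD//; last 3 first.
  - by apply: emeasurable_funM.
  - by move=> x; rewrite lee_fin ltW.
  - by move=> x; rewrite mule_ge0.
  apply: le_sph => //; [exact: ltW|exact/measurable_EFinP| |].
    by apply: emeasurable_funD => //; apply: emeasurable_funM.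
  by move=> x _; rewrite -EFinM -EFinD lee_fin; exact: le_threshold_powR.
have {}H : ((c / 2)%:E <= (d `^ (1 - p))%:E * sph (fun x => (`|w x| `^ p)%:E) s)%E.
  have ce : (c%:E = (c / 2)%:E + (c / 2)%:E)%E by rewrite -EFinD -splitr.
  by move: H; rewrite {1}ce leeD2lE.
have {}H : ((c / 2 * d `^ (p - 1))%:E <= sph (fun x => (`|w x| `^ p)%:E) s)%E.
  rewrite mulrC EFinM; apply: (@le_trans _ _ ((d `^ (p - 1))%:E *
      ((d `^ (1 - p))%:E * sph (fun x => (`|w x| `^ p)%:E) s))%E).
    by apply: lee_wpmul2l => //; rewrite lee_fin powR_ge0.
  rewrite muleA -EFinM -powRD ?(gt_eqF d0) ?implybT//.
  by rewrite (_ : p - 1 + (1 - p) = 0) ?powRr0 ?mul1e//; ring.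
rewrite muleA -EFinM [_ * (a ^+ n * _)]mulrC [in leLHS]EFinM; apply: lee_pmul => //.
- by rewrite lee_fin mulr_ge0 ?powR_ge0// exprn_ge0// ltW.
- by rewrite lee_fin !mulr_ge0 ?powR_ge0// ltW.
- rewrite lee_fin ler_pM ?powR_ge0 ?exprn_ge0 ?(ltW a0)//.
    by rewrite lerXn2r ?nnegrE ?(ltW a0) ?(ltW s0).
  by rewrite ge0_ler_powR ?nnegrE ?(ltW a0) ?(ltW s0).
Qed.

(** A Chebyshev inequality on the radii, through polar coordinates. *)
Lemma sph_chebyshev (C : R) (S : set R) (G : 'rV[R]_N -> \bar R) : 0 <= C ->
  measurable S -> (forall s, S s -> 0 < s) ->
  measurable_fun setT G -> (forall x, 0 <= G x)%E ->
  (forall s, S s -> C%:E <= (s ^+ n)%:E * sph G s)%E ->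
  (C%:E * leb S <= (kappa (R := R) (n := n))%:E * \int[mu]_x G x)%E.
Proof.
move=> C0 mS Spos mG G0 key.
rewrite -kappaE -polar_sph// -integral_cst// [leLHS]integral_mkcond.
have msG : measurable_fun setT (sph G) by exact: measurable_sph.
have sG0 s : (0 <= sph G s)%E by exact: sph_ge0.
have r0 s : (0 <= (\1_(`]0%R, +oo[%classic) s * s ^+ n)%:E * sph G s)%E.
  by rewrite mule_ge0// lee_fin radius_weight_ge0.
apply: ge0_le_integral => //.
- by move=> s _; rewrite patchE; case: ifPn => // _; rewrite lee_fin.
- by apply/(measurable_restrictT _ _).1 => //; exact: measurable_cst.
- by apply: emeasurable_funM => //; apply/measurable_EFinP; exact: measurable_radius_weight.
move=> s _; rewrite patchE; case: ifPn => // /set_mem Ss.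
rewrite indicE mem_set ?mul1r; first exact: key.
by rewrite /= in_itv/= Spos.
Qed.

(** On a set of radii bounded away from 0 where the mean of |v| exceeds the bound
for test functions by a fixed amount, the mean of |v - phi| is bounded below for
every approximating test function phi; since the weighted norm of v - phi is
arbitrarily small, such a set is null. The bad radii form a countable union of
sets of this kind. *)
Lemma sphere_limit (r p alpha E : R) v : 0 < r -> 1 <= p -> 0 <= alpha -> 0 < E ->
  wW1p0 p alpha (eball N r) v ->
  ((2 `^ p)%:E * wint p alpha (eball N r) (wgradn (eball N r) v) < E%:E)%E ->
  {ae leb, forall s, 0 < s < r ->
    (sph (fun x => `|(v \_ (eball N r)) x|%:E) s <= (sphere_const (n := n) * sphere_profile (n := n) r p alpha E s)%:E)%E}.
Proof.
move=> r0 p1 al0 E0 Wv DE.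
set B := eball N r in Wv DE *; set D := wint _ _ _ _ in DE.
have oB : open B := @open_eball R N r; have mB := open_measurable_row oB.
have p0 : 0 < p by exact: lt_le_trans p1.
have [[[mv _] _ _] _] := Wv.
pose H s := sphere_const (n := n) * sphere_profile (n := n) r p alpha E s.
have mvB : measurable_fun setT (v \_ B) by exact: (measurable_restrictT v mB).1.
pose F := sph (fun x => `|(v \_ B) x|%:E).
have mabs : measurable_fun setT (fun x => `|(v \_ B) x|%:E).
  by apply/measurable_EFinP; exact: measurableT_comp.
have mF : measurable_fun setT F by apply: measurable_sph.
have mH : measurable_fun setT H.
  by apply: measurable_funM; [exact: measurable_cst|exact: measurable_sphere_profile].
pose c (k : nat) : R := k.+1%:R^-1.
have c0 k : 0 < c k by rewrite invr_gt0.
pose S k := `[c k, r[%classic `&` [set s | ((H s + c k)%:E <= F s)%E].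
have mS k : measurable (S k).
  apply: measurable_lee => //.
    apply: measurable_funTS; apply/measurable_EFinP; exact: measurable_funD.
  exact: measurable_funTS.
(* on S k the mean of |v - phi| is at least c k for every phi close to v *)
have nullS k : leb (S k) = 0%E.
  apply/eqP; rewrite eq_le measure_ge0 andbT.
  pose C1 := c k / 2 * (c k / (2 * shell_vol (R := R) (n := n))) `^ (p - 1) * (c k ^+ n * c k `^ alpha).
  have C10 : 0 < C1.
    have M0 : 0 < shell_vol (R := R) (n := n) := shell_vol_gt0.
    by rewrite /C1 !mulr_gt0 ?powR_gt0 ?exprn_gt0 ?divr_gt0 ?mulr_gt0.
  have K0 : 0 < kappa (R := R) (n := n) := kappa_gt0.
  have [e0 e00 De0] : exists2 e0 : R, 0 < e0 & ((2 `^ p)%:E * (D + e0%:E) <= E%:E)%E.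
    have D0 : (0 <= D)%E by exact: wint_ge0.
    have P0 : 0 < 2 `^ p :> R by rewrite powR_gt0.
    case: D D0 DE => [d d0|_|//]; last by rewrite gt0_muley ?lte_fin.
    rewrite -EFinM lte_fin => dE.
    exists (E / 2 `^ p - d); first by rewrite subr_gt0 ltr_pdivlMr// mulrC.
    by rewrite -EFinD -EFinM lee_fin [d + _]addrC subrK mulrC divfK ?gt_eqF.
  apply/lee_addgt0Pr => e egt0; rewrite add0e.
  (* e0 keeps phi in the range of the radial estimate, the other term makes
     the measure of S k at most e *)
  pose e1 := Num.min e0 (e * C1 / kappa (R := R) (n := n)).
  have e10 : 0 < e1 by rewrite lt_min e00/= divr_gt0// mulr_gt0.
  have [phi tphi [h1 h2]] := W0_approx oB p1 e10 Wv.
  have Cphi := test_function_C1 tphi; have [cphi _ _] := Cphi.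
  have mphi : measurable_fun setT phi by exact: continuous_measurable_row.
  have phi0 x : r <= enorm x -> phi x = 0.
    by move=> rx; apply: (test_function_eq0 tphi); rewrite /B /eball /= ltNge rx.
  have hE : (\int[mu]_x (gradn phi x `^ p * enorm x `^ alpha)%:E <= E%:E)%E.
    apply: (le_trans h2); apply: le_trans De0; apply: lee_wpmul2l.
      by rewrite lee_fin powR_ge0.
    by apply: leeD2l; rewrite lee_fin ge_min lexx.
  pose w x := (v \_ B) x - phi x.
  have mw : measurable_fun setT w by exact: measurable_funB.
  pose G x := (`|w x| `^ p * enorm x `^ alpha)%:E.
  have mG : measurable_fun setT G by exact: measurable_weight.
  have G0 x : (0 <= G x)%E by exact: weight_ge0.
  have key s : S k s -> (C1%:E <= (s ^+ n)%:E * sph G s)%E.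
    move=> [/=]; rewrite in_itv/= => /andP[cs sr] HF.
    have s0 : 0 < s by exact: lt_le_trans cs.
    apply: sph_powR_ge => //.
    have sb := sphere_bound s0 sr p1 al0 E0 Cphi phi0 hE.
    have : ((H s + c k)%:E <= sph (fun x => `|w x|%:E) s + (H s)%:E)%E.
      apply: (le_trans HF).
      apply: (@le_trans _ _ (sph (fun x => `|w x|%:E) s + sph (fun x => `|phi x|%:E) s)%E); last exact: leeD2l.
      rewrite -sphD//; last 2 first.
      - by apply/measurable_EFinP; exact: measurableT_comp.
      - by apply/measurable_EFinP; exact: measurableT_comp.
      apply: le_sph => //; [exact: ltW| |].
        by apply: emeasurable_funD; apply/measurable_EFinP; exact: measurableT_comp.
      move=> x _; rewrite -EFinD lee_fin.
      by have := ler_normD (w x) (phi x); rewrite /w subrK.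
    by rewrite addrC EFinD leeD2rE.
  clearbody C1; have wG : (\int[mu]_x G x = wint p alpha B (fun x => v x - phi x)%R)%E.
    rewrite -(@integral_eq0_setT _ _ _ B); last first.
      move=> x Bx; rewrite /G /w patchE memNset// (test_function_eq0 tphi)//.
      by rewrite subrr normr0 powR0 ?gt_eqF// mul0r.
    by apply: eq_integral => x Bx; rewrite /G /w patchE Bx.
  have Spos s : S k s -> 0 < s.
    by case=> /=; rewrite in_itv/= => /andP[cs _] _; exact: lt_le_trans cs.
  have := sph_chebyshev (ltW C10) (mS k) Spos mG G0 key.
  rewrite wG => {}key.
  have : (C1%:E * leb (S k) <= C1%:E * e%:E)%E.
    apply: (le_trans key); apply: (@le_trans _ _ (kappa (R := R) (n := n) * e1)%:E).
      by rewrite EFinM; apply: lee_wpmul2l => //; rewrite lee_fin ltW.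
    rewrite -EFinM lee_fin [leLHS]mulrC -ler_pdivlMr// (mulrC C1) ge_min.
    by apply/orP; right; exact: lexx.
  by rewrite lee_pmul2l ?lte_fin.
have nS : leb.-negligible (\bigcup_k S k).
  by apply: negligible_bigcup => k; exists (S k); split; [exact: mS|exact: nullS|].
suff sub : ~` [set s | 0 < s < r -> (F s <= (H s)%:E)%E] `<=` \bigcup_k S k.
  apply: (@filterS _ _ (ae_filter_ringOfSetsType leb) (~` \bigcup_k S k)).
    by move=> s /= Ss; apply: contrapT => /sub.
  have: leb.-negligible (~` (~` \bigcup_k S k)) by rewrite setCK.
  exact.
move=> s /= /not_implyP[/andP[s0 sr]] /negP; rewrite -ltNge => HF.
have [k1 hk1] := ltr_add_invr s0; rewrite add0r in hk1.
have [k2 hk2] : exists k, ((H s + k.+1%:R^-1)%:E <= F s)%E.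
  case: (F s) HF => [f||//]; last by exists 0%N; rewrite leey.
  by rewrite lte_fin => /ltr_add_invr[k hk]; exists k; rewrite lee_fin ltW.
have le_c i j : (i <= j)%N -> c j <= c i.
  by move=> ij; rewrite /c lef_pV2 ?posrE// ler_nat.
exists (maxn k1 k2) => //; split => /=.
  by rewrite in_itv/= sr andbT (le_trans (le_c _ _ (leq_maxl _ _)))// ltW.
by apply: le_trans hk2; rewrite lee_fin lerD2l; apply: le_c; exact: leq_maxr.
Qed.

(** By polar coordinates almost every sphere meets the exceptional null set of
the radial representation in a null set of directions; in the other directions
|v| takes the same value. *)
Lemma radial_sph (r : R) v (f : R -> R) : measurable_fun (eball N r) v ->
  {ae mu, forall x, eball N r x -> v x = f (enorm x)} ->
  {ae leb, forall s, 0 < s < r -> exists2 a : R, 0 <= a &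
    forall q, 0 < q -> sph (fun x => (`|(v \_ (eball N r)) x| `^ q)%:E) s =
      (a `^ q * shell_vol (R := R) (n := n))%:E}.
Proof.
move=> mv [Z [mZ Z0 Zv]]; set B := eball N r in mv Zv *.
have oB : open B := @open_eball R N r; have mB := open_measurable_row oB.
have m1 : measurable_fun setT (fun x => (\1_Z x)%:E : \bar R).
  by apply/measurable_EFinP; exact: measurable_indic.
have ge1 x : (0 <= (\1_Z x)%:E :> \bar R)%E by rewrite lee_fin.
have ms : measurable_fun setT (sph (fun x => (\1_Z x)%:E)) by exact: measurable_sph.
have iZ : (\int[mu]_x (\1_Z x)%:E = 0)%E by rewrite integral_indic// setIT; exact: Z0.
have := polar_sph m1 ge1; rewrite iZ mule0 => h0.
have : {ae leb, forall s, (setT : set R) s -> ((\1_(`]0%R, +oo[%classic) s * s ^+ n)%:E *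
    sph (fun x => (\1_Z x)%:E) s = 0)%E}.
  apply/ae_eq_integral_abs => //.
    by apply: emeasurable_funM => //; apply/measurable_EFinP; exact: measurable_radius_weight.
  rewrite -[RHS]h0; apply: eq_integral => s _; rewrite gee0_abs// mule_ge0 ?lee_fin ?radius_weight_ge0//.
  exact: sph_ge0.
apply: (@filterS _ _ (ae_filter_ringOfSetsType leb)) => s hs /andP[s0 sr].
have {}hs : sph (fun x => (\1_Z x)%:E) s = 0%E.
  have /eqP := hs Logic.I; rewrite indicE mem_set ?mul1r; last by rewrite /= in_itv/= s0.
  by rewrite mule_eq0 eqe expf_eq0 (gt_eqF s0) andbF/= => /eqP.
exists `|f s| => // q q0.
have mvq : measurable_fun setT (fun x => (`|(v \_ B) x| `^ q)%:E).
  apply/measurable_EFinP; apply: (measurableT_comp (measurable_powR q)).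
  by apply: measurableT_comp => //; exact: (measurable_restrictT v mB).1.
have mfs : measurable_fun setT (fun _ : 'rV[R]_N => (`|f s| `^ q)%:E) by exact: measurable_cst.
rewrite -(sph_cst s (powR_ge0 _ _)) /sph.
have : {ae mu, forall y, (setT : set 'rV[R]_N) y -> ((\1_shell y)%:E *
    (\1_Z ((s / enorm y) *: y))%:E = 0 :> \bar R)%E}.
  have mm := measurable_sph_int s m1; apply/(ae_eq_integral_abs mu measurableT mm).
  rewrite -[RHS]hs; apply: eq_integral => y _; rewrite gee0_abs//; exact: sph_int_ge0.
move=> aey; apply: ae_eq_integral => //.
- by have := measurable_sph_int s mvq; exact.
- by have := measurable_sph_int s mfs; exact.
apply: filterS aey => y hy _; have := hy Logic.I.
rewrite indicE; case: (boolP (y \in shell)); last by rewrite !mul0e.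
rewrite inE => ys; rewrite !mul1e indicE; set x := _ *: _.
case: (boolP (x \in Z)) => [_ /eqP|]; first by rewrite eqe oner_eq0.
rewrite notin_setE => Zx _; have ex : enorm x = s by apply: enorm_dir => //; exact: ltW.
have Bx : B x by rewrite /B /eball /= ex.
rewrite patchE mem_set//; congr ((`| _ | `^ q)%:E).
have := contra_not (@Zv x) Zx => /= /contrapT/(_ Bx) ->.
by rewrite ex.
Qed.

End limit.

(** * The radial upper bound *)

Section radial_bound.
Context {R : realType}.
Local Notation leb := (@lebesgue_measure R).

(** With u = 1 - s/r, the factor (1-u)^m decays like exp(-m u), and half of this
exponent absorbs u^k at the price of the factor (2k/m)^k. *)
Lemma power_profile_le (m k r s : R) : 0 < m -> 0 < k -> 0 < s -> s < r ->
  s `^ m * (r - s) `^ k <=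
  r `^ (m + k) * (2 * k) `^ k * m `^ (- k) * expR (- (m / 2) * (1 - s / r)).
Proof.
move=> m0 k0 s0 sr; have r0 : 0 < r by exact: lt_trans sr.
pose u : R := 1 - s / r.
have u0 : 0 < u by rewrite subr_gt0 ltr_pdivrMr// mul1r.
have u1 : 0 < 1 - u by rewrite /u subKr divr_gt0.
have -> : s = r * (1 - u) by rewrite /u subKr mulrC divfK ?gt_eqF.
have -> : r - r * (1 - u) = r * u by ring.
have -> : r * (1 - u) / r = 1 - u by rewrite mulrC mulKf ?gt_eqF.
have -> : 1 - (1 - u) = u by rewrite subKr.
rewrite (powRM m (ltW r0) (ltW u1)) (powRM k (ltW r0) (ltW u0)).
clearbody u.
have h1 : (1 - u) `^ m <= expR (- u * m).
  rewrite expRM ge0_ler_powR ?nnegrE ?(ltW m0) ?(ltW u1) ?expR_ge0//.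
  exact: expR_ge1Dx.
have h2 : u `^ k <= (2 * k) `^ k * m `^ (- k) * expR (m / 2 * u).
  have -> : (2 * k) `^ k * m `^ (- k) * expR (m / 2 * u) = (2 * k / m * expR (m * u / (2 * k))) `^ k.
    have k2 : 0 <= 2 * k by rewrite mulr_ge0// ltW.
    have mi : 0 <= m^-1 by rewrite invr_ge0 ltW.
    rewrite (powRM k (mulr_ge0 k2 mi) (expR_ge0 _)) (powRM k k2 mi) -expRM.
    rewrite -(powR_inv1 (ltW m0)) -powRrM mulN1r.
    by congr (_ * expR _); field; rewrite gt_eqF.
  rewrite ge0_ler_powR ?nnegrE ?(ltW k0) ?(ltW u0)//.
    by rewrite mulr_ge0 ?expR_ge0 ?divr_ge0 ?mulr_ge0 ?(ltW k0) ?(ltW m0).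
  apply: (@le_trans _ _ (2 * k / m * (m * u / (2 * k)))).
    by rewrite (_ : 2 * k / m * (m * u / (2 * k)) = u)//; field; rewrite !gt_eqF.
  rewrite ler_wpM2l ?divr_ge0 ?mulr_ge0 ?(ltW k0) ?(ltW m0)//.
  by apply: le_trans (expR_ge1Dx _); rewrite lerDr.
have := ler_pM (powR_ge0 _ _) (powR_ge0 _ _) h1 h2.
move=> h.
have -> : r `^ m * (1 - u) `^ m * (r `^ k * u `^ k) =
  r `^ (m + k) * ((1 - u) `^ m * u `^ k).
  by rewrite powRD ?(gt_eqF r0) ?implybT//; ring.
rewrite -!mulrA ler_wpM2l ?powR_ge0//; apply: (le_trans h).
rewrite (_ : expR (- (m / 2) * u) = expR (- u * m) * expR (m / 2 * u)).
  by rewrite le_eqVlt; apply/orP; left; apply/eqP; ring.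
by rewrite -expRD; congr expR; field.
Qed.

Lemma integral_expR_le (m r : R) : 0 < m -> 0 < r ->
  (\int[leb]_(s in `]0%R, r[%classic) (expR (- (m / 2) * (1 - s / r)))%:E <= (2 * r / m)%:E)%E.
Proof.
move=> m0 r0.
pose f (s : R) := expR (- (m / 2) * (1 - s / r)).
pose F (s : R) := 2 * r / m * f s.
have dF (s : R) : is_derive s 1 F (f s).
  rewrite /F /f; apply: is_derive_eq; rewrite /GRing.scale/=.
  by set e := expR _; field; rewrite !gt_eqF.
have cf : continuous f.
  move=> s; apply: continuous_comp; last exact: continuous_expR.
  apply: continuousM; first exact: cvg_cst.
  by apply: continuousB; [exact: cvg_cst|apply: continuousM => //; exact: cvg_cst].
have cF : continuous F by move=> s; apply: derivable_continuous1; have [] := dF s.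
have H : (\int[leb]_(s in `[0%R, r]%classic) (f s)%:E = (F r)%:E - (F 0%R)%:E)%E.
  apply: continuous_FTC2 => //.
  - exact: continuous_subspaceT.
  - split=> [s _||]; first by have [] := dF s.
    + by apply: cvg_at_right_filter; exact: cF.
    + by apply: cvg_at_left_filter; exact: cF.
  - by move=> s _; rewrite derive1E; have [] := dF s.
have mf : measurable_fun setT (fun s => (f s)%:E).
  by apply/measurable_EFinP; exact: continuous_measurable_fun.
apply: (@le_trans _ _ (\int[leb]_(s in `[0%R, r]%classic) (f s)%:E)%E).
  apply: ge0_subset_integral => //.
  - exact: measurable_funTS.
  - by apply: subset_itv; rewrite bnd_simp.
rewrite H -EFinB lee_fin /F /f divff ?gt_eqF// subrr mulr0 expR0 mulr1 lerBlDr lerDl.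
by rewrite mulr_ge0 ?expR_ge0// divr_ge0 ?mulr_ge0 ?(ltW m0) ?(ltW r0).
Qed.

(** The mass sits at distance about r/m from the boundary, whence k + 1 negative
powers of [m]. *)
Lemma profile_integral_le (m k r : R) : 0 < m -> 0 < k -> 0 < r ->
  (\int[leb]_(s in `]0%R, r[%classic) (s `^ m * (r - s) `^ k)%:E <=
   (2 * (2 * k) `^ k * r `^ (m + k + 1) * m `^ (- (k + 1)))%:E)%E.
Proof.
move=> m0 k0 r0.
pose c := r `^ (m + k) * (2 * k) `^ k * m `^ (- k).
have c0 : 0 <= c by rewrite /c !mulr_ge0 ?powR_ge0.
have mf : measurable_fun `]0%R, r[%classic (fun s : R => (expR (- (m / 2) * (1 - s / r)))%:E).
  apply: measurable_funTS; apply/measurable_EFinP; apply: (measurableT_comp (@measurable_expR R)).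
  apply: measurable_funM; first exact: measurable_cst.
  by apply: measurable_funB; [exact: measurable_cst|apply: measurable_funM => //; exact: measurable_cst].
apply: (@le_trans _ _ (\int[leb]_(s in `]0%R, r[%classic) (c%:E * (expR (- (m / 2) * (1 - s / r)))%:E))%E).
  apply: ge0_le_integral => //.
  - by move=> s _; rewrite lee_fin mulr_ge0// powR_ge0.
  - apply: measurable_funTS; apply/measurable_EFinP; apply: measurable_funM.
      exact: measurable_powR.
    by apply: (measurableT_comp (measurable_powR _)); exact: measurable_funB.
  - by apply: emeasurable_funM => //; exact: measurable_cst.
  - move=> s; rewrite /= in_itv/= => /andP[s0 sr]; rewrite -EFinM lee_fin.
    exact: power_profile_le.
rewrite ge0_integralZl//.
apply: (@le_trans _ _ (c%:E * (2 * r / m)%:E)%E).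
  by apply: lee_wpmul2l; [rewrite lee_fin|exact: integral_expR_le].
have er : r `^ (m + k + 1) = r `^ (m + k) * r.
  by rewrite powRD ?(gt_eqF r0) ?implybT// powRr1 ?(ltW r0).
have em : m `^ (- (k + 1)) = m `^ (- k) * m^-1.
  by rewrite opprD powRD ?(gt_eqF m0) ?implybT// powR_inv1 ?(ltW m0).
rewrite -EFinM lee_fin /c er em.
by rewrite le_eqVlt; apply/orP; left; apply/eqP; ring.
Qed.

Context {n : nat}.
Local Notation N := n.+1.
Local Notation mu := (@lebesgue_row R N).
Local Notation Ms := (shell_vol (R := R) (n := n)).
Local Notation Kh := (sphere_const (R := R) (n := n)).
Local Notation hp := (sphere_profile (R := R) (n := n)).

Lemma sphere_profile_powR (r p alpha E s q : R) : 0 < s -> s < r -> 0 < E ->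
  (hp r p alpha E s) `^ q =
  E `^ (q / p) * (s `^ (- (((alpha + n%:R) / p) * q)) * (r - s) `^ (q * (1 - p^-1))).
Proof.
move=> s0 sr E0; rewrite /sphere_profile !powRM ?mulr_ge0 ?powR_ge0//.
rewrite -!powRrM mulNr (mulrC p^-1) (mulrC (1 - _)) mulrA.
by [].
Qed.

(** On almost every sphere |v| is a constant a, and the bound on the mean of |v|
is a bound on a; its q-th power gives the mean of |v|^q, which polar coordinates
integrate. *)
Lemma radial_wint_le (r p alpha gamma q E : R) (v : 'rV[R]_N -> R) :
  0 < r -> 1 <= p -> 0 <= alpha -> 0 < q -> 0 < E ->
  wW1p0 p alpha (eball N r) v -> radially_symmetric (eball N r) v ->
  ((2 `^ p)%:E * wint p alpha (eball N r) (wgradn (eball N r) v) < E%:E)%E ->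
  ((kappa (R := R) (n := n))%:E * wint q gamma (eball N r) v <=
   (Ms * (Kh / Ms) `^ q * E `^ (q / p))%:E *
   \int[leb]_(s in `]0%R, r[%classic)
      (s `^ (n%:R + gamma - (alpha + n%:R) / p * q) * (r - s) `^ (q * (1 - p^-1)))%:E)%E.
Proof.
move=> r0 p1 al0 q0 E0 Wv [f vf] DE.
have hs := sphere_limit r0 p1 al0 E0 Wv DE.
have [[[mv _] _ _] _] := Wv.
have hr := radial_sph mv vf.
move: mv hs hr {vf DE Wv}; set B := eball N r => mv hs hr.
have oB : open B := @open_eball R N r; have mB := open_measurable_row oB.
have mvB : measurable_fun setT (v \_ B) by exact: (measurable_restrictT v mB).1.
pose G x := (`|(v \_ B) x| `^ q * enorm x `^ gamma)%:E.
have mG : measurable_fun setT G by exact: measurable_weight.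
have G0 x : (0 <= G x)%E by exact: weight_ge0.
have vB0 x : ~ B x -> (v \_ B) x = 0 by move=> Bx; rewrite patchE memNset.
have -> : wint q gamma B v = (\int[mu]_x G x)%E.
  rewrite -(@integral_eq0_setT R _ _ mu B); last first.
    by move=> x /vB0; rewrite /G => ->; rewrite normr0 powR0 ?gt_eqF// mul0r.
  by apply: eq_integral => x Bx; rewrite /G patchE Bx.
have M0 : 0 < Ms by exact: shell_vol_gt0.
have c0 : 0 <= Ms * (Kh / Ms) `^ q * E `^ (q / p) by rewrite !mulr_ge0 ?powR_ge0// ltW.
have mpr : measurable_fun setT (fun s : R => (s `^ (n%:R + gamma - (alpha + n%:R) / p * q) *
    (r - s) `^ (q * (1 - p^-1)))%:E).
  apply/measurable_EFinP; apply: measurable_funM; first exact: measurable_powR.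
  by apply: (measurableT_comp (measurable_powR _)); exact: measurable_funB.
have msG : measurable_fun setT (sph G) by exact: measurable_sph.
have sG0 s : (0 <= sph G s)%E by exact: sph_ge0.
rewrite -kappaE -polar_sph//.
rewrite -ge0_integralZl//; last 2 first.
- exact: measurable_funTS.
- by move=> s _; rewrite lee_fin mulr_ge0 ?powR_ge0.
rewrite [leRHS]integral_mkcond.
apply: ae_ge0_le_integral => //.
- by move=> s _; rewrite mule_ge0// lee_fin radius_weight_ge0.
- by apply: emeasurable_funM => //; apply/measurable_EFinP; exact: measurable_radius_weight.
- move=> s _; rewrite patchE; case: ifPn => // _.
  by rewrite -EFinM lee_fin !mulr_ge0 ?powR_ge0// ltW.
- apply: (measurable_restrictT _ _).1 => //; apply: measurable_funTS.
  by apply: emeasurable_funM => //; exact: measurable_cst.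
apply: (@filterS2 _ _ (ae_filter_ringOfSetsType leb) _ _ _ _ hs hr) => s {}hs {}hr _.
rewrite patchE; case: ifPn => [/set_mem|/negP ns].
  rewrite /= in_itv/= => /andP[s0 sr].
  have ssr : 0 < s < r by rewrite s0.
  have {}hs := hs ssr; have [a a0 ha] := hr ssr.
  rewrite indicE mem_set ?mul1r; last by rewrite /= in_itv/= s0.
  have -> : sph G s = ((s `^ gamma)%:E * sph (fun x => (`|(v \_ B) x| `^ q)%:E) s)%E.
    have <- := @sph_radial R n (fun t => t `^ gamma) (fun x => (`|(v \_ B) x| `^ q)%:E) s (ltW s0) (powR_ge0 _ _).
    - by apply: eq_sph => [|x _]; [exact: ltW|rewrite -EFinM mulrC].
    - apply/measurable_EFinP; apply: (measurableT_comp (measurable_powR q)).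
      exact: measurableT_comp.
    - by move=> x; rewrite lee_fin powR_ge0.
  rewrite ha// -!EFinM lee_fin.
  have ale : a <= Kh / Ms * hp r p alpha E s.
    move: hs; have -> : sph (fun x => `|(v \_ B) x|%:E) s = (a * Ms)%:E.
      rewrite -[a in RHS]powRr1// -ha//; apply: eq_sph => [|x _]; first exact: ltW.
      by rewrite powRr1.
    by rewrite lee_fin [_ / _ * _]mulrAC ler_pdivlMr.
  have K0 : 0 <= Kh / Ms by rewrite divr_ge0// ltW// sphere_const_gt0.
  have aq : a `^ q <= (Kh / Ms) `^ q * (hp r p alpha E s) `^ q.
    have h0 := sphere_profile_ge0 (n := n) r p alpha E s.
    rewrite -powRM//; apply: ge0_ler_powR => //; first exact: ltW.
    by rewrite nnegrE mulr_ge0.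
  rewrite sphere_profile_powR// in aq.
  apply: (@le_trans _ _ (s ^+ n * (s `^ gamma * ((Kh / Ms) `^ q * (E `^ (q / p) *
     (s `^ (- ((alpha + n%:R) / p * q)) * (r - s) `^ (q * (1 - p^-1)))) * Ms)))).
    by rewrite ler_wpM2l ?exprn_ge0 ?(ltW s0)// ler_wpM2l ?powR_ge0// ler_wpM2r// ltW.
  rewrite !powRD ?(gt_eqF s0) ?implybT// powR_mulrn ?(ltW s0)//.
  by rewrite le_eqVlt; apply/orP; left; apply/eqP; ring.
rewrite indicE; case: (boolP (s \in _)) => [/set_mem|_]; last by rewrite mul0r mul0e.
rewrite /= in_itv/= andbT => s0.
have rs : r <= s by rewrite leNgt; apply/negP => sr; apply: ns; rewrite inE/= in_itv/= s0.
rewrite (_ : sph G s = 0%E) ?mule0//.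
have z : sph (fun _ : 'rV[R]_N => (0 : R)%:E) s = 0%E.
  by rewrite (sph_cst s (lexx 0)) mul0r.
rewrite -[RHS]z.
apply: eq_sph => [|x xs]; first exact: ltW.
by rewrite /G vB0 ?normr0 ?powR0 ?gt_eqF ?mul0r// /B /eball /= xs ltNge rs.
Qed.

End radial_bound.

(** * A competitor concentrated near the boundary *)

Section competitor.
Context {R : realType} {n : nat}.
Local Notation N := n.+1.
Local Notation mu := (@lebesgue_row R N).
Implicit Types (f phi : 'rV[R]_N -> R) (Omega : set 'rV[R]_N).

Lemma lebesgue_cbox (a b : 'I_N -> R) : (forall i, a i <= b i) ->
  mu (cbox a b) = (\prod_(i < N) (b i - a i))%:E.
Proof.
move=> ab.
rewrite (_ : cbox a b = [set x | forall i, (`[a i, b i]%classic : set R) (x ord0 i)]); last first.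
  by apply/seteqP; split=> x H i; have := H i; rewrite /= in_itv.
rewrite (@lebesgue_row_box _ _ (fun i => `[a i, b i]%classic)); last first.
  by move=> i; exact: measurable_itv.
rewrite -prodEFin; apply: eq_bigr => i _.
rewrite lebesgue_measure_itv/= lte_fin; case: ltgtP (ab i) => // -> _.
by rewrite subrr.
Qed.

Lemma wint_le_scaled (p alpha c : R) Omega (A : set 'rV[R]_N) f : measurable Omega ->
  measurable A -> A `<=` Omega -> measurable_fun Omega f -> 0 <= c ->
  (forall x, Omega x -> `|f x| `^ p * enorm x `^ alpha <= c * \1_A x) ->
  (wint p alpha Omega f <= c%:E * mu A)%E.
Proof.
move=> mO mA AO mf c0 H; rewrite -integral_scaled_indic//.
rewrite -(@integral_eq0_setT R _ _ mu Omega); last first.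
  by move=> x Ox; rewrite indicE memNset ?mulr0// => /AO.
apply: ge0_le_integral => //.
- by move=> x _; exact: weight_ge0.
- exact: measurable_weight.
- apply: measurable_funTS; apply/measurable_EFinP; apply: measurable_funM => //.
Qed.

Lemma scaled_le_wint (p alpha c : R) Omega (A : set 'rV[R]_N) f : measurable Omega ->
  measurable A -> A `<=` Omega -> measurable_fun Omega f -> 0 <= c ->
  (forall x, A x -> c <= `|f x| `^ p * enorm x `^ alpha) ->
  (c%:E * mu A <= wint p alpha Omega f)%E.
Proof.
move=> mO mA AO mf c0 H; rewrite -integral_scaled_indic//.
rewrite -(@integral_eq0_setT R _ _ mu Omega); last first.
  by move=> x Ox; rewrite indicE memNset ?mulr0// => /AO.
apply: ge0_le_integral => //.
- by move=> x _; rewrite lee_fin mulr_ge0.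
- apply: measurable_funTS; apply/measurable_EFinP; apply: measurable_funM => //.
- exact: measurable_weight.
move=> x Ox; rewrite lee_fin indicE; case: (boolP (x \in A)) => [/set_mem|_].
  by rewrite mulr1; exact: H.
by rewrite mulr0 mulr_ge0 ?powR_ge0.
Qed.

Lemma wint_wgradn_test (p alpha : R) Omega phi : open Omega -> test_function Omega phi ->
  wint p alpha Omega (wgradn Omega phi) = wint p alpha Omega (gradn phi).
Proof.
move=> oO tphi; have mO := open_measurable_row oO.
have wphi i := weak_partial_test i mO tphi.
have mg := measurable_gradn (test_function_C1 tphi).
have mw : measurable_fun Omega (wgradn Omega phi).
  by apply: measurable_wgradn => i; eexists; exact: wphi.
apply: ae_eq_integral => //.
- exact: measurable_weight.
- by apply: measurable_weight => //; exact: measurable_funTS.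
by apply: filterS (wgrad_ae_eq oO wphi) => x E Ox; rewrite /wgradn E.
Qed.

(** A test function approximates itself, and the zero function has norm zero
because its chosen gradient vanishes almost everywhere. *)
Lemma wW1p0_test (p alpha : R) Omega phi : 0 < p -> open Omega -> test_function Omega phi ->
  (wint p alpha Omega phi < +oo)%E -> (wint p alpha Omega (gradn phi) < +oo)%E ->
  wW1p0 p alpha Omega phi.
Proof.
move=> p0 oO tphi i0 i1; have mO := open_measurable_row oO.
have wphi i := weak_partial_test i mO tphi.
have [cphi _ _] := test_function_C1 tphi.
have mphi : measurable_fun setT phi by exact: continuous_measurable_row.
split.
  split.
  - split; first exact: measurable_funTS.
    exact: poweR_lty.
  - by move=> i; eexists; exact: wphi.
  - rewrite (@wW1p_normE R n p alpha Omega phi (lt0r_neq0 p0)); apply: poweR_lty.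
    apply: lte_add_pinfty; first exact: i0.
    by rewrite (wint_wgradn_test p alpha oO tphi).
move=> e e0; exists phi => //.
have wd i := weak_partialB oO (wphi i) (wphi i).
rewrite (@wW1p_normE R n p alpha Omega _ (lt0r_neq0 p0)).
rewrite (_ : wint p alpha Omega (fun x => phi x - phi x)%R = 0%E); last first.
  by apply: integral0_eq => x _; rewrite subrr normr0 powR0 ?gt_eqF// mul0r.
rewrite (_ : wint p alpha Omega (wgradn _ _) = 0%E); last first.
  rewrite -[RHS](integral0 mu Omega); apply: ae_eq_integral => //.
    apply: measurable_weight => //; apply: measurable_wgradn => i.
    by eexists; exact: wd.
  apply: filterS (wgrad_ae_eq oO wd) => x E Ox; rewrite /wgradn E//.
  rewrite (_ : \row__ _ = 0) ?enorm0 ?normr0 ?powR0 ?gt_eqF ?mul0r//.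
  by apply/rowP => i; rewrite !mxE subrr.
by rewrite add0e poweR0r ?lte_fin// invr_neq0// gt_eqF.
Qed.

(** A bump of half-width 1/g and slope g is a rescaled copy of the bump on
[-1, 1] of slope 1, so its derivative is of order g. *)
Lemma derive1_bump_scale (c g t : R) : 0 < g ->
  derive1 (bump (c - g^-1) (c + g^-1) g) t = g * derive1 (bump (- 1) 1 1) (g * t + (- (g * c))).
Proof.
move=> g0.
rewrite (_ : bump (c - g^-1) (c + g^-1) g = (fun t => bump (- 1) 1 1 (g * t + (- (g * c))))); last first.
  apply/funext => u; rewrite /bump !mul1r.
  by congr (expinv _ * expinv _); field; rewrite gt_eqF.
have d := @smooth1_derivable R _ (g * t + (- (g * c))) (smooth1_bump (- 1) 1 (1 : R)).
by rewrite derive1E; have [_ ->] := is_derive_affine d.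
Qed.

Lemma derive1_bump_bound : exists2 M : R, 0 < M &
  forall t, - 1 <= t <= 1 -> `|derive1 (bump (- 1) 1 (1 : R)) t| <= M.
Proof.
pose f (t : R) := `|derive1 (bump (- 1) 1 (1 : R)) t|.
have cf : continuous f.
  move=> t; apply: (@continuous_comp _ _ _ _ (fun x : R => `|x|)); last exact: norm_continuous.
  exact: smooth1_continuous (smooth1_derive (smooth1_bump _ _ _)) _.
have [||c _ hc] := @EVT_max R f (- 1) 1; first by lra.
  exact: continuous_subspaceT.
exists (f c + 1); first by rewrite ltr_wpDl// normr_ge0.
move=> t t1; apply: (le_trans (hc t _)); first by rewrite in_itv.
by rewrite lerDl.
Qed.

Variables (r g : R).
Hypotheses (r0 : 0 < r) (g0 : 0 < g) (gr : 2 * N%:R / g <= r).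

(** The centre of the small cube: moved inwards from the boundary point r e_1 by
2N/g, enough for a cube of half-width 1/g to stay inside the ball. *)
Definition corner (i : 'I_N) : R := if i == ord0 then r - 2 * N%:R / g else 0.
Definition corner_lo (t : R) (i : 'I_N) : R := corner i - t * g^-1.
Definition corner_hi (t : R) (i : 'I_N) : R := corner i + t * g^-1.

(** The norm is at least the first coordinate and at most the sum of the absolute
values of the coordinates. *)
Lemma corner_box x : cbox (corner_lo 1) (corner_hi 1) x -> r - 3 * N%:R / g <= enorm x /\ enorm x < r.
Proof.
move=> xb; have gi0 : 0 < g^-1 by rewrite invr_gt0.
have c0 i : 0 <= corner i by rewrite /corner; case: ifP => // _; rewrite subr_ge0.
have N1 : 1 <= N%:R :> R by rewrite ler1n.
split.
  have := xb ord0; rewrite /corner_lo /corner eqxx mul1r => /andP[h _].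
  apply: le_trans (le_coord_enorm _ ord0); apply: le_trans (ler_norm _).
  by apply: le_trans h; nra.
apply: (le_lt_trans (enorm_le_sum x)).
apply: (@le_lt_trans _ _ (\sum_i (corner i + g^-1))).
  apply: ler_sum => i _; have := xb i; rewrite /corner_lo /corner_hi mul1r => /andP[h1 h2].
  by rewrite ler_norml h2 andbT; have := c0 i; lra.
rewrite big_split/= sumr_const card_ord -mulr_natl.
rewrite (bigD1 ord0)//= [X in _ + X + _]big1 ?addr0 => [|i /negbTE i0]; last first.
  by rewrite /corner i0.
by rewrite /corner eqxx; nra.
Qed.

Definition corner_bump : 'rV[R]_N -> R := boxbump (corner_lo 1) (corner_hi 1) g.

Lemma corner_bump_test Omega : cbox (corner_lo 1) (corner_hi 1) `<=` Omega -> test_function Omega corner_bump.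
Proof. exact: test_function_boxbump. Qed.

Lemma corner_bump_lower x : cbox (corner_lo 2^-1) (corner_hi 2^-1) x ->
  (expinv 2^-1 ^+ 2) ^+ N <= corner_bump x.
Proof.
move=> xb; rewrite /corner_bump /boxbump /prodfun -[in leLHS](card_ord N) -prodr_const.
apply: ler_prod => i _; rewrite exprn_ge0 ?expinv_ge0//=.
have := xb i; rewrite /corner_lo /corner_hi !mul1r => /andP[h1 h2].
rewrite /bump expr2 ler_pM ?expinv_ge0//; apply: expinv_le.
  rewrite -[leLHS](mulVKf (lt0r_neq0 g0)) ler_pM2l//; lra.
rewrite -[leLHS](mulVKf (lt0r_neq0 g0)) ler_pM2l//; lra.
Qed.

Lemma corner_bump_gradn_le (M : R) x : 0 < M ->
  (forall t, - 1 <= t <= 1 -> `|derive1 (bump (- 1) 1 (1 : R)) t| <= M) ->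
  cbox (corner_lo 1) (corner_hi 1) x -> gradn corner_bump x <= N%:R * (g * M).
Proof.
move=> M0 hM xb; rewrite /gradn; apply: (le_trans (enorm_le_sum _)).
rewrite mulr_natl -[X in _ *+ X](card_ord N) -sumr_const.
apply: ler_sum => i _; rewrite mxE /corner_bump /boxbump partial_prodfun; last first.
  by move=> j; exact: smooth1_bump.
rewrite /prodfun normr_prod (bigD1 i)//= -[leRHS]mulr1.
apply: ler_pM; rewrite ?normr_ge0 ?prodr_ge0//.
  rewrite /pderiv eqxx /corner_lo /corner_hi !mul1r derive1_bump_scale// normrM (gtr0_norm g0) ler_pM2l//.
  apply: hM; have := xb i; rewrite /corner_lo /corner_hi !mul1r => /andP[h1 h2].
  rewrite -mulrBr -ler_norml normrM (gtr0_norm g0) -ler_pdivlMl// mulr1 ler_norml.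
  by apply/andP; split; lra.
apply: (@le_trans _ _ (\prod_(j < N | j != i) (1 : R))); last by rewrite big1.
apply: ler_prod => j /negbTE ji; rewrite normr_ge0/= /pderiv ji ger0_norm ?bump_ge0//.
exact: bump_le1.
Qed.

(** Moving inwards by 3N/g costs the power g only a constant factor, from
1 - u >= exp(-2u) for u <= 1/2. *)
Lemma powR_corner_ge : 6 * N%:R / g <= r ->
  r `^ g * expR (- (6 * N%:R / r)) <= (r - 3 * N%:R / g) `^ g.
Proof.
move=> gr6; pose u : R := 3 * N%:R / (g * r).
have u0 : 0 < u by rewrite divr_gt0 ?mulr_gt0 ?ltr0n.
have u2 : u <= 2^-1.
  rewrite /u ler_pdivrMr ?mulr_gt0//; move: gr6; rewrite ler_pdivrMr//; lra.
have -> : r - 3 * N%:R / g = r * (1 - u) by rewrite /u; field; rewrite !gt_eqF.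
have -> : - (6 * N%:R / r) = - (2 * u) * g by rewrite /u; field; rewrite !gt_eqF.
have u1 : 0 < 1 - u by lra.
rewrite (powRM g (ltW r0) (ltW u1)) expRM ler_wpM2l ?powR_ge0//.
apply: ge0_ler_powR; rewrite ?nnegrE ?expR_ge0 ?(ltW g0) ?(ltW u1)//.
rewrite expRN -[leLHS]mul1r ler_pdivrMr ?expR_gt0//.
have h := expR_ge1Dx (2 * u).
apply: (@le_trans _ _ ((1 - u) * (1 + 2 * u))); first by nra.
by rewrite ler_wpM2l// ltW.
Qed.

(** The gradient is at most N g M on the cube of half-width 1/g, and the function
is bounded below on the cube of half the size. *)
Lemma competitor_bounds (p alpha q M : R) : 0 < p -> 0 <= alpha -> 0 < q -> 0 < M ->
  (forall t, - 1 <= t <= 1 -> `|derive1 (bump (- 1) 1 (1 : R)) t| <= M) ->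
  6 * N%:R / g <= r ->
  let B := eball N r in
  [/\ admissible p alpha B corner_bump,
    (wint p alpha B (wgradn B corner_bump) <=
      ((N%:R * (g * M)) `^ p * r `^ alpha * (2 / g) ^+ N)%:E)%E,
    ((((expinv 2^-1 ^+ 2) ^+ N) `^ q * (r `^ g * expR (- (6 * N%:R / r))) * g^-1 ^+ N)%:E
       <= wint q g B corner_bump)%E &
    (wint q g B corner_bump < +oo)%E].
Proof.
move=> p0 al0 q0 M0 hM gr6 B.
have oB : open B := @open_eball R N r; have mB := open_measurable_row oB.
have gi0 : 0 < g^-1 by rewrite invr_gt0.
pose A := cbox (corner_lo 1) (corner_hi 1); have mA : measurable A by exact: measurable_cbox.
pose A' := cbox (corner_lo 2^-1) (corner_hi 2^-1); have mA' : measurable A' by exact: measurable_cbox.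
have AA : A' `<=` A.
  by move=> x h i; have /andP[] := h i; rewrite /corner_lo /corner_hi => h1 h2; apply/andP; split; lra.
have AB : A `<=` B by move=> x /corner_box[].
have A'B := subset_trans AA AB.
have muA : mu A = ((2 / g) ^+ N)%:E.
  rewrite lebesgue_cbox => [|i]; last by rewrite /corner_lo /corner_hi; lra.
  congr EFin; rewrite -[in RHS](card_ord N) -prodr_const; apply: eq_bigr => i _.
  by rewrite /corner_lo /corner_hi; ring.
have muA' : mu A' = (g^-1 ^+ N)%:E.
  rewrite lebesgue_cbox => [|i]; last by rewrite /corner_lo /corner_hi; lra.
  congr EFin; rewrite -[in RHS](card_ord N) -prodr_const; apply: eq_bigr => i _.
  by rewrite /corner_lo /corner_hi; lra.
have tA : test_function A corner_bump by exact: corner_bump_test.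
have tB : test_function B corner_bump by exact: corner_bump_test.
have C := test_function_C1 tB; have [cc _ _] := C.
have mphi : measurable_fun B corner_bump.
  by apply: measurable_funTS; exact: continuous_measurable_row.
have mgrad : measurable_fun B (gradn corner_bump) by apply: measurable_funTS; exact: measurable_gradn.
have bound (f : 'rV[R]_N -> R) (K s a : R) : 0 <= K -> 0 < s -> 0 <= a -> (forall x, ~ A x -> f x = 0) ->
    (forall x, A x -> `|f x| <= K) -> measurable_fun B f ->
    (wint s a B f <= (K `^ s * r `^ a * (2 / g) ^+ N)%:E)%E.
  move=> K0 s0 a0 f0 fK mf; rewrite EFinM -muA; apply: wint_le_scaled => //.
    by rewrite mulr_ge0 ?powR_ge0.
  move=> x Bx; rewrite indicE; case: (boolP (x \in A)) => [/set_mem Ax|/negP nA].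
    rewrite mulr1; apply: ler_pM; rewrite ?powR_ge0//.
      by apply: ge0_ler_powR; rewrite ?nnegrE ?(ltW s0)//; exact: fK.
    by apply: ge0_ler_powR; rewrite ?nnegrE ?enorm_ge0 ?(ltW r0)//; exact: ltW.
  rewrite f0; last by move=> Ax; apply: nA; rewrite inE.
  by rewrite normr0 powR0 ?gt_eqF// mul0r mulr0.
have b1 x : A x -> `|corner_bump x| <= 1.
  by move=> _; rewrite ger0_norm ?boxbump_ge0// boxbump_le1.
have z1 x : ~ A x -> corner_bump x = 0 by move=> Ax; exact: (test_function_eq0 tA).
have z2 x : ~ A x -> gradn corner_bump x = 0 by move=> Ax; exact: (gradn_eq0 tA).
have D := bound (gradn corner_bump) (N%:R * (g * M)) p alpha.
have {}D : (wint p alpha B (gradn corner_bump) <=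
      ((N%:R * (g * M)) `^ p * r `^ alpha * (2 / g) ^+ N)%:E)%E.
  apply: D => //; first by rewrite !mulr_ge0// ltW.
  by move=> x Ax; rewrite ger0_norm ?gradn_ge0//; exact: corner_bump_gradn_le.
pose d := ((expinv 2^-1 ^+ 2) ^+ N : R).
have d0 : 0 < d by rewrite !exprn_gt0// expinv_gt0.
have L : ((d `^ q * (r `^ g * expR (- (6 * N%:R / r))) * g^-1 ^+ N)%:E <= wint q g B corner_bump)%E.
  rewrite EFinM -muA'; apply: scaled_le_wint => //.
    by rewrite !mulr_ge0 ?powR_ge0 ?expR_ge0.
  move=> x A'x; have [h1 _] := corner_box (AA _ A'x).
  apply: ler_pM; rewrite ?powR_ge0 ?mulr_ge0 ?powR_ge0 ?expR_ge0//.
    apply: ge0_ler_powR; rewrite ?nnegrE ?(ltW q0) ?(ltW d0)//.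
    rewrite ger0_norm ?boxbump_ge0//; exact: corner_bump_lower.
  apply: (le_trans (powR_corner_ge gr6)).
  apply: ge0_ler_powR; rewrite ?nnegrE ?enorm_ge0 ?(ltW g0)//.
  have Ng : 0 <= N%:R / g by rewrite divr_ge0// ltW.
  by move: gr6; rewrite -!mulrA; lra.
have W0 : wW1p0 p alpha B corner_bump.
  apply: wW1p0_test => //.
    by apply: le_lt_trans (bound _ 1 p alpha _ _ _ _ _ _) _; rewrite ?ltry//; exact: ltW.
  by apply: le_lt_trans D _; rewrite ltry.
split.
- split; first exact: W0.
  move=> ae0.
  have : wint q g B corner_bump = 0%E.
    rewrite -[RHS](integral0 mu B); apply: ae_eq_integral => //.
      exact: measurable_weight.
    by apply: filterS ae0 => x E Bx; rewrite E// normr0 powR0 ?gt_eqF// mul0r.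
  move=> w0; move: L; rewrite w0 lee_fin leNgt => /negP; apply.
  apply: mulr_gt0; last exact: exprn_gt0.
  by apply: mulr_gt0; [exact: powR_gt0|apply: mulr_gt0; [exact: powR_gt0|exact: expR_gt0]].
- by rewrite (wint_wgradn_test p alpha oB tB); exact: D.
- exact: L.
- by apply: le_lt_trans (bound _ 1 q g _ _ _ _ _ _) _; rewrite ?ltry//; exact: ltW.
Qed.

End competitor.

(** * Comparison of the two bounds *)

Section conclusion.
Context {R : realType}.

(** The weight vanishes at most at the origin, which is a null set. *)
Lemma wint_gt0 {n} (q gamma : R) (Omega : set 'rV[R]_n.+1)
    (v : 'rV[R]_n.+1 -> R) : measurable Omega -> measurable_fun Omega v -> 0 < q ->
  ~ {ae lebesgue_row n.+1, forall x, Omega x -> v x = 0} ->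
  (0 < wint q gamma Omega v)%E.
Proof.
move=> mO mv q0 nz; rewrite lt_neqAle wint_ge0 andbT eq_sym.
apply/negP => /eqP w0; apply: nz.
have mw := measurable_weight q gamma mO mv.
have : {ae lebesgue_row n.+1, forall x, Omega x -> (`|v x| `^ q * enorm x `^ gamma)%:E = 0%E}.
  apply/(ae_eq_integral_abs _ mO mw).
  rewrite -[RHS]w0; apply: eq_integral => x _; rewrite gee0_abs//; exact: weight_ge0.
have : {ae lebesgue_row n.+1, forall x : 'rV[R]_n.+1, x != 0}.
  exists [set 0%R]; split; [|exact: null_row0|].
    by rewrite row0_box; apply: (@measurable_box R n.+1 (fun=> [set 0%R])) => i; exact: measurable_set1.
  by move=> x /= /negP; rewrite negbK => /eqP.
apply: filterS2 => x x0 E Ox.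
have ex : enorm x != 0 by rewrite enorm_eq0.
have /eqP := E Ox; rewrite eqe mulf_eq0 !powR_eq0 (negbTE ex) !andFb orbF normr_eq0.
by move=> /andP[/eqP].
Qed.

Lemma quotient_EFin {n} (p q alpha gamma a b : R) (Omega : set 'rV[R]_n) v : 0 < b ->
  wint p alpha Omega (wgradn Omega v) = a%:E -> wint q gamma Omega v = b%:E ->
  weighted_quotient p q alpha gamma Omega v = (a / b `^ (p / q))%:E.
Proof.
move=> b0 ha hb; rewrite /weighted_quotient ha hb poweR_EFin.
by rewrite inver gt_eqF ?powR_gt0.
Qed.

(** The comparison of the two bounds, with [A g^(p-N)] and [B r^g g^(-N)] the
estimates for the bump and [w] the weighted integral of the radial function. As
(p/q)(q/p) = 1 the factor [w] cancels, and so does [r^g]; the powers of [g] add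
up to (p-N) q/p + N - (k+1) = -(N-1)(q/p-1). *)
Lemma exponent_bound (L p q r N n b k g w : R) (kp A B : R) :
  0 < p -> 0 < q -> 0 < r -> 0 < g -> 0 < w -> 0 < B -> 0 < A -> 0 <= L ->
  k = q * (1 - p^-1) -> 0 < k -> g / 2 <= n + g - b ->
  kp * w <= L * (2 `^ (p + 1) * (A * g `^ (p - N) / (B * (r `^ g * g `^ (- N))) `^ (p / q)) * w `^ (p / q)) `^ (q / p) *
     (2 * (2 * k) `^ k * r `^ (n + g - b + k + 1) * (n + g - b) `^ (- (k + 1))) ->
  kp <= L * (2 `^ (p + 1) * A) `^ (q / p) / B * (2 * (2 * k) `^ k) * r `^ (n - b + k + 1) * 2 `^ (k + 1) *
    g `^ (- ((N - 1) * (q / p - 1))).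
Proof.
move=> p0 q0 r0 g0 w0 B0 A0 L0 kE k0 hm H.
have pq : p / q * (q / p) = 1 by field; rewrite !gt_eqF.
have BB0 : 0 < B * (r `^ g * g `^ (- N)) by rewrite !mulr_gt0 ?powR_gt0.
have H1 : (2 `^ (p + 1) * (A * g `^ (p - N) / (B * (r `^ g * g `^ (- N))) `^ (p / q)) * w `^ (p / q)) `^ (q / p) =
   (2 `^ (p + 1) * A) `^ (q / p) * (g `^ ((p - N) * (q / p)) / (B * (r `^ g * g `^ (- N)))) * w.
  have -> : 2 `^ (p + 1) * (A * g `^ (p - N) / (B * (r `^ g * g `^ (- N))) `^ (p / q)) * w `^ (p / q) =
     (2 `^ (p + 1) * A) * (g `^ (p - N) * ((B * (r `^ g * g `^ (- N))) `^ (- (p / q)) * w `^ (p / q))).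
    by rewrite (powRN (B * _) (p / q)); ring.
  move: BB0; set X := B * _ => X0.
  have S0 : 0 <= 2 `^ (p + 1) * A by rewrite mulr_ge0 ?powR_ge0 ?(ltW A0).
  have Xw : 0 <= X `^ (- (p / q)) * w `^ (p / q) by rewrite mulr_ge0 ?powR_ge0.
  rewrite (powRM _ S0 (mulr_ge0 (powR_ge0 g _) Xw)) (powRM _ (powR_ge0 g _) Xw).
  rewrite (powRM _ (powR_ge0 X _) (powR_ge0 w _)) -!powRrM mulNr pq.
  by rewrite powR_inv1 ?(ltW X0)// powRr1 ?(ltW w0)//; ring.
set m := n + g - b in hm H.
have m0 : 0 < m by apply: lt_le_trans hm; rewrite divr_gt0.
have H2 : m `^ (- (k + 1)) <= 2 `^ (k + 1) * g `^ (- (k + 1)).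
  have -> : 2 `^ (k + 1) * g `^ (- (k + 1)) = (g / 2) `^ (- (k + 1)).
    rewrite powRM ?(ltW g0)// -(@powR_inv1 _ 2)// -powRrM mulN1r opprK mulrC.
    by [].
  have k1 : 0 < k + 1 by rewrite addr_gt0.
  rewrite !powRN lef_pV2 ?posrE ?powR_gt0 ?divr_gt0//.
  by apply: ge0_ler_powR; rewrite ?nnegrE ?(ltW m0) ?(ltW k1) ?divr_ge0 ?(ltW g0).
rewrite H1 in H.
have er : r `^ (m + k + 1) = r `^ g * r `^ (n - b + k + 1).
  rewrite -powRD; first by congr powR; rewrite /m; ring.
  by rewrite (gt_eqF r0) implybT.
have eg : g `^ (- ((N - 1) * (q / p - 1))) = g `^ ((p - N) * (q / p)) / g `^ (- N) * g `^ (- (k + 1)).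
  rewrite -powRN opprK -!powRD ?(gt_eqF g0) ?implybT//.
  by congr powR; rewrite kE; field; rewrite gt_eqF.
rewrite -(ler_pM2r w0); apply: (le_trans H); rewrite er eg.
set S := (_ * A) `^ _; set Q := (2 * k) `^ k; set rg := r `^ g; set rn := r `^ (n - b + k + 1).
set gN := g `^ (- N); set g1 := g `^ (_ * _); set gk := g `^ (- (k + 1)) in H2 *.
have rg0 : 0 < rg by rewrite powR_gt0.
have gN0 : 0 < gN by rewrite powR_gt0.
apply: (@le_trans _ _ (L * (S * (g1 / (B * (rg * gN))) * w) * (2 * Q * (rg * rn) * (2 `^ (k + 1) * gk)))).
  have X0 : 0 <= (B * (rg * gN))^-1 by rewrite invr_ge0 ltW.
  rewrite ler_wpM2l//; first by rewrite !mulr_ge0 ?powR_ge0// ltW.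
  by rewrite ler_wpM2l// !mulr_ge0 ?powR_ge0.
rewrite le_eqVlt; apply/orP; left; apply/eqP; field.
by rewrite !gt_eqF.
Qed.

(** The threshold makes the bump fit into the ball, keeps the exponent of s in
the radial integral above g/2, and reverses the conclusion of
[exponent_bound]. *)
Lemma large_gamma_not_radial {k} (r p alpha q : R) : 0 < r -> 1 < p -> 0 <= alpha -> p < q ->
  exists gstar : R, alpha <= gstar /\
    forall gamma : R, gstar < gamma ->
    forall v : 'rV[R]_k.+2 -> R,
      minimizer p q alpha gamma (eball k.+2 r) v ->
      ~ radially_symmetric (eball k.+2 r) v.
Proof.
move=> r0 p1 al0 pq; have p0 : 0 < p by exact: lt_trans p1.
have q0 : 0 < q by exact: lt_trans pq.
set n := k.+1; pose N := n.+1; pose Nr : R := N%:R.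
have Nr1 : 0 < Nr - 1 by rewrite /Nr subr_gt0 ltr1n.
have Nr0 : 0 < Nr by rewrite ltr0n.
have [M M0 hM] := @derive1_bump_bound R.
pose b := (alpha + n%:R) / p * q.
pose kq := q * (1 - p^-1).
have kq0 : 0 < kq by rewrite mulr_gt0// subr_gt0 invf_lt1.
pose A := (Nr * M) `^ p * r `^ alpha * 2 ^+ N.
have A0 : 0 < A.
  have NM : 0 < Nr * M by rewrite mulr_gt0.
  by rewrite /A mulr_gt0 ?exprn_gt0// mulr_gt0 ?powR_gt0.
pose Bc := ((expinv 2^-1 ^+ 2) ^+ N) `^ q * expR (- (6 * Nr / r)).
have Bc0 : 0 < Bc.
  by rewrite mulr_gt0 ?expR_gt0// powR_gt0// !exprn_gt0// expinv_gt0.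
pose Ms := shell_vol (R := R) (n := n); have Ms0 : 0 < Ms := shell_vol_gt0.
pose L := Ms * (sphere_const (R := R) (n := n) / Ms) `^ q.
have L0 : 0 <= L by rewrite mulr_ge0 ?powR_ge0// ltW.
pose C := L * (2 `^ (p + 1) * A) `^ (q / p) / Bc * (2 * (2 * kq) `^ kq) *
  r `^ (n%:R - b + kq + 1) * 2 `^ (kq + 1).
pose kp := kappa (R := R) (n := n); have kp0 : 0 < kp := kappa_gt0.
pose ep := (Nr - 1) * (q / p - 1).
have ep0 : 0 < ep by rewrite mulr_gt0// subr_gt0 ltr_pdivlMr// mul1r.
(* in this order: the required lower bound, positivity, the cube fits into the
   ball, the exponent m below is at least g/2, the final contradiction *)
pose g1 := Num.max alpha (Num.max 1 (Num.max (6 * Nr / r) (Num.max (2 * b) ((C / kp) `^ (ep^-1))))).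
exists g1; split; first by rewrite le_max lexx.
move=> g; rewrite !gt_max => /and5P[ga g1' g6 gb gC] v [[Wv nz] vmin] vrad.
have g0 : 0 < g by exact: lt_trans g1'.
have gr6 : 6 * N%:R / g <= r by rewrite ler_pdivrMr// [leRHS]mulrC -ler_pdivrMr// ltW.
have gr : 2 * N%:R / g <= r.
  apply: le_trans gr6; rewrite ler_wpM2r ?invr_ge0 ?(ltW g0)// ler_wpM2r//; lra.
have := competitor_bounds r0 g0 gr p0 al0 q0 M0 hM gr6.
set phi := corner_bump r g; move: phi => phi [adm D1 W1 Wfin].
set B := eball _ r in Wv nz vmin vrad adm D1 W1 Wfin *.
have oB : open B := @open_eball R N r; have mB := open_measurable_row oB.
have [[[mv _] _ vn] _] := Wv.
have Wgt0 : (0 < wint q g B v)%E by exact: wint_gt0.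
have Dfin : (wint p alpha B (wgradn B v) < +oo)%E.
  move: vn; rewrite (@wW1p_normE R n p alpha B v (lt0r_neq0 p0)) => /lty_poweRy h.
  have {}h := h (invr_neq0 (lt0r_neq0 p0)).
  by apply: le_lt_trans h; apply: leeDr; exact: wint_ge0.
pose m := n%:R + g - b.
have gm : g / 2 <= m.
  have n0 : 0 <= n%:R :> R by [].
  by rewrite /m; lra.
have m0 : 0 < m by apply: lt_le_trans gm; rewrite divr_gt0.
pose Q := 2 * (2 * kq) `^ kq * r `^ (m + kq + 1) * m `^ (- (kq + 1)).
have bound E : 0 < E -> ((2 `^ p)%:E * wint p alpha B (wgradn B v) < E%:E)%E ->
    (kp%:E * wint q g B v <= (L * E `^ (q / p) * Q)%:E)%E.
  move=> E0 DE; have := radial_wint_le g r0 (ltW p1) al0 q0 E0 Wv vrad DE.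
  move=> /le_trans; apply.
  rewrite [X in (_ <= X)%E]EFinM; apply: lee_wpmul2l.
    by rewrite lee_fin mulr_ge0 ?powR_ge0.
  exact: profile_integral_le.
have Dge0 : (0 <= wint p alpha B (wgradn B v))%E by exact: wint_ge0.
move: Dfin Dge0 bound; case dE : (wint p alpha B (wgradn B v)) => [d||]// _; rewrite lee_fin => d0 bound.
(* any admissible E shows that W(v) is finite *)
have Wlty : (wint q g B v < +oo)%E.
  have E1 : 0 < 2 `^ p * d + 1 by rewrite ltr_wpDl// mulr_ge0 ?powR_ge0.
  have := bound _ E1; rewrite -EFinM lte_fin ltrDl => /(_ ltr01).
  by case: (wint q g B v) => [w||]//; rewrite ?ltry// gt0_muley ?lte_fin.
move: Wgt0 Wlty bound; case wE : (wint q g B v) => [w||]//; rewrite lte_fin => w0 _ bound.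
have c1 : (Nr * (g * M)) `^ p * r `^ alpha * (2 / g) ^+ N = A * g `^ (p - Nr).
  have NM0 : 0 <= Nr * M by rewrite mulr_ge0// ltW.
  have -> : Nr * (g * M) = (Nr * M) * g by ring.
  rewrite (powRM p NM0 (ltW g0)) exprMn powRD ?(gt_eqF g0) ?implybT// powRN powR_mulrn ?(ltW g0)//.
  by rewrite /A exprVn; ring.
have c2 : ((expinv 2^-1 ^+ 2) ^+ N) `^ q * (r `^ g * expR (- (6 * Nr / r))) * g^-1 ^+ N =
    Bc * (r `^ g * g `^ (- Nr)).
  by rewrite powRN powR_mulrn ?(ltW g0)// /Bc exprVn; ring.
rewrite c1 in D1; rewrite c2 in W1.
pose X := Bc * (r `^ g * g `^ (- Nr)).
have X0 : 0 < X.
  by rewrite mulr_gt0//; apply: mulr_gt0; exact: powR_gt0.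
have Dphi0 : (0 <= wint p alpha B (wgradn B phi))%E by exact: wint_ge0.
move: D1 Dphi0; case dpE : (wint p alpha B (wgradn B phi)) => [dp||]//; rewrite !lee_fin => D1 dp0.
move: W1 Wfin; case wpE : (wint q g B phi) => [wp||]//; rewrite lee_fin => W1 _.
have wp0 : 0 < wp by exact: lt_le_trans W1.
pose U := A * g `^ (p - Nr) / X `^ (p / q).
have U0 : 0 < U.
  by rewrite divr_gt0 ?powR_gt0//; apply: mulr_gt0 => //; exact: powR_gt0.
have dU : d <= U * w `^ (p / q).
  have : (weighted_quotient p q alpha g B v <= weighted_quotient p q alpha g B phi)%E.
    by rewrite vmin; apply: ereal_inf_lbound; exists phi.
  rewrite (quotient_EFin w0 dE wE) (quotient_EFin wp0 dpE wpE) lee_fin => h.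
  rewrite -ler_pdivrMr ?powR_gt0//; apply: (le_trans h); rewrite /U.
  apply: ler_pM => //; first by rewrite invr_ge0 powR_ge0.
  rewrite lef_pV2 ?posrE ?powR_gt0//.
  by apply: ge0_ler_powR; rewrite ?nnegrE ?divr_ge0 ?(ltW p0) ?(ltW q0) ?(ltW X0) ?(ltW wp0).
(* twice the bound on 2^p D(v), for the strict inequality required of E *)
pose E := 2 `^ (p + 1) * U * w `^ (p / q).
have Uw0 : 0 < U * w `^ (p / q) by rewrite mulr_gt0// powR_gt0.
have P2 : 0 < 2 `^ p :> R by rewrite powR_gt0.
have EE : E = 2 `^ p * 2 * (U * w `^ (p / q)).
  have p2 : 2 `^ (p + 1) = 2 `^ p * 2 :> R.
    by rewrite powRD ?powRr1// pnatr_eq0 implybT.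
  by rewrite /E p2 -!mulrA.
have E0 : 0 < E by rewrite EE; apply: mulr_gt0 => //; exact: mulr_gt0.
have dE' : 2 `^ p * d < E.
  rewrite EE -mulrA ltr_pM2l//; apply: (le_lt_trans dU).
  by rewrite ltr_pMl// ltr1n.
have := bound E E0; rewrite -!EFinM lte_fin lee_fin => /(_ dE') H.
have := exponent_bound p0 q0 r0 g0 w0 Bc0 A0 L0 (erefl kq) kq0 gm H.
rewrite -/C -/ep => kpC.
have C0 : 0 <= C.
  by rewrite /C !mulr_ge0 ?invr_ge0 ?powR_ge0// ltW.
have : C / kp < g `^ ep.
  rewrite -[ltLHS](@powRr1 _ (C / kp)) ?divr_ge0 ?(ltW kp0)//.
  rewrite -(mulVf (lt0r_neq0 ep0)) powRrM.
  by apply: gt0_ltr_powR => //; rewrite nnegrE ?powR_ge0 ?(ltW g0).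
rewrite ltr_pdivrMr// => h; move: kpC; rewrite leNgt => /negP; apply.
by rewrite powRN ltr_pdivrMr ?powR_gt0// mulrC.
Qed.

End conclusion.

Theorem theorem1p1 (R : realType) (N : nat) (r p alpha q : R) :
  (2 <= N)%N ->
  0 < r ->
  1 <= p <= N%:R ->
  0 <= alpha < N%:R * (p - 1) ->
  p < q -> (q%:E < q0 N p alpha)%E ->
  exists gamma_star : R, alpha <= gamma_star /\
    forall gamma : R, gamma_star < gamma ->
    forall v : 'rV[R]_N -> R,
      minimizer p q alpha gamma (eball N r) v ->
      ~ radially_symmetric (eball N r) v.
Proof.
case: N => [|[|k]]// _ r0 _ /andP[al0 alN] pq _.
apply: large_gamma_not_radial => //.
have := le_lt_trans al0 alN.
by rewrite pmulr_rgt0 ?ltr0n// subr_gt0.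
Qed.
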